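(* Let $k,l$ be integers with $1\le k\le l+1$ and $k\ne l+1$, put $p=l-k+1\ge 1$, let $f,g$ be functions analytic at $0$ with $f(0)\ne 0$, and let $F=g/f$. Consider the system $$\dot z=-w\,f(z)+z^{l+1}g(z),\qquad \dot w=k\,z^{2k-1}f(z)+k\,w\,z^{l}g(z).$$ The first return to the transversal $w=z^{l+1}F(z)$ ($z>0$ small) of the solution with $z(0)=\epsilon$, $w(0)=\epsilon^{l+1}F(\epsilon)$ ($\epsilon>0$ small) is attained at a value $z$ given by a convergent power series in $\epsilon$ whose first terms are as follows. Let $$B_0=2(p+2k)F(0),\quad B_1=2(p+2k+1)F'(0),\quad \theta_p=(-1)^{p+k-1},\quad \Phi_{q,k}(1)=\int_0^1 s^{q+k-1}(1-s^{2k})^{1/2}ds .$$ For $p\ge 2$ $$z=\epsilon+2\epsilon^{p+1}\frac{B_0\Phi_{p,k}(1)}{2k}(1+\theta_p)+2\epsilon^{p+2}\frac{B_1\Phi_{p+1,k}(1)}{2k}(1-\theta_p)+O(\epsilon^{p+3}),$$ and for $p=1$ $$z=\epsilon+2\epsilon^{2}\frac{B_0\Phi_{1,k}(1)}{2k}(1+\theta_1)+2\epsilon^{3}\left[\frac{(1-\theta_1)B_1\Phi_{2,k}(1)+\frac{1+\theta_1}{k}B_0^2\Phi_{1,k}(1)^2}{2k}+\left(\frac{B_0\Phi_{1,k}(1)}{2k}(1+\theta_1)\right)^2\right]+O(\epsilon^{4}).$$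
   Context: Time is eliminated from the system, and the return is that of the orbit curve through the starting point, followed counterclockwise around the origin: with $z=\epsilon x$ and $w=z^{l+1}F(z)+\epsilon^k y$, the curve is parametrized so that $\dot x=-2y$, and it passes successively through the quadrants $x>0,y>0$; $x<0,y>0$; $x<0,y<0$; $x>0,y<0$ before returning to the positive $x$-axis (which corresponds to the transversal). *)

(* Defs.v *)
From Stdlib Require Import Reals.
From Coquelicot Require Import Coquelicot.
Open Scope R_scope.

Definition analytic_at_0 (f : R -> R) : Prop :=
  exists a : nat -> R, locally 0 (fun z => is_pseries a z (f z)).

Definition ratio (f g : R -> R) (z : R) : R := g z / f z.

(** Two-sided derivatives are required on the closed segment between [0]
    and [T], where [T] may have either sign. *)
Definition is_solution (k l : nat) (f g : R -> R) (z w : R -> R) (T : R) : Prop :=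
  forall t : R, Rmin 0 T <= t <= Rmax 0 T ->
    is_derive z t (- w t * f (z t) + z t ^ (l + 1) * g (z t)) /\
    is_derive w t (INR k * z t ^ (2 * k - 1) * f (z t)
                   + INR k * w t * z t ^ l * g (z t)).

(** Signed height of [(z, w)] over the curve [w = z^(l+1) F(z)].  In the
    coordinates [z = eps * x], [w = z^(l+1) F(z) + eps^k * y] it is
    [eps^k * y], so it has the sign of [y]. *)
Definition height (l : nat) (f g : R -> R) (z w : R) : R :=
  w - z ^ (l + 1) * ratio f g z.

Definition on_transversal (l : nat) (f g : R -> R) (z w : R) : Prop :=
  0 < z /\ w = z ^ (l + 1) * ratio f g z.

(** Running time is [s * T] with [0 <= s <= 1], so that [T < 0] means following
    the orbit backwards in time. *)
Definition first_return (k l : nat) (f g : R -> R) (eps : R)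
    (z w : R -> R) (T : R) : Prop :=
  T <> 0 /\
  is_solution k l f g z w T /\
  z 0 = eps /\ w 0 = eps ^ (l + 1) * ratio f g eps /\
  on_transversal l f g (z T) (w T) /\
  forall s : R, 0 < s < 1 -> ~ on_transversal l f g (z (s * T)) (w (s * T)).

(** The direction of time realizing a counterclockwise turn depends on the sign
    of [f 0]; it is selected here by the order in which the orbit visits the
    open quadrants of the [(x, y)] plane. *)
Definition counterclockwise (l : nat) (f g : R -> R)
    (z w : R -> R) (T : R) : Prop :=
  let x s := z (s * T) in
  let y s := height l f g (z (s * T)) (w (s * T)) in
  exists s1 s2 s3 : R,
    0 < s1 /\ s1 < s2 /\ s2 < s3 /\ s3 < 1 /\
    (forall s, 0 < s < s1 -> 0 < x s /\ 0 < y s) /\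
    (forall s, s1 < s < s2 -> x s < 0 /\ 0 < y s) /\
    (forall s, s2 < s < s3 -> x s < 0 /\ y s < 0) /\
    (forall s, s3 < s < 1 -> 0 < x s /\ y s < 0).

(** [Phi_{q,k}(1)]; the [1] is the upper bound of integration. *)
Definition Phi1 (q k : nat) : R :=
  RInt (fun s => s ^ (q + k - 1) * sqrt (1 - s ^ (2 * k))) 0 1.

(* Main.v *)
(** With [h = w - z^(l+1) F(z)] the system reads [z' = - f h],
    [h' = f (k z^(2k-1) + k z^(2l+1) F^2 + z^l ((k+l+1) F + z F') h)].  In the generalized polar
    coordinates [z = rho C(t)], [h = rho^k S(t)], where [C^(2k) + S^2 = 1], eliminating time turns
    it into a scalar equation [d rho / dt = rho H(t, rho)] with [H] a power series in [rho] of
    order [p], so for [f > 0] the orbit turns counterclockwise and returns at [t = 2 PI].  The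
    ansatz [rho = eps * sum v_n(t) eps^n] gives a triangular system of integrations for the [v_n];
    weighted l1 bounds on the coefficients, uniform in [t], make the series converge, so the return
    value is [eps * sum v_n(2 PI) eps^n].  The first coefficients reduce to integrals of
    [S^2 C^n] over the curve, i.e. to [Phi], because the other terms are exact forms in [C].
    The orbit in the original time is recovered by inverting the time function, a local Gronwall
    argument shows that it is the only one, and [f < 0] follows by reversing time. *)

Require Import Defs.
From Stdlib Require Import Reals Lra Lia Arith FunctionalExtensionality.
From Coquelicot Require Import Coquelicot.
Open Scope R_scope.

(** * Summable coefficient sequences *)

(** The exponent [p] comes from an energy. In the derivative of [z^(2k) + h^2 = rho^(2k)] the
    dominant terms of [z'] and [h'] cancel, and the relative change of [rho] that remains is smaller
    than the angular speed by a factor [rho^p]. Hence the angle can replace time, [v_n = 0] for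
    [0 < n < p], and the parity of [l = p + k - 1] decides which of the two next coefficients
    survives a full turn. Convergence is obtained without a majorant equation: truncated l1 norms
    are bounded by induction on the truncation length, and the vanishing constant term of [H] makes
    the bound close once the radius is small. The statement speaks about every differentiable
    solution, and a competing solution is not known to remain where [f] and [g] are controlled.
    Uniqueness therefore has to be proved with estimates that hold only while the two solutions are
    close. The requirement on the order of the quadrants fixes the direction of time, so that two
    returns can be compared on a common time interval. *)

(** The iterates [U j] stabilize: [U j n] is final as soon as [j > n], so the diagonal is a fixed
    point. Every coefficient recursion below is solved this way, with values in [R] or in
    [R -> R]. *)
Lemma causal_fixpoint {X : Type} (x0 : X) (Phi : (nat -> X) -> nat -> X) :
  (forall u v n, (forall i, (i < n)%nat -> u i = v i) -> Phi u n = Phi v n) ->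
  exists u, forall n, u n = Phi u n.
Proof.
  intros Hc.
  set (U := fix U j := match j with O => fun _ : nat => x0 | S j => Phi (U j) end).
  assert (Hst : forall n j, (n < j)%nat -> U j n = U (S n) n).
  { intros n; induction n as [n IH] using (well_founded_induction lt_wf).
    intros [|j] Hj; [lia|]; simpl.
    apply Hc; intros i Hi.
    rewrite (IH i Hi j) by lia; symmetry; apply (IH i Hi n); lia. }
  exists (fun n => U (S n) n); intros n.
  change (U (S n) n) with (Phi (U n) n).
  apply Hc; intros i Hi; apply Hst; lia.
Qed.

(** Discrete Fubini on the triangle [q + j <= N]; it regroups Cauchy products and substitutions. *)
Lemma sum_triangle (c : nat -> nat -> R) N :
  sum_f_R0 (fun n => sum_f_R0 (fun q => c q (n - q)%nat) n) N =
  sum_f_R0 (fun q => sum_f_R0 (c q) (N - q)) N.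
Proof.
  induction N as [|N IH]; [reflexivity|].
  rewrite tech5, IH, (tech5 (fun q => c q (S N - q)%nat)), Nat.sub_diag.
  rewrite (tech5 (fun q => sum_f_R0 (c q) (S N - q))), Nat.sub_diag; simpl (sum_f_R0 (c (S N)) 0).
  rewrite <- Rplus_assoc, <- plus_sum; f_equal.
  apply sum_eq; intros q Hq.
  replace (S N - q)%nat with (S (N - q)) by lia; reflexivity.
Qed.

Lemma sum_f_R0_scal c (a : nat -> R) N :
  sum_f_R0 (fun n => c * a n) N = c * sum_f_R0 a N.
Proof. rewrite scal_sum; apply sum_eq; intros; ring. Qed.

Lemma sum_f_R0_nonneg (a : nat -> R) N : (forall n, 0 <= a n) -> 0 <= sum_f_R0 a N.
Proof. intros H; apply cond_pos_sum; exact H. Qed.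

Lemma sum_f_R0_mono (a : nat -> R) N M :
  (forall n, 0 <= a n) -> (N <= M)%nat -> sum_f_R0 a N <= sum_f_R0 a M.
Proof.
  intros H; induction 1 as [|M HM IH]; [lra|]; simpl; specialize (H (S M)); lra.
Qed.

Lemma sum_f_R0_le (a b : nat -> R) N :
  (forall n, (n <= N)%nat -> a n <= b n) -> sum_f_R0 a N <= sum_f_R0 b N.
Proof. intros H; apply sum_Rle; intros; apply H; lia. Qed.

(** Truncations of the weighted l1 norm at radius [r]. Bounding the truncations presupposes no
    convergence, and inequalities valid at each fixed [N] can serve in inductions on [N]. *)
Definition l1sum (r : R) (a : nat -> R) (N : nat) : R :=
  sum_f_R0 (fun n => Rabs (a n) * r ^ n) N.

Definition l1_le (r M : R) (a : nat -> R) : Prop := forall N, l1sum r a N <= M.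

Section L1.
Variable r : R.
Hypothesis Hr : 0 <= r.

Lemma l1term_nonneg (a : nat -> R) n : 0 <= Rabs (a n) * r ^ n.
Proof. apply Rmult_le_pos; [apply Rabs_pos | apply pow_le, Hr]. Qed.

Lemma l1sum_nonneg a N : 0 <= l1sum r a N.
Proof. apply sum_f_R0_nonneg; intros; apply l1term_nonneg. Qed.

Lemma l1sum_mono a N M : (N <= M)%nat -> l1sum r a N <= l1sum r a M.
Proof. apply sum_f_R0_mono; intros; apply l1term_nonneg. Qed.

Lemma l1sum_le a b N :
  (forall n, (n <= N)%nat -> Rabs (a n) <= Rabs (b n)) -> l1sum r a N <= l1sum r b N.
Proof.
  intros H; apply sum_f_R0_le; intros n Hn.
  apply Rmult_le_compat_r; [apply pow_le, Hr | apply H, Hn].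
Qed.

Lemma l1_le_nonneg M a : l1_le r M a -> 0 <= M.
Proof. intros H; apply Rle_trans with (2 := H O); apply l1sum_nonneg. Qed.

Lemma l1_le_weaken M M' a : M <= M' -> l1_le r M a -> l1_le r M' a.
Proof. intros H Ha N; specialize (Ha N); lra. Qed.

Lemma l1_le_dom M a b : (forall n, Rabs (a n) <= Rabs (b n)) -> l1_le r M b -> l1_le r M a.
Proof. intros H Hb N; apply Rle_trans with (2 := Hb N), l1sum_le; auto. Qed.

Lemma l1sum_scal c a N : l1sum r (fun n => c * a n) N = Rabs c * l1sum r a N.
Proof.
  unfold l1sum; rewrite scal_sum; apply sum_eq; intros; rewrite Rabs_mult; ring.
Qed.

Lemma l1_le_scal c K M a : Rabs c <= K -> l1_le r M a -> l1_le r (K * M) (fun n => c * a n).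
Proof.
  intros Hc Ha N; rewrite l1sum_scal.
  apply Rmult_le_compat; auto using Rabs_pos, l1sum_nonneg.
Qed.

Lemma l1_le_plus M M' a b :
  l1_le r M a -> l1_le r M' b -> l1_le r (M + M') (fun n => a n + b n).
Proof.
  intros Ha Hb N; apply Rle_trans with (l1sum r a N + l1sum r b N).
  - unfold l1sum; rewrite <- plus_sum; apply sum_f_R0_le; intros n _.
    rewrite <- Rmult_plus_distr_r; apply Rmult_le_compat_r;
      [apply pow_le, Hr | apply Rabs_triang].
  - specialize (Ha N); specialize (Hb N); lra.
Qed.

Lemma l1_coef_le M a n : l1_le r M a -> Rabs (a n) * r ^ n <= M.
Proof.
  intros H; apply Rle_trans with (2 := H n).
  destruct n as [|n]; unfold l1sum; [simpl; lra|].
  rewrite tech5.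
  assert (0 <= sum_f_R0 (fun n => Rabs (a n) * r ^ n) n) by apply l1sum_nonneg; lra.
Qed.

(** The index triangle [q + j <= N] of the product lies in the square [q, j <= N], and all terms are
    nonnegative. *)
Lemma l1sum_mult a b N : l1sum r (PS_mult a b) N <= l1sum r a N * l1sum r b N.
Proof.
  apply Rle_trans with
    (sum_f_R0 (fun n => sum_f_R0 (fun q => (Rabs (a q) * r ^ q) *
       (Rabs (b (n - q)%nat) * r ^ (n - q))) n) N).
  - apply sum_f_R0_le; intros n _; unfold PS_mult.
    rewrite Rmult_comm.
    apply Rle_trans with (r ^ n * sum_f_R0 (fun q => Rabs (a q * b (n - q)%nat)) n).
    + apply Rmult_le_compat_l; [apply pow_le, Hr | apply Rsum_abs].
    + rewrite scal_sum; apply sum_f_R0_le; intros q Hq.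
      rewrite Rabs_mult.
      replace (r ^ n) with (r ^ q * r ^ (n - q))
        by (rewrite <- pow_add; f_equal; lia).
      right; ring.
  - rewrite (sum_triangle (fun q j => (Rabs (a q) * r ^ q) * (Rabs (b j) * r ^ j))).
    unfold l1sum at 1; rewrite Rmult_comm, scal_sum; apply sum_f_R0_le; intros q Hq.
    rewrite sum_f_R0_scal; apply Rmult_le_compat_l; [apply l1term_nonneg|].
    apply l1sum_mono; lia.
Qed.

Lemma l1_le_mult M M' a b :
  l1_le r M a -> l1_le r M' b -> l1_le r (M * M') (PS_mult a b).
Proof.
  intros Ha Hb N; apply Rle_trans with (1 := l1sum_mult a b N).
  apply Rmult_le_compat; auto using l1sum_nonneg.
Qed.

End L1.

(** Without a constant term every weight gains at least one factor [t]. This is the source of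
    smallness throughout: a norm can be made at most 1/2 by reducing the radius. *)
Lemma l1_le_shrink r t M a :
  0 <= r -> 0 <= t <= 1 -> a O = 0 -> l1_le r M a -> l1_le (t * r) (t * M) a.
Proof.
  intros Hr Ht H0 Ha N.
  apply Rle_trans with (t * l1sum r a N);
    [|apply Rmult_le_compat_l; [lra | apply Ha]].
  unfold l1sum; rewrite scal_sum; apply sum_f_R0_le; intros [|n] _.
  - rewrite H0, Rabs_R0; simpl; lra.
  - rewrite Rpow_mult_distr.
    assert (t ^ S n <= t).
    { simpl; rewrite <- (Rmult_1_r t) at 3; apply Rmult_le_compat_l; [lra|].
      rewrite <- (pow1 n); apply pow_incr; lra. }
    assert (Hp := l1term_nonneg r Hr a (S n)).
    replace (Rabs (a (S n)) * (t ^ S n * r ^ S n)) with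
      (t ^ S n * (Rabs (a (S n)) * r ^ S n)) by ring.
    rewrite (Rmult_comm _ t); apply Rmult_le_compat_r; assumption.
Qed.

Lemma l1_le_smaller r r' M a : 0 <= r' <= r -> l1_le r M a -> l1_le r' M a.
Proof.
  intros Hr Ha N; apply Rle_trans with (2 := Ha N).
  apply sum_f_R0_le; intros n _; apply Rmult_le_compat_l; [apply Rabs_pos|].
  apply pow_incr; lra.
Qed.

Lemma PS_incr_n_0 (a : nat -> R) p : PS_incr_n a (S p) O = 0.
Proof. reflexivity. Qed.

Lemma PS_incr_n_S (a : nat -> R) p n : PS_incr_n a (S p) (S n) = PS_incr_n a p n.
Proof. reflexivity. Qed.

Lemma l1_le_incr r M a p :
  0 <= r <= 1 -> l1_le r M a -> l1_le r M (PS_incr_n a p).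
Proof.
  intros Hr Ha; induction p as [|p IH]; [exact Ha|].
  intros [|N]; unfold l1sum.
  - cbn [sum_f_R0]; rewrite PS_incr_n_0, Rabs_R0, Rmult_0_l.
    apply l1_le_nonneg with r a; [lra | exact Ha].
  - rewrite decomp_sum by lia; cbn [pred].
    rewrite PS_incr_n_0, Rabs_R0, Rmult_0_l, Rplus_0_l.
    apply Rle_trans with (2 := IH N); apply sum_f_R0_le; intros n _.
    rewrite PS_incr_n_S; apply Rmult_le_compat_l; [apply Rabs_pos|].
    simpl; assert (0 <= r ^ n) by (apply pow_le; lra).
    rewrite <- (Rmult_1_l (r ^ n)) at 2; apply Rmult_le_compat_r; lra.
Qed.

Definition PS_one (n : nat) : R := match n with O => 1 | S _ => 0 end.

Lemma l1_one r : l1_le r 1 PS_one.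
Proof.
  intros N; unfold l1sum; induction N as [|N IH].
  - simpl; rewrite Rabs_R1; lra.
  - rewrite tech5; simpl (PS_one (S N)); rewrite Rabs_R0; lra.
Qed.

Fixpoint PS_pow (a : nat -> R) (m : nat) : nat -> R :=
  match m with O => PS_one | S m => PS_mult a (PS_pow a m) end.

Lemma PS_mult_causal a a' b b' n :
  (forall i, (i <= n)%nat -> a i = a' i) -> (forall i, (i <= n)%nat -> b i = b' i) ->
  PS_mult a b n = PS_mult a' b' n.
Proof.
  intros Ha Hb; apply sum_eq; intros i Hi; rewrite Ha, Hb by lia; reflexivity.
Qed.

Lemma PS_pow_causal a b m n :
  (forall i, (i <= n)%nat -> a i = b i) -> PS_pow a m n = PS_pow b m n.
Proof.
  revert n; induction m as [|m IH]; intros n H; [reflexivity|].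
  apply PS_mult_causal; [exact H|]; intros i Hi; apply IH; intros; apply H; lia.
Qed.

Lemma l1sum_pow r a m N : 0 <= r -> l1sum r (PS_pow a m) N <= l1sum r a N ^ m.
Proof.
  intros Hr; induction m as [|m IH].
  - apply l1_one.
  - simpl; apply Rle_trans with (1 := l1sum_mult r Hr _ _ _).
    apply Rmult_le_compat_l; [apply l1sum_nonneg, Hr | exact IH].
Qed.

(** [b] is the series of [1 / (1 + a)], written as the fixed point [b = 1 - a b], which is causal
    because [a 0 = 0]. *)
Lemma PS_inverse_exists (a : nat -> R) : a O = 0 ->
  exists b, forall n, b n = PS_one n - PS_mult a b n.
Proof.
  intros H0; apply (causal_fixpoint 0 (fun b n => PS_one n - PS_mult a b n)).
  intros u v n H; f_equal; apply sum_eq; intros [|i] Hi.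
  - rewrite H0; ring.
  - rewrite H by lia; reflexivity.
Qed.

(** On truncations, the norm of [b] is at most 1 plus half of itself. Truncated norms are finite, so
    the half can be absorbed. *)
Lemma l1_inverse r a b : 0 <= r -> l1_le r (1 / 2) a ->
  (forall n, b n = PS_one n - PS_mult a b n) -> l1_le r 2 b.
Proof.
  intros Hr Ha Hb N.
  assert (H : l1sum r b N <= 1 + l1sum r (PS_mult a b) N).
  { assert (H1 := l1_one r N).
    apply Rle_trans with (l1sum r PS_one N + l1sum r (PS_mult a b) N); [|lra].
    unfold l1sum; rewrite <- plus_sum; apply sum_f_R0_le; intros n _.
    rewrite <- Rmult_plus_distr_r; apply Rmult_le_compat_r; [apply pow_le, Hr|].
    rewrite Hb; unfold Rminus; rewrite <- (Rabs_Ropp (PS_mult a b n)); apply Rabs_triang. }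
  assert (H1 := l1sum_mult r Hr a b N); specialize (Ha N).
  assert (H2 := l1sum_nonneg r Hr b N).
  assert (l1sum r a N * l1sum r b N <= 1 / 2 * l1sum r b N)
    by (apply Rmult_le_compat_r; assumption).
  lra.
Qed.

(** * Evaluation and substitution *)

Lemma is_pseries_lim (a : nat -> R) x l :
  is_pseries a x l <-> is_lim_seq (fun N => sum_f_R0 (fun n => a n * x ^ n) N) l.
Proof.
  unfold is_pseries, is_series, is_lim_seq; split; apply filterlim_ext; intros N;
    [|symmetry]; rewrite <- sum_n_Reals; apply sum_n_ext; intros n;
    rewrite pow_n_pow; unfold scal; simpl; unfold mult; simpl; ring.
Qed.

Lemma bounded_sums_converge (b : nat -> R) M : (forall n, 0 <= b n) ->
  (forall N, sum_f_R0 b N <= M) -> ex_finite_lim_seq (sum_f_R0 b).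
Proof.
  intros Hb HM; apply ex_finite_lim_seq_incr with M; [|exact HM].
  intros n; rewrite tech5; specialize (Hb (S n)); lra.
Qed.

Lemma sum_f_R0_tail (b : nat -> R) K N : (K <= N)%nat ->
  (forall n, 0 <= b n) -> forall c, (forall n, Rabs (c n) <= b n) ->
  Rabs (sum_f_R0 c N - sum_f_R0 c K) <= sum_f_R0 b N - sum_f_R0 b K.
Proof.
  intros HKN Hb c Hc; induction HKN as [|N HKN IH].
  - rewrite !Rminus_diag, Rabs_R0; lra.
  - rewrite !tech5; specialize (Hc (S N)).
    replace (sum_f_R0 c N + c (S N) - sum_f_R0 c K)
      with ((sum_f_R0 c N - sum_f_R0 c K) + c (S N)) by ring.
    eapply Rle_trans; [apply Rabs_triang|]; lra.
Qed.

Lemma is_lim_seq_sum_f_R0 (b : nat -> nat -> R) (l : nat -> R) K :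
  (forall q, is_lim_seq (fun N => b N q) (l q)) ->
  is_lim_seq (fun N => sum_f_R0 (b N) K) (sum_f_R0 l K).
Proof.
  intros H; induction K as [|K IH]; [apply H|].
  simpl; apply is_lim_seq_plus'; [exact IH | apply H].
Qed.

(** Dominated convergence for sums whose range grows with [N]: the tail of [B] controls the terms
    beyond a fixed [K], and the finitely many others tend to 0. *)
Lemma tannery_0 (b : nat -> nat -> R) (B : nat -> R) M :
  (forall q, is_lim_seq (fun N => b N q) 0) ->
  (forall N q, Rabs (b N q) <= B q) -> (forall N, sum_f_R0 B N <= M) ->
  is_lim_seq (fun N => sum_f_R0 (b N) N) 0.
Proof.
  intros Hl HB HM.
  assert (HB0 : forall q, 0 <= B q) by (intros q; apply Rle_trans with (2 := HB O q), Rabs_pos).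
  apply is_lim_seq_spec; intros eps; simpl.
  destruct (bounded_sums_converge B M HB0 HM) as [S HS].
  assert (He : 0 < eps / 4) by (destruct eps; simpl; lra).
  apply is_lim_seq_spec in HS; destruct (HS (mkposreal _ He)) as [K HK]; simpl in HK.
  assert (HF := is_lim_seq_sum_f_R0 b (fun _ => 0) K Hl).
  rewrite (sum_eq_R0 (fun _ => 0)) in HF by reflexivity.
  apply is_lim_seq_spec in HF; destruct (HF (mkposreal _ He)) as [K' HK']; simpl in HK'.
  exists (Nat.max K K'); intros N HN.
  assert (H1 := sum_f_R0_tail B K N ltac:(lia) HB0 (b N) (HB N)).
  specialize (HK' N ltac:(lia)).
  assert (H2 := HK N ltac:(lia)); assert (H3 := HK K ltac:(lia)).
  rewrite Rminus_0_r in HK' |- *.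
  apply Rabs_def2 in H2; apply Rabs_def2 in H3.
  replace (sum_f_R0 (b N) N) with
    ((sum_f_R0 (b N) N - sum_f_R0 (b N) K) + sum_f_R0 (b N) K) by ring.
  eapply Rle_lt_trans; [apply Rabs_triang|]; lra.
Qed.

Section Values.
Variables (r M : R) (a : nat -> R).
Hypothesis Hr : 0 <= r.
Hypothesis Ha : l1_le r M a.

Lemma Rabs_term_le x n : Rabs x <= r -> Rabs (a n * x ^ n) <= Rabs (a n) * r ^ n.
Proof.
  intros Hx; rewrite Rabs_mult; apply Rmult_le_compat_l; [apply Rabs_pos|].
  rewrite <- RPow_abs; apply pow_incr; split; [apply Rabs_pos | exact Hx].
Qed.

Lemma l1_partial_le x N : Rabs x <= r ->
  Rabs (sum_f_R0 (fun n => a n * x ^ n) N) <= M.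
Proof.
  intros Hx; eapply Rle_trans; [apply Rsum_abs|].
  apply Rle_trans with (2 := Ha N), sum_f_R0_le; intros; apply Rabs_term_le, Hx.
Qed.

Lemma l1_ex_pseries x : Rabs x <= r -> is_pseries a x (PSeries a x).
Proof.
  intros Hx; apply PSeries_correct, ex_pseries_R, ex_series_Rabs.
  destruct (bounded_sums_converge (fun n => Rabs (a n * x ^ n)) M) as [l Hl].
  - intros; apply Rabs_pos.
  - intros N; apply Rle_trans with (2 := Ha N), sum_f_R0_le; intros; apply Rabs_term_le, Hx.
  - exists l; unfold is_series; apply filterlim_ext with (2 := Hl).
    intros N; symmetry; apply sum_n_Reals.
Qed.

Lemma l1_PSeries_lim x : Rabs x <= r ->
  is_lim_seq (fun N => sum_f_R0 (fun n => a n * x ^ n) N) (PSeries a x).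
Proof. intros Hx; apply is_pseries_lim, l1_ex_pseries, Hx. Qed.

Lemma l1_PSeries_le x : Rabs x <= r -> Rabs (PSeries a x) <= M.
Proof.
  intros Hx.
  assert (H := is_lim_seq_abs _ _ (l1_PSeries_lim x Hx)).
  apply (is_lim_seq_le _ (fun _ => M) (Rabs (PSeries a x)) M (fun N => l1_partial_le x N Hx) H).
  apply is_lim_seq_const.
Qed.

Lemma l1_CV_radius x : Rabs x < r -> Rbar_lt (Rabs x) (CV_radius a).
Proof.
  intros Hx; apply Rbar_lt_le_trans with r; [exact Hx|].
  apply (CV_radius_bounded a); exists M; intros n.
  rewrite Rabs_mult, <- RPow_abs, (Rabs_pos_eq r Hr); apply l1_coef_le; assumption.
Qed.

(** On half of the radius the tails decay geometrically, uniformly in [a]. *)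
Lemma l1_tail x N : Rabs x <= r / 2 ->
  Rabs (PSeries a x - sum_f_R0 (fun n => a n * x ^ n) N) <= M * (/ 2) ^ N.
Proof.
  intros Hx.
  assert (Hx' : Rabs x <= r) by lra.
  assert (HM := l1_le_nonneg r Hr M a Ha).
  assert (Hn : forall K, Rabs (sum_f_R0 (fun n => a n * x ^ n) (N + K)
     - sum_f_R0 (fun n => a n * x ^ n) N) <= M * (/ 2) ^ N).
  { intros K.
    eapply Rle_trans.
    - apply (sum_f_R0_tail (fun n => M * (/2) ^ n) N (N + K)); [lia| |].
      + intros n; apply Rmult_le_pos; [exact HM | apply pow_le; lra].
      + intros n; rewrite Rabs_mult, <- RPow_abs.
        apply Rle_trans with (Rabs (a n) * (r / 2) ^ n).
        * apply Rmult_le_compat_l; [apply Rabs_pos|]; apply pow_incr; split;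
            [apply Rabs_pos | exact Hx].
        * unfold Rdiv; rewrite Rpow_mult_distr, <- Rmult_assoc.
          apply Rmult_le_compat_r; [apply pow_le; lra|]; apply l1_coef_le; assumption.
    - assert (E : forall K, sum_f_R0 (fun n => M * (/ 2) ^ n) K = M * (2 - (/ 2) ^ K)).
      { induction K0 as [|K0 IH]; [simpl; ring|]; rewrite tech5, IH; simpl; field. }
      rewrite !E.
      assert (0 <= M * (/2) ^ (N + K)) by (apply Rmult_le_pos; [exact HM | apply pow_le; lra]).
      lra. }
  assert (Hl := l1_PSeries_lim x Hx').
  apply (is_lim_seq_incr_n _ N) in Hl.
  assert (Hl' : is_lim_seq (fun n => Rabs (sum_f_R0 (fun n => a n * x ^ n) (n + N) -
     sum_f_R0 (fun n => a n * x ^ n) N)) (Rabs (PSeries a x - sum_f_R0 (fun n => a n * x ^ n) N))).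
  { apply (is_lim_seq_abs _ (Finite _)), is_lim_seq_minus'; [exact Hl | apply is_lim_seq_const]. }
  refine (is_lim_seq_le _ (fun _ => M * (/2) ^ N) (Finite _) (Finite _) _ Hl' (is_lim_seq_const _)).
  intros K; rewrite Nat.add_comm; apply Hn.
Qed.

End Values.

Lemma PSeries_one x : PSeries PS_one x = 1.
Proof.
  apply is_pseries_unique, is_pseries_lim.
  apply is_lim_seq_ext with (fun _ => 1); [|apply is_lim_seq_const].
  induction n as [|n IH]; [simpl; ring|]; rewrite tech5, <- IH; simpl; ring.
Qed.

Lemma l1_pow_le r M a m : 0 <= r -> l1_le r M a -> l1_le r (M ^ m) (PS_pow a m).
Proof.
  intros Hr Ha N; apply Rle_trans with (1 := l1sum_pow r a m N Hr).
  apply pow_incr; split; [apply l1sum_nonneg, Hr | apply Ha].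
Qed.

Lemma l1_PSeries_mult r M M' a b x : l1_le r M a -> l1_le r M' b -> Rabs x < r ->
  PSeries (PS_mult a b) x = PSeries a x * PSeries b x.
Proof.
  intros Ha Hb Hx; assert (0 <= r) by (assert (H := Rabs_pos x); lra).
  apply PSeries_mult; eapply l1_CV_radius; eauto.
Qed.

Lemma l1_PSeries_pow r M a m x : l1_le r M a -> Rabs x < r ->
  PSeries (PS_pow a m) x = PSeries a x ^ m.
Proof.
  intros Ha Hx; assert (0 <= r) by (assert (H := Rabs_pos x); lra).
  induction m as [|m IH]; [apply PSeries_one|].
  simpl; rewrite (l1_PSeries_mult r M (M ^ m)), IH; auto using l1_pow_le.
Qed.

Lemma l1_PSeries_inverse r a b x : l1_le r (1 / 2) a ->
  (forall n, b n = PS_one n - PS_mult a b n) -> Rabs x < r ->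
  (1 + PSeries a x) * PSeries b x = 1.
Proof.
  intros Ha Hb Hx; assert (Hr : 0 <= r) by (assert (H := Rabs_pos x); lra).
  assert (Hb' := l1_inverse r a b Hr Ha Hb).
  assert (E : PSeries b x = 1 - PSeries a x * PSeries b x); [|lra].
  rewrite <- (l1_PSeries_mult r (1/2) 2) by assumption.
  rewrite <- (PSeries_one x), <- PSeries_minus.
  - apply PSeries_ext; exact Hb.
  - eexists; apply (l1_ex_pseries r 1); [apply l1_one | lra].
  - eexists; apply (l1_ex_pseries r (1/2 * 2)); [apply l1_le_mult; assumption | lra].
Qed.

(** Coefficients of [v(x) h(x v(x))]. *)
Definition PS_subst (h v : nat -> R) (n : nat) : R :=
  sum_f_R0 (fun q => h q * PS_pow v (S q) (n - q)) n.

(** With [h 0 = 0] the coefficient of order [n] only sees [v_i] for [i < n]; this is what makes the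
    system for the [v_n] triangular. *)
Lemma PS_subst_causal h u v n : h O = 0 ->
  (forall i, (i < n)%nat -> u i = v i) -> PS_subst h u n = PS_subst h v n.
Proof.
  intros Hh H; apply sum_eq; intros [|q] Hq; [rewrite Hh; ring|].
  f_equal; apply PS_pow_causal; intros i Hi; apply H; lia.
Qed.

(** The disjunction serves the induction in [flow_l1]: when [h 0 = 0], bounds on [v] are needed only
    for truncations shorter than [N]. *)
Lemma l1sum_subst_le r h v N A (Hr : 0 <= r) (HA : 0 <= A) :
  (forall q, (q <= N)%nat -> h q = 0 \/ l1sum r v (N - q) <= A) ->
  l1sum r (PS_subst h v) N <= A * l1sum (A * r) h N.
Proof.
  intros HhA.
  apply Rle_trans with (sum_f_R0 (fun n => sum_f_R0 (fun q =>
     (Rabs (h q) * r ^ q) * (Rabs (PS_pow v (S q) (n - q)%nat) * r ^ (n - q))) n) N).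
  - apply sum_f_R0_le; intros n _; unfold PS_subst.
    rewrite Rmult_comm.
    apply Rle_trans with
      (r ^ n * sum_f_R0 (fun q => Rabs (h q * PS_pow v (S q) (n - q)%nat)) n).
    + apply Rmult_le_compat_l; [apply pow_le, Hr | apply Rsum_abs].
    + rewrite scal_sum; apply sum_f_R0_le; intros q Hq.
      rewrite Rabs_mult.
      replace (r ^ n) with (r ^ q * r ^ (n - q))
        by (rewrite <- pow_add; f_equal; lia).
      right; ring.
  - rewrite (sum_triangle (fun q j => (Rabs (h q) * r ^ q) * (Rabs (PS_pow v (S q) j) * r ^ j))).
    unfold l1sum; rewrite scal_sum; apply sum_f_R0_le; intros q Hq.
    rewrite sum_f_R0_scal, Rpow_mult_distr.
    destruct (HhA q Hq) as [H0 | HA']; [rewrite H0, Rabs_R0; lra|].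
    replace (Rabs (h q) * (A ^ q * r ^ q) * A) with (Rabs (h q) * r ^ q * A ^ S q)
      by (simpl; ring).
    apply Rmult_le_compat_l; [apply l1term_nonneg, Hr|].
    eapply Rle_trans; [apply l1sum_pow, Hr|].
    apply pow_incr; split; [apply l1sum_nonneg, Hr | exact HA'].
Qed.

Lemma is_lim_seq_shift_sub (u : nat -> R) q (l : R) :
  is_lim_seq u l -> is_lim_seq (fun N => u (N - q)%nat) l.
Proof.
  intros H; apply is_lim_seq_incr_n with q.
  apply is_lim_seq_ext with u; [|exact H].
  intros n; f_equal; lia.
Qed.

Lemma l1_PSeries_subst r A M h v x : 0 < r -> 0 <= A ->
  l1_le r A v -> l1_le (A * r) M h -> Rabs x < r ->
  PSeries (PS_subst h v) x = PSeries v x * PSeries h (x * PSeries v x).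
Proof.
  intros Hr HA Hv Hh Hx.
  apply is_pseries_unique, is_pseries_lim.
  set (V := PSeries v x).
  assert (HV : Rabs V <= A) by (apply l1_PSeries_le with r; [exact Hv | lra]).
  (* [b N q] is the error of replacing [V^(q+1)] by a truncated series of that power. Each error
     tends to 0 and is dominated by a summable sequence, so the partial sums of the substitution
     have the same limit as [V] times those of [h] at [x V]. *)
  set (b := fun N q => h q * x ^ q * (sum_f_R0 (fun j => PS_pow v (S q) j * x ^ j) (N - q) - V ^ S q)).
  assert (HxV : Rabs (x * V) <= A * r).
  { rewrite Rabs_mult, (Rmult_comm A); apply Rmult_le_compat; auto using Rabs_pos; lra. }
  assert (Hlim := l1_PSeries_lim (A * r) M h Hh _ HxV).
  apply (is_lim_seq_scal_l _ V) in Hlim; simpl in Hlim.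
  assert (Hb : is_lim_seq (fun N => sum_f_R0 (b N) N) 0).
  { apply tannery_0 with (fun q => Rabs (h q) * (A * r) ^ q * (2 * A)) (M * (2 * A)).
    - intros q; unfold b.
      replace (Finite 0) with (Rbar_mult (h q * x ^ q) 0)
        by (simpl; f_equal; ring).
      apply is_lim_seq_scal_l.
      replace (Finite 0) with (Finite (V ^ S q - V ^ S q)) by (f_equal; ring).
      apply is_lim_seq_minus'; [|apply is_lim_seq_const].
      apply (is_lim_seq_shift_sub (sum_f_R0 (fun j => PS_pow v (S q) j * x ^ j))).
      unfold V; rewrite <- (l1_PSeries_pow r A v (S q)) by assumption.
      apply (l1_PSeries_lim r (A ^ S q)); [apply l1_pow_le; [lra | exact Hv] | lra].
    - intros N q; unfold b; rewrite Rabs_mult, Rpow_mult_distr.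
      replace (Rabs (h q) * (A ^ q * r ^ q) * (2 * A)) with
        ((Rabs (h q) * r ^ q) * (A ^ S q + A ^ S q)) by (simpl; ring).
      apply Rmult_le_compat; [apply Rabs_pos | apply Rabs_pos | apply Rabs_term_le; lra |].
      unfold Rminus; eapply Rle_trans; [apply Rabs_triang|].
      rewrite Rabs_Ropp; apply Rplus_le_compat.
      + apply (l1_partial_le r); [apply l1_pow_le; [lra | exact Hv] | lra].
      + rewrite <- RPow_abs; apply pow_incr; split; [apply Rabs_pos | exact HV].
    - intros N; rewrite <- scal_sum, Rmult_comm; apply Rmult_le_compat_r; [lra | apply Hh]. }
  assert (Hs := is_lim_seq_plus' _ _ _ _ Hb Hlim); rewrite Rplus_0_l in Hs.
  eapply is_lim_seq_ext with (2 := Hs); intros N; cbv beta.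
  rewrite scal_sum, <- plus_sum.
  transitivity (sum_f_R0 (fun q => sum_f_R0 (fun j =>
     (h q * x ^ q) * (PS_pow v (S q) j * x ^ j)) (N - q)) N).
  - apply sum_eq; intros q Hq; unfold b.
    rewrite sum_f_R0_scal, Rpow_mult_distr; simpl (V ^ S q); ring.
  - rewrite <- (sum_triangle (fun q j => (h q * x ^ q) * (PS_pow v (S q) j * x ^ j))).
    apply sum_eq; intros n Hn; unfold PS_subst.
    rewrite Rmult_comm, scal_sum; apply sum_eq; intros q Hq.
    replace (x ^ n) with (x ^ q * x ^ (n - q)) by (rewrite <- pow_add; f_equal; lia).
    ring.
Qed.

(** * Analytic dependence of a flow on its initial value *)

Lemma continuous_sum_f_R0 (f : nat -> R -> R) N x :
  (forall n, (n <= N)%nat -> continuous (f n) x) ->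
  continuous (fun s => sum_f_R0 (fun n => f n s) N) x.
Proof.
  intros H; induction N as [|N IH]; simpl; [apply H; lia|].
  apply (continuous_plus (fun s => sum_f_R0 (fun n => f n s) N) (f (S N)));
    [apply IH; intros; apply H; lia | apply H; lia].
Qed.

Lemma continuous_PS_mult (a b : R -> nat -> R) x n :
  (forall n, continuous (fun s => a s n) x) -> (forall n, continuous (fun s => b s n) x) ->
  continuous (fun s => PS_mult (a s) (b s) n) x.
Proof.
  intros Ha Hb; apply (continuous_sum_f_R0 (fun k s => a s k * b s (n - k)%nat)).
  intros k _; apply (continuous_mult (fun s => a s k) (fun s => b s (n - k)%nat)); auto.
Qed.

Lemma continuous_PS_pow (a : R -> nat -> R) x m :
  (forall n, continuous (fun s => a s n) x) ->
  forall n, continuous (fun s => PS_pow (a s) m n) x.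
Proof.
  intros Ha; induction m as [|m IH]; intros n; [apply continuous_const|].
  apply (continuous_PS_mult a (fun s => PS_pow (a s) m)); assumption.
Qed.

Lemma continuous_PS_subst (h v : R -> nat -> R) x n :
  (forall n, continuous (fun s => h s n) x) -> (forall n, continuous (fun s => v s n) x) ->
  continuous (fun s => PS_subst (h s) (v s) n) x.
Proof.
  intros Hh Hv.
  apply (continuous_sum_f_R0 (fun q s => h s q * PS_pow (v s) (S q) (n - q)%nat)).
  intros q _; apply (continuous_mult (fun s => h s q)); [apply Hh|].
  apply continuous_PS_pow, Hv.
Qed.

Lemma Rabs_increment_le (f df : R -> R) L B :
  (forall s, Rabs s <= L -> is_derive f s (df s)) -> (forall s, Rabs s <= L -> Rabs (df s) <= B) ->
  forall s, Rabs s <= L -> Rabs (f s - f 0) <= B * Rabs s.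
Proof.
  intros Hd HB s Hs.
  assert (Hin : forall x, Rmin 0 s <= x <= Rmax 0 s -> Rabs x <= L).
  { intros x; unfold Rmin, Rmax; destruct (Rle_dec 0 s); intros Hx;
      apply Rabs_le; apply Rabs_le_between in Hs; lra. }
  destruct (MVT_gen f 0 s df) as [c [Hc E]].
  - intros x Hx; apply Hd, Hin; lra.
  - intros x Hx; apply continuity_pt_filterlim, (ex_derive_continuous (V := R_NormedModule)).
    exists (df x); apply Hd, Hin, Hx.
  - rewrite E, Rabs_mult, Rminus_0_r; apply Rmult_le_compat_r; [apply Rabs_pos|].
    apply HB, Hin, Hc.
Qed.

Lemma is_derive_sum_f_R0 (f df : nat -> R -> R) N s :
  (forall n, is_derive (f n) s (df n s)) ->
  is_derive (fun s => sum_f_R0 (fun n => f n s) N) s (sum_f_R0 (fun n => df n s) N).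
Proof.
  intros H; induction N as [|N IH]; simpl; [apply H|].
  apply (is_derive_plus (fun s => sum_f_R0 (fun n => f n s) N) (f (S N))); auto.
Qed.

Lemma sum_signs (a : nat -> R) : exists sg : nat -> R,
  (forall n, Rabs (sg n) = 1) /\ (forall n, sg n * a n = Rabs (a n)).
Proof.
  exists (fun n => if Rle_dec 0 (a n) then 1 else -1); split; intros n;
    destruct (Rle_dec 0 (a n)) as [H|H].
  - apply Rabs_R1.
  - rewrite Rabs_left; lra.
  - rewrite Rabs_pos_eq by exact H; ring.
  - rewrite Rabs_left by lra; ring.
Qed.

Section Flow.
Variables (H : R -> nat -> R) (L M R0 : R).
Hypothesis (HL : 0 < L) (HR0 : 0 < R0).
Hypothesis H_0 : forall s, H s O = 0.
Hypothesis H_cont : forall n s, continuous (fun s => H s n) s.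
Hypothesis H_l1 : forall s, Rabs s <= L -> l1_le R0 M (H s).

Lemma flow_coefs_exist : exists v : nat -> R -> R,
  (forall n, v n 0 = PS_one n) /\
  (forall n s, is_derive (v n) s (PS_subst (H s) (fun m => v m s) n)).
Proof.
  destruct (causal_fixpoint (fun _ => 0) (fun (u : nat -> R -> R) n s =>
     PS_one n + RInt (fun t => PS_subst (H t) (fun m => u m t) n) 0 s)) as [v Hv].
  { intros u v n Huv; apply functional_extensionality; intros s; f_equal.
    apply RInt_ext; intros t _; apply PS_subst_causal; [apply H_0|].
    intros i Hi; rewrite (Huv i Hi); reflexivity. }
  assert (Hc : forall n, (forall i, (i < n)%nat -> forall s, continuous (v i) s) ->
     forall s, continuous (fun t => PS_subst (H t) (fun m => v m t) n) s).
  { intros n Hi s.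
    (* The continuity lemma for substitutions wants all components continuous, but only those below
       [n] are known to be. The others are replaced by 0, which by causality does not change the
       coefficient. *)
    apply continuous_ext with (fun t => PS_subst (H t)
      (fun m => (if lt_dec m n then v m else fun _ => 0) t) n).
    - intros t; apply PS_subst_causal; [apply H_0|].
      intros i Hin; destruct (lt_dec i n); [reflexivity | lia].
    - apply (continuous_PS_subst H (fun t m => (if lt_dec m n then v m else fun _ => 0) t)).
      + intros; apply H_cont.
      + intros m; destruct (lt_dec m n); [apply Hi; assumption | apply continuous_const]. }
  assert (Hd : forall n, (forall i, (i < n)%nat -> forall s, continuous (v i) s) ->
     forall s, is_derive (v n) s (PS_subst (H s) (fun m => v m s) n)).
  { intros n Hi s; specialize (Hc n Hi).
    rewrite (Hv n).
    replace (PS_subst (H s) (fun m => v m s) n) with (0 + PS_subst (H s) (fun m => v m s) n) by ring.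
    apply (is_derive_plus (fun _ => PS_one n)); [apply (is_derive_const (V := R_NormedModule))|].
    apply (is_derive_RInt (fun t => PS_subst (H t) (fun m => v m t) n) _ 0); [|apply Hc].
    apply filter_forall; intros t; apply (RInt_correct (V := R_CompleteNormedModule)), (ex_RInt_continuous (V := R_CompleteNormedModule));
      intros; apply Hc. }
  assert (Hcont : forall n s, continuous (v n) s).
  { intros n; induction n as [n IH] using (well_founded_induction lt_wf); intros s.
    apply (ex_derive_continuous (V := R_NormedModule)); eexists; apply Hd; exact IH. }
  exists v; split.
  - intros n; rewrite (Hv n), RInt_point; unfold zero; simpl; ring.
  - intros n; apply Hd; intros; apply Hcont.
Qed.

(** Induction on the length [N] of the partial sum: with [sg n] the sign of [v n s], the sum
    is the value at [s] of a function [W] whose derivative only involves the [v m] with [m < N]. *)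
Lemma flow_l1 (v : nat -> R -> R) r :
  (forall n, v n 0 = PS_one n) ->
  (forall n s, is_derive (v n) s (PS_subst (H s) (fun m => v m s) n)) ->
  0 <= r -> 2 * r <= R0 -> 2 * r / R0 * M * 2 * L <= 1 ->
  forall s, Rabs s <= L -> l1_le r 2 (fun n => v n s).
Proof.
  intros Hv0 Hd Hr Hr0 Hsmall.
  assert (HM : 0 <= M).
  { apply l1_le_nonneg with R0 (H 0); [lra|]; apply H_l1; rewrite Rabs_R0; lra. }
  assert (Ht : 0 <= 2 * r / R0 <= 1).
  { split; [apply Rcomplements.Rdiv_le_0_compat; lra|].
    apply (Rmult_le_reg_r R0); [exact HR0|]; field_simplify; lra. }
  (* Bound on the rate of change of the truncated norm: as [H s] has no constant term, passing from
     radius [R0] to [2 r] gains the factor [2 r / R0]. *)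
  assert (Hstep : forall N s, Rabs s <= L ->
     (forall q, (q <= N)%nat -> H s q = 0 \/ l1sum r (fun n => v n s) (N - q) <= 2) ->
     l1sum r (PS_subst (H s) (fun m => v m s)) N <= 2 * (2 * r / R0 * M)).
  { intros N s Hs Hq.
    eapply Rle_trans; [apply (l1sum_subst_le r _ _ N 2); [exact Hr | lra | exact Hq]|].
    apply Rmult_le_compat_l; [lra|].
    assert (E := l1_le_shrink R0 (2 * r / R0) M (H s) ltac:(lra) Ht (H_0 s) (H_l1 s Hs) N).
    replace (2 * r / R0 * R0) with (2 * r) in E by (field; lra); exact E. }
  assert (Hmain : forall N s, Rabs s <= L -> l1sum r (fun n => v n s) N <= 2).
  { induction N as [N IH] using (well_founded_induction lt_wf); intros s Hs.
    destruct (sum_signs (fun n => v n s)) as [sg [Hsg1 Hsg2]].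
    set (W := fun t => sum_f_R0 (fun n => sg n * r ^ n * v n t) N).
    set (dW := fun t => sum_f_R0 (fun n => sg n * r ^ n * PS_subst (H t) (fun m => v m t) n) N).
    assert (HW := Rabs_increment_le W dW L (2 * (2 * r / R0 * M))).
    specialize (HW ltac:(intros t _; apply (is_derive_sum_f_R0
       (fun n t => sg n * r ^ n * v n t)
       (fun n t => sg n * r ^ n * PS_subst (H t) (fun m => v m t) n)); intros n;
       apply (is_derive_scal (v n)); apply Hd)).
    assert (HB : forall t, Rabs t <= L -> Rabs (dW t) <= 2 * (2 * r / R0 * M)).
    { intros t Htl; eapply Rle_trans; [apply Rsum_abs|].
      (* Only the term [q = 0] would require the bound at [N] itself, and there [H] vanishes; the
         other terms use the induction hypothesis at a shorter length. *)
      apply Rle_trans with (2 := Hstep N t Htl ltac:(intros [|q] Hq;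
        [left; apply H_0 | right; apply IH; [lia | exact Htl]])).
      apply sum_f_R0_le; intros n _.
      rewrite !Rabs_mult, Hsg1, (Rabs_pos_eq (r ^ n)) by (apply pow_le, Hr); right; ring. }
    specialize (HW HB s Hs).
    assert (E1 : W s = l1sum r (fun n => v n s) N).
    { apply sum_eq; intros n _; rewrite <- Hsg2; ring. }
    assert (E2 : W 0 <= 1).
    { unfold W; rewrite (sum_eq _ (fun n => match n with O => sg O | S _ => 0 end)).
      - apply Rle_trans with (sg O).
        + clear; right; induction N as [|N IH]; [reflexivity|]; rewrite tech5, IH; ring.
        + rewrite <- (Hsg1 O); apply Rle_abs.
      - intros [|n] _; rewrite Hv0; simpl; ring. }
    (* [W] starts at most at 1 and, by the smallness of [r], moves by at most 1, hence the bound
       2. *)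
    apply Rabs_le_between in HW.
    assert (2 * (2 * r / R0 * M) * Rabs s <= 2 * (2 * r / R0 * M) * L).
    { apply Rmult_le_compat_l; [|exact Hs].
      apply Rmult_le_pos; [lra|]; apply Rmult_le_pos; lra. }
    lra. }
  intros s Hs N; apply Hmain, Hs.
Qed.

Lemma CVU_of_geometric (fn : nat -> R -> R) (f : R -> R) (D : R -> Prop) A :
  (forall x n, D x -> Rabs (f x - fn n x) <= A * (/ 2) ^ n) -> CVU_dom fn D /\
  (forall x, D x -> Lim_seq (fun n => fn n x) = f x).
Proof.
  intros Hf.
  assert (Hg : is_lim_seq (fun n => A * (/ 2) ^ n) 0).
  { replace (Finite 0) with (Rbar_mult A 0) by (simpl; f_equal; ring).
    apply is_lim_seq_scal_l, is_lim_seq_geom; rewrite Rabs_pos_eq; lra. }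
  assert (Hl : forall x, D x -> Lim_seq (fun n => fn n x) = f x).
  { intros x Hx; apply is_lim_seq_unique, is_lim_seq_spec; intros eps.
    apply is_lim_seq_spec in Hg; destruct (Hg eps) as [N HN]; exists N; intros n Hn.
    specialize (HN n Hn); rewrite Rminus_0_r in HN; apply Rabs_def2 in HN.
    rewrite Rabs_minus_sym; eapply Rle_lt_trans; [apply Hf, Hx | lra]. }
  split; [|exact Hl].
  intros eps; apply is_lim_seq_spec in Hg; destruct (Hg eps) as [N HN]; exists N; intros n Hn x Hx.
  specialize (HN n Hn); rewrite Rminus_0_r in HN; apply Rabs_def2 in HN.
  rewrite (Hl x Hx), Rabs_minus_sym; eapply Rle_lt_trans; [apply Hf, Hx | lra].
Qed.

(** For [Rabs x <= r / 2] the tails of the series and of its termwise derivative decay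
    geometrically, uniformly in [s]. This justifies differentiating term by term, after which
    [l1_PSeries_subst] identifies the sum of the derivatives. *)
Lemma analytic_flow : exists (v : nat -> R -> R) (r : R),
  0 < r /\ 2 * r <= R0 /\
  (forall n, v n 0 = PS_one n) /\
  (forall n s, is_derive (v n) s (PS_subst (H s) (fun m => v m s) n)) /\
  (forall s, Rabs s <= L -> l1_le r 2 (fun n => v n s)) /\
  (forall x s, Rabs x <= r / 2 -> Rabs s < L ->
     is_derive (fun s => PSeries (fun n => v n s) x) s
       (PSeries (fun n => v n s) x * PSeries (H s) (x * PSeries (fun n => v n s) x))).
Proof.
  destruct flow_coefs_exist as [v [Hv0 Hd]].
  assert (HM : 0 <= M).
  { apply l1_le_nonneg with R0 (H 0); [lra|]; apply H_l1; rewrite Rabs_R0; lra. }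
  assert (HML : 0 <= 2 * M * L) by (apply Rmult_le_pos; lra).
  (* Chosen so that [2 r / R0 = 1 / (1 + 2 M L)]: the smallness condition of [flow_l1] holds, and
     the added 1 covers [M = 0] and gives [2 r <= R0]. *)
  set (r := R0 / (2 * (1 + 2 * M * L))).
  assert (Hr : 0 < r) by (apply Rdiv_lt_0_compat; lra).
  assert (E1 : 2 * r / R0 = / (1 + 2 * M * L)) by (unfold r; field; lra).
  assert (H1 : / (1 + 2 * M * L) <= 1) by (rewrite <- Rinv_1 at 2; apply Rinv_le_contravar; lra).
  assert (H2r : 2 * r <= R0).
  { replace (2 * r) with (2 * r / R0 * R0) by (field; lra); rewrite E1.
    rewrite <- (Rmult_1_l R0) at 2; apply Rmult_le_compat_r; lra. }
  assert (Hsm : 2 * r / R0 * M * 2 * L <= 1).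
  { rewrite E1; apply (Rmult_le_reg_r (1 + 2 * M * L)); [lra|]; field_simplify; lra. }
  assert (Hl1 := flow_l1 v r Hv0 Hd ltac:(lra) H2r Hsm).
  exists v, r; repeat (split; [auto; fail|]).
  intros x s Hx Hs.
  assert (HhM : forall t, Rabs t <= L -> l1_le (2 * r) M (H t))
    by (intros t Ht; apply l1_le_smaller with R0; [lra | apply H_l1, Ht]).
  assert (Hsub : forall t, Rabs t <= L -> l1_le r (2 * M) (PS_subst (H t) (fun m => v m t))).
  { intros t Ht N; eapply Rle_trans; [apply (l1sum_subst_le r _ _ N 2); [lra | lra |]|].
    - intros q _; right; apply Hl1, Ht.
    - apply Rmult_le_compat_l; [lra | apply HhM, Ht]. }
  set (D := fun t => Rabs t < L).
  set (fn := fun N t => sum_f_R0 (fun n => v n t * x ^ n) N).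
  assert (Hfd : forall N t, is_derive (fn N) t
    (sum_f_R0 (fun n => PS_subst (H t) (fun m => v m t) n * x ^ n) N)).
  { intros N t; apply (is_derive_sum_f_R0 (fun n t => v n t * x ^ n)
      (fun n t => PS_subst (H t) (fun m => v m t) n * x ^ n)).
    intros n; apply (is_derive_ext (fun t => x ^ n * v n t)); [intros t'; apply Rmult_comm|].
    rewrite Rmult_comm; apply (is_derive_scal (v n)), Hd. }
  destruct (CVU_of_geometric fn (fun t => PSeries (fun n => v n t) x) D 2) as [C1 C2].
  { intros t N Ht; apply (l1_tail r 2 (fun n => v n t)); [lra | apply Hl1; unfold D in Ht; lra | exact Hx]. }
  destruct (CVU_of_geometric (fun N t => Derive (fn N) t)
    (fun t => PSeries (PS_subst (H t) (fun m => v m t)) x) D (2 * M)) as [C3 C4].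
  { intros t N Ht; rewrite (is_derive_unique _ _ _ (Hfd N t)).
    apply (l1_tail r (2 * M)); [lra | apply Hsub; unfold D in Ht; lra | exact Hx]. }
  assert (Dopen : open D).
  { intros t Ht; unfold D in *.
    assert (Hp : 0 < L - Rabs t) by lra.
    exists (mkposreal _ Hp); intros y Hy; simpl in Hy.
    unfold ball in Hy; simpl in Hy; unfold AbsRing_ball, abs, minus, plus, opp in Hy; simpl in Hy.
    replace y with ((y + - t) + t) by ring.
    eapply Rle_lt_trans; [apply Rabs_triang | lra]. }
  assert (Hder := CVU_Derive fn D Dopen).
  assert (Dconn : is_connected D).
  { intros a b c Ha Hb Hc; unfold D in *.
    apply Rabs_def1; apply Rabs_def2 in Ha; apply Rabs_def2 in Hb; lra. }
  specialize (Hder Dconn C1 (fun n t _ => ex_intro _ _ (Hfd n t))).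
  assert (Hcont : forall n t, D t -> continuity_pt (Derive (fn n)) t).
  { intros n t _; apply continuity_pt_filterlim.
    apply (continuous_ext (fun t => sum_f_R0 (fun n => PS_subst (H t) (fun m => v m t) n * x ^ n) n)).
    - intros u; symmetry; apply is_derive_unique, Hfd.
    - apply (continuous_sum_f_R0 (fun n t => PS_subst (H t) (fun m => v m t) n * x ^ n)).
      intros m _; apply (continuous_mult (fun t => PS_subst (H t) (fun m => v m t) m));
        [|apply continuous_const].
      apply (continuous_PS_subst H (fun t m => v m t)); [intros; apply H_cont|].
      intros q; apply (ex_derive_continuous (V := R_NormedModule)); eexists; apply Hd. }
  specialize (Hder Hcont C3 s Hs).
  rewrite C4 in Hder by exact Hs; simpl in Hder.
  rewrite (l1_PSeries_subst r 2 M) in Hder;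
    [| exact Hr | lra | apply Hl1; lra | apply HhM; lra | lra].
  eapply is_derive_ext_loc with (2 := Hder).
  apply (locally_open D (fun t => real (Lim_seq (fun n => fn n t)) = PSeries (fun n => v n t) x));
    [exact Dopen | | exact Hs].
  intros t Ht; rewrite (C2 t Ht); reflexivity.
Qed.

End Flow.

(** * Generalized polar coordinates *)

Lemma is_derive_eq (f : R -> R) (x d d' : R) : is_derive f x d -> d = d' -> is_derive f x d'.
Proof. intros H <-; exact H. Qed.

Lemma exp_INR_mult a n : exp a ^ n = exp (INR n * a).
Proof.
  induction n as [|n IH]; [simpl; rewrite Rmult_0_l, exp_0; reflexivity|].
  rewrite S_INR, Rmult_plus_distr_r, exp_plus, <- IH, Rmult_1_l; simpl; ring.
Qed.

(** [gcos] and [gsin] parametrize the curve [x^(2k) + y^2 = 1] by the angle, which makes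
    their zeros and signs those of [cos] and [sin]; [gspeed] is the resulting speed factor. *)
Definition gden (k : nat) (t : R) : R := cos t ^ (2 * k) + sin t ^ 2.
Definition gcos (k : nat) (t : R) : R := cos t * exp (- / (2 * INR k) * ln (gden k t)).
Definition gsin (k : nat) (t : R) : R := sin t * exp (- / 2 * ln (gden k t)).
Definition gspeed (k : nat) (t : R) : R :=
  (sin t ^ 2 + cos t ^ 2 / INR k) * exp ((- / 2 - / (2 * INR k)) * ln (gden k t)).

Section GeneralizedTrig.
Variable k : nat.
Hypothesis hk : (1 <= k)%nat.

Lemma INR_k_pos : 1 <= INR k.
Proof. apply (le_INR 1), hk. Qed.

Lemma sin_cos_sq t : sin t ^ 2 + cos t ^ 2 = 1.
Proof. assert (H := sin2_cos2 t); unfold Rsqr in H; lra. Qed.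

Lemma gden_pos t : 0 < gden k t.
Proof.
  unfold gden; assert (H := sin_cos_sq t).
  rewrite pow_mult.
  assert (H1 : 0 <= cos t ^ 2) by apply pow2_ge_0.
  assert (H2 : 0 <= sin t ^ 2) by apply pow2_ge_0.
  destruct H1 as [H1|H1].
  - assert (0 < (cos t ^ 2) ^ k) by (apply pow_lt; exact H1); lra.
  - rewrite <- H1, pow_i by lia; lra.
Qed.

Lemma exp_neg_ln_gden t : exp (- ln (gden k t)) = / gden k t.
Proof. rewrite exp_Ropp, exp_ln by apply gden_pos; reflexivity. Qed.

Lemma gcos_sq_pow t : gcos k t ^ (2 * k) + gsin k t ^ 2 = 1.
Proof.
  assert (Hk := INR_k_pos); assert (HD := gden_pos t).
  unfold gcos, gsin; rewrite !Rpow_mult_distr, !exp_INR_mult.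
  rewrite mult_INR; simpl (INR 2).
  replace (_ * (- / (2 * INR k) * ln (gden k t))) with (- ln (gden k t)) by (simpl; field; lra).
  replace (_ * (- / 2 * ln (gden k t))) with (- ln (gden k t)) by (simpl; field).
  rewrite exp_neg_ln_gden; unfold gden in *; field; lra.
Qed.

Lemma gspeed_pos t : 0 < gspeed k t.
Proof.
  assert (Hk := INR_k_pos).
  unfold gspeed; apply Rmult_lt_0_compat; [|apply exp_pos].
  assert (H := sin_cos_sq t).
  assert (H1 : 0 <= cos t ^ 2) by apply pow2_ge_0.
  assert (H2 : 0 <= sin t ^ 2) by apply pow2_ge_0.
  destruct H1 as [H1|H1].
  - assert (0 < cos t ^ 2 / INR k) by (apply Rdiv_lt_0_compat; lra); lra.
  - rewrite <- H1; unfold Rdiv; lra.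
Qed.

Lemma cos_pow_pred t : cos t ^ (2 * k) = cos t * cos t ^ (2 * k - 1).
Proof. replace (2 * k)%nat with (S (2 * k - 1)) at 1 by lia; reflexivity. Qed.

Lemma is_derive_gden t :
  is_derive (gden k) t (2 * sin t * cos t - 2 * INR k * (cos t ^ (2 * k - 1) * sin t)).
Proof.
  unfold gden; auto_derive; [exact I|].
  replace (k + (k + 0))%nat with (2 * k)%nat by lia.
  rewrite mult_INR; replace (Nat.pred (2 * k)) with (2 * k - 1)%nat by lia; simpl (INR 2); ring.
Qed.

Lemma is_derive_gcos t : is_derive (gcos k) t (- gsin k t * gspeed k t).
Proof.
  assert (Hk := INR_k_pos); assert (HD := gden_pos t).
  assert (H : is_derive (gcos k) t
    (- sin t * exp (- / (2 * INR k) * ln (gden k t)) + cos t *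
      (- / (2 * INR k) * ((2 * sin t * cos t - 2 * INR k * (cos t ^ (2 * k - 1) * sin t)) / gden k t)
      * exp (- / (2 * INR k) * ln (gden k t))))).
  { assert (Hd := is_derive_gden t); unfold gcos; auto_derive.
    - repeat split; [eexists; exact Hd | exact HD].
    - replace (Derive (fun x : R => gden k x) t) with (2 * sin t * cos t - 2 * INR k * (cos t ^ (2 * k - 1) * sin t))
        by (symmetry; exact (is_derive_unique _ _ _ Hd)); field; split; lra. }
  assert (E : - gsin k t * gspeed k t = - sin t * (sin t ^ 2 + cos t ^ 2 / INR k) *
    (/ gden k t * exp (- / (2 * INR k) * ln (gden k t)))).
  { unfold gsin, gspeed; rewrite <- exp_neg_ln_gden, <- exp_plus.
    replace (- ln (gden k t) + - / (2 * INR k) * ln (gden k t)) with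
      (- / 2 * ln (gden k t) + (- / 2 - / (2 * INR k)) * ln (gden k t)) by (field; lra).
    rewrite exp_plus; ring. }
  rewrite E; apply is_derive_eq with (1 := H).
  (* The exponential is a common factor. Once [cos^(2k)] is split as [cos * cos^(2k-1)], the terms
     in [cos^(2k)] cancel as polynomials. *)
  set (e := exp _); unfold gden in *; rewrite cos_pow_pred in *; field; split; lra.
Qed.

Lemma is_derive_gsin t :
  is_derive (gsin k) t (INR k * gcos k t ^ (2 * k - 1) * gspeed k t).
Proof.
  assert (Hk := INR_k_pos); assert (HD := gden_pos t).
  assert (H : is_derive (gsin k) t
    (cos t * exp (- / 2 * ln (gden k t)) + sin t *
      (- / 2 * ((2 * sin t * cos t - 2 * INR k * (cos t ^ (2 * k - 1) * sin t)) / gden k t)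
      * exp (- / 2 * ln (gden k t))))).
  { assert (Hd := is_derive_gden t); unfold gsin; auto_derive.
    - repeat split; [eexists; exact Hd | exact HD].
    - replace (Derive (fun x : R => gden k x) t) with (2 * sin t * cos t - 2 * INR k * (cos t ^ (2 * k - 1) * sin t))
        by (symmetry; exact (is_derive_unique _ _ _ Hd)); field; lra. }
  assert (E : INR k * gcos k t ^ (2 * k - 1) * gspeed k t = INR k * cos t ^ (2 * k - 1) *
    (sin t ^ 2 + cos t ^ 2 / INR k) * (/ gden k t * exp (- / 2 * ln (gden k t)))).
  { unfold gcos, gspeed; rewrite Rpow_mult_distr, exp_INR_mult, <- exp_neg_ln_gden, <- exp_plus.
    rewrite minus_INR, mult_INR by lia; change (INR 2) with 2; change (INR 1) with 1.
    replace (- ln (gden k t) + - / 2 * ln (gden k t)) with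
      ((2 * INR k - 1) * (- / (2 * INR k) * ln (gden k t))
       + (- / 2 - / (2 * INR k)) * ln (gden k t)) by (field; lra).
    rewrite exp_plus; ring. }
  rewrite E; apply is_derive_eq with (1 := H).
  set (e := exp _); unfold gden in *; rewrite cos_pow_pred in *; field; split; lra.
Qed.

Lemma continuous_gcos t : continuous (gcos k) t.
Proof. apply (ex_derive_continuous (V := R_NormedModule)); eexists; apply is_derive_gcos. Qed.

Lemma continuous_gsin t : continuous (gsin k) t.
Proof. apply (ex_derive_continuous (V := R_NormedModule)); eexists; apply is_derive_gsin. Qed.

Lemma continuous_gspeed t : continuous (gspeed k) t.
Proof.
  apply (ex_derive_continuous (V := R_NormedModule)); unfold gspeed; auto_derive.
  repeat split; [eexists; apply is_derive_gden | apply gden_pos].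
Qed.

Lemma gcos_gsin_bounds t : Rabs (gcos k t) <= 1 /\ Rabs (gsin k t) <= 1.
Proof.
  assert (H := gcos_sq_pow t); rewrite pow_mult in H.
  assert (H1 : 0 <= gcos k t ^ 2) by apply pow2_ge_0.
  assert (H2 : 0 <= gsin k t ^ 2) by apply pow2_ge_0.
  assert (H3 : 0 <= (gcos k t ^ 2) ^ k) by (apply pow_le; exact H1).
  split; rewrite <- (Rabs_pos_eq 1) by lra; apply Rsqr_le_abs_0; unfold Rsqr.
  - destruct (Rle_or_lt (gcos k t * gcos k t) (1 * 1)) as [Hl|Hl]; [exact Hl|exfalso].
    assert (Hp : 1 < (gcos k t ^ 2) ^ k) by (apply Rlt_pow_R1; [simpl; lra | lia]); lra.
  - simpl in *; lra.
Qed.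

Lemma gcos_pos t : 0 < cos t -> 0 < gcos k t.
Proof. intros H; apply Rmult_lt_0_compat; [exact H | apply exp_pos]. Qed.

Lemma gcos_neg t : cos t < 0 -> gcos k t < 0.
Proof.
  intros H; unfold gcos; assert (E := exp_pos (- / (2 * INR k) * ln (gden k t)));
  rewrite <- (Rmult_0_l (exp (- / (2 * INR k) * ln (gden k t)))).
  apply Rmult_lt_compat_r; assumption.
Qed.

Lemma gsin_pos t : 0 < sin t -> 0 < gsin k t.
Proof. intros H; apply Rmult_lt_0_compat; [exact H | apply exp_pos]. Qed.

Lemma gsin_neg t : sin t < 0 -> gsin k t < 0.
Proof.
  intros H; unfold gsin; assert (E := exp_pos (- / 2 * ln (gden k t)));
  rewrite <- (Rmult_0_l (exp (- / 2 * ln (gden k t)))).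
  apply Rmult_lt_compat_r; assumption.
Qed.

Lemma gcos_at t c : cos t = c -> sin t = 0 -> c ^ 2 = 1 -> gcos k t = c /\ gsin k t = 0.
Proof.
  intros Hc Hs H1; unfold gcos, gsin, gden; rewrite Hc, Hs, pow_mult, H1, pow1.
  replace (1 + 0 ^ 2) with 1 by ring; rewrite ln_1, !Rmult_0_r, exp_0; split; ring.
Qed.

End GeneralizedTrig.

(** * Weighted areas inside the curve x^(2k) + y^2 = 1 *)

Lemma is_derive_RInt_0 (f : R -> R) (x : R) : (forall t, continuous f t) ->
  is_derive (fun x => RInt f 0 x) x (f x).
Proof.
  intros Hf; apply (is_derive_RInt f _ 0); [|apply Hf].
  apply filter_forall; intros t; apply (RInt_correct (V := R_CompleteNormedModule)),
    (ex_RInt_continuous (V := R_CompleteNormedModule)); intros; apply Hf.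
Qed.

Lemma derive_zero_eq (f : R -> R) (a b : R) :
  (forall t, a <= t <= b -> is_derive f t 0) -> a < b -> f a = f b.
Proof. exact (eq_is_derive f a b). Qed.

Section Area.
Variables (k n : nat).
Hypothesis hk : (1 <= k)%nat.

Let psi (x : R) : R := RInt (fun s => s ^ n * sqrt (1 - s ^ (2 * k))) 0 x.

(** [sqrt] is 0 on negative numbers, so the integrand is continuous on the whole line and the
    derivative is two-sided even at 1 and -1. *)
Lemma is_derive_psi x : is_derive psi x (x ^ n * sqrt (1 - x ^ (2 * k))).
Proof.
  apply (is_derive_RInt_0 (fun s => s ^ n * sqrt (1 - s ^ (2 * k)))).
  intros t; apply (continuous_mult (fun s => s ^ n) (fun s => sqrt (1 - s ^ (2 * k)))).
  - apply (ex_derive_continuous (V := R_NormedModule)); auto_derive; exact I.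
  - apply (continuous_comp (fun s => 1 - s ^ (2 * k)) sqrt); [|apply continuous_sqrt].
    apply (ex_derive_continuous (V := R_NormedModule)); auto_derive; exact I.
Qed.

Lemma psi_opp_1 : psi (-1) = - (-1) ^ n * psi 1.
Proof.
  assert (H : forall t : R, 0 <= t <= 1 -> is_derive (fun x => psi (- x) + (-1) ^ n * psi x) t 0).
  { intros t _.
    assert (H1 := is_derive_comp psi Ropp t _ _ (is_derive_psi (- t)) (is_derive_opp _ _ _ (is_derive_id t))).
    assert (H2 := is_derive_scal psi t ((-1) ^ n) _ (is_derive_psi t)).
    apply (is_derive_eq _ _ _ _ (is_derive_plus _ _ _ _ _ H1 H2)).
    unfold plus, scal, opp, one; simpl; unfold mult; simpl.
    replace (t * - 1) with (- t) by ring.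
    replace ((- t) ^ n) with ((-1) ^ n * t ^ n) by (rewrite <- Rpow_mult_distr; f_equal; ring).
    replace ((- t) ^ (k + (k + 0))) with (t ^ (k + (k + 0)))
      by (replace (k + (k + 0))%nat with (2 * k)%nat by lia; rewrite !pow_mult; f_equal; ring).
    ring. }
  apply derive_zero_eq in H; [|lra].
  rewrite Ropp_0 in H.
  assert (E : psi 0 = 0) by (unfold psi; rewrite RInt_point; reflexivity).
  rewrite E in H; replace (-1) with (- (1)) in * by ring; lra.
Qed.

(** On the curve [sqrt (1 - gcos^(2k))] is the absolute value of [gsin]. Hence [psi] along [gcos]
    is, up to a sign constant on each half turn, a primitive of the area integrand. *)
Lemma is_derive_psi_gcos t :
  is_derive (fun t => psi (gcos k t)) t
    (- (gspeed k t * gsin k t * Rabs (gsin k t) * gcos k t ^ n)).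
Proof.
  apply (is_derive_eq _ _ _ _ (is_derive_comp psi (gcos k) t _ _ (is_derive_psi _) (is_derive_gcos k hk t))).
  replace (1 - gcos k t ^ (2 * k)) with (Rsqr (gsin k t))
    by (unfold Rsqr; assert (H := gcos_sq_pow k hk t); simpl in *; lra).
  rewrite sqrt_Rsqr_abs; unfold scal; simpl; unfold mult; simpl; ring.
Qed.

(** The upper and the lower half turn each contribute [psi 1 - psi (-1)], and the parity of [psi]
    turns this into [(1 + (-1)^n) psi 1]. *)
Lemma area_integral (A : R -> R) :
  (forall t, is_derive A t (gspeed k t * gsin k t ^ 2 * gcos k t ^ n)) ->
  A (2 * PI) - A 0 =
  2 * (1 + (-1) ^ n) * RInt (fun s => s ^ n * sqrt (1 - s ^ (2 * k))) 0 1.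
Proof.
  intros HA; change (RInt _ 0 1) with (psi 1).
  assert (HPI := PI_RGT_0).
  assert (Hs : forall t, 0 <= t <= PI -> 0 <= gsin k t).
  { intros t Ht; apply Rmult_le_pos; [apply sin_ge_0; lra | left; apply exp_pos]. }
  assert (Hs' : forall t, PI <= t <= 2 * PI -> gsin k t <= 0).
  { intros t Ht; unfold gsin; rewrite <- (Rmult_0_l (exp (- / 2 * ln (gden k t)))).
    apply Rmult_le_compat_r; [left; apply exp_pos | apply sin_le_0; lra]. }
  assert (E1 : A 0 + psi (gcos k 0) = A PI + psi (gcos k PI)).
  { apply (derive_zero_eq (fun t => A t + psi (gcos k t))); [|exact HPI].
    intros t Ht; apply (is_derive_eq _ _ _ _ (is_derive_plus _ _ _ _ _ (HA t) (is_derive_psi_gcos t))).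
    rewrite (Rabs_pos_eq _ (Hs t Ht)); unfold plus, zero; simpl; ring. }
  assert (E2 : A PI - psi (gcos k PI) = A (2 * PI) - psi (gcos k (2 * PI))).
  { apply (derive_zero_eq (fun t => A t - psi (gcos k t))); [|lra].
    intros t Ht; apply (is_derive_eq _ _ _ _ (is_derive_minus _ _ _ _ _ (HA t) (is_derive_psi_gcos t))).
    rewrite (Rabs_left1 _ (Hs' t Ht)); unfold minus, plus, opp, zero; simpl; ring. }
  destruct (gcos_at k 0 1 cos_0 sin_0 ltac:(ring)) as [C0 _].
  destruct (gcos_at k PI (-1) cos_PI sin_PI ltac:(ring)) as [C1 _].
  destruct (gcos_at k (2 * PI) 1 cos_2PI sin_2PI ltac:(ring)) as [C2 _].
  rewrite C0, C1 in E1; rewrite C1, C2 in E2; rewrite psi_opp_1 in *.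
  lra.
Qed.

End Area.

(** * The radial equation *)

Lemma PSeries_cmult c (a : nat -> R) x : PSeries (fun n => c * a n) x = c * PSeries a x.
Proof. apply (PSeries_scal c a x). Qed.

Lemma PSeries_rescale c (a : nat -> R) x : PSeries (fun n => a n * c ^ n) x = PSeries a (x * c).
Proof. apply Series_ext; intros n; rewrite Rpow_mult_distr; ring. Qed.

Lemma PS_mult_incr_S (a b : nat -> R) p n :
  PS_mult (PS_incr_n a (S p)) b (S n) = PS_mult (PS_incr_n a p) b n.
Proof.
  unfold PS_mult; rewrite decomp_sum by lia; cbn [pred].
  rewrite PS_incr_n_0, Rmult_0_l, Rplus_0_l; reflexivity.
Qed.

Lemma PS_mult_incr (a b : nat -> R) p n : PS_mult (PS_incr_n a p) b (p + n) = PS_mult a b n.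
Proof.
  induction p as [|p IH]; [reflexivity|].
  rewrite Nat.add_succ_l, PS_mult_incr_S; exact IH.
Qed.

Lemma PS_mult_incr_lt (a b : nat -> R) p n : (n < p)%nat -> PS_mult (PS_incr_n a p) b n = 0.
Proof.
  revert p; induction n as [|n IH]; intros [|p] H; try lia.
  - unfold PS_mult; cbn [sum_f_R0]; rewrite PS_incr_n_0; ring.
  - rewrite PS_mult_incr_S; apply IH; lia.
Qed.

Lemma continuous_PS_incr (a : R -> nat -> R) x p n :
  (forall n, continuous (fun s => a s n) x) ->
  continuous (fun s => PS_incr_n (a s) p n : R) x.
Proof.
  intros Ha; revert n; induction p as [|p IH]; intros n; [apply Ha|].
  destruct n as [|n]; [apply continuous_const | apply IH].
Qed.

Lemma continuous_pow (f : R -> R) n x : continuous f x -> continuous (fun s => f s ^ n) x.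
Proof.
  intros H; induction n as [|n IH]; [apply continuous_const|].
  apply (continuous_mult f (fun s => f s ^ n)); assumption.
Qed.

(** In the recursion, the convolution term containing [b n] itself carries the factor [a t 0 = 0],
    so existence and continuity in [t] both follow from the earlier coefficients. *)
Lemma PS_inverse_family (a : R -> nat -> R) : (forall t, a t O = 0) ->
  (forall t n, continuous (fun s => a s n) t) ->
  exists b : R -> nat -> R, (forall t n, b t n = PS_one n - PS_mult (a t) (b t) n) /\
    (forall t n, continuous (fun s => b s n) t).
Proof.
  intros H0 Hc.
  destruct (causal_fixpoint (fun _ => 0) (fun (b : nat -> R -> R) n t =>
    PS_one n - PS_mult (a t) (fun m => b m t) n)) as [b Hb].
  { intros u v n H; apply functional_extensionality; intros t; f_equal.
    apply sum_eq; intros [|i] Hi; [rewrite H0; ring|].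
    rewrite H by lia; reflexivity. }
  exists (fun t n => b n t); split.
  - intros t n; exact (f_equal (fun f => f t) (Hb n)).
  - intros t n; induction n as [n IH] using (well_founded_induction lt_wf).
    change (fun s => b n s) with (b n); rewrite (Hb n).
    apply (continuous_minus (fun _ => PS_one n)); [apply continuous_const|].
    apply (continuous_sum_f_R0 (fun i s => a s i * b (n - i)%nat s)).
    intros [|i] Hi.
    + apply (continuous_ext (fun _ => 0)); [|apply continuous_const].
      intros s; rewrite H0; symmetry; apply Rmult_0_l.
    + apply (continuous_mult (fun s => a s (S i))); [apply Hc | apply IH; lia].
Qed.

Lemma Rabs_pow_le_1 x n : Rabs x <= 1 -> Rabs (x ^ n) <= 1.
Proof.
  intros H; rewrite <- RPow_abs, <- (pow1 n); apply pow_incr; split; [apply Rabs_pos | exact H].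
Qed.

Lemma l1_le_rescale r M a c : 0 <= r -> Rabs c <= 1 -> l1_le r M a ->
  l1_le r M (fun n => a n * c ^ n).
Proof.
  intros Hr Hc; apply l1_le_dom; [exact Hr|]; intros n.
  rewrite Rabs_mult; rewrite <- (Rmult_1_r (Rabs (a n))) at 2.
  apply Rmult_le_compat_l; [apply Rabs_pos | apply Rabs_pow_le_1, Hc].
Qed.

(** Halving the radius pays for the linear weight, since [n <= 2^n]. *)
Lemma l1_le_affine_weight r M a c : 0 <= r -> 0 <= c -> l1_le r M a ->
  l1_le (r / 2) ((c + 1) * M) (fun n => (c + INR n) * a n).
Proof.
  intros Hr Hc Ha N.
  apply Rle_trans with ((c + 1) * l1sum r a N);
    [|apply Rmult_le_compat_l; [lra | apply Ha]].
  unfold l1sum; rewrite <- sum_f_R0_scal; apply sum_f_R0_le; intros n _.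
  assert (Hn : INR n <= 2 ^ n).
  { clear; induction n as [|n IH]; [simpl; lra|]; rewrite S_INR; simpl.
    assert (1 <= 2 ^ n) by (apply pow_R1_Rle; lra); lra. }
  assert (H1 : 1 <= 2 ^ n) by (apply pow_R1_Rle; lra).
  assert (Hn0 := pos_INR n).
  rewrite Rabs_mult, (Rabs_pos_eq (c + INR n)) by lra.
  replace (r ^ n) with (2 ^ n * (r / 2) ^ n)
    by (rewrite <- Rpow_mult_distr; f_equal; field).
  assert (Hp := l1term_nonneg (r / 2) ltac:(lra) a n).
  replace ((c + 1) * (Rabs (a n) * (2 ^ n * (r / 2) ^ n))) with
    ((c + 1) * 2 ^ n * (Rabs (a n) * (r / 2) ^ n)) by ring.
  rewrite Rmult_assoc; apply Rmult_le_compat_r; [exact Hp|].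
  assert (0 <= c * (2 ^ n - 1)) by (apply Rmult_le_pos; lra); lra.
Qed.

(** The weight is the operator [c + z d/dz]. With [c = k + l + 1] it produces the factor of [z^l h]
    in the equation for [h']. *)
Lemma PSeries_affine_weight r M a c z : l1_le r M a -> Rabs z < r ->
  PSeries (fun n => (c + INR n) * a n) z = c * PSeries a z + z * Derive (PSeries a) z.
Proof.
  intros Ha Hz.
  assert (Hr : 0 <= r) by (assert (H := Rabs_pos z); lra).
  assert (HR := l1_CV_radius r M a Hr Ha z Hz).
  rewrite Derive_PSeries by exact HR.
  rewrite <- PSeries_incr_1, <- PSeries_cmult, <- PSeries_plus.
  - apply PSeries_ext; intros [|n]; unfold PS_plus, PS_incr_1, PS_derive, plus, zero; simpl; ring.
  - apply (ex_pseries_scal (V := R_NormedModule) c a z); [apply Rmult_comm|].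
    eexists; apply (l1_ex_pseries r M); [exact Ha | lra].
  - apply ex_pseries_incr_1, CV_radius_inside; rewrite CV_radius_derive; exact HR.
Qed.

Section PolarField.
Variables (k l p : nat) (a : nat -> R) (RF MF L : R).
Hypothesis hk : (1 <= k)%nat.
Hypothesis hp : (1 <= p)%nat.
Hypothesis HRF : 0 < RF.
Hypothesis Ha : l1_le RF MF a.
Hypothesis HL : 0 < L.

(** With [a] the coefficients of [F], [q] are those of [(k+l+1) F + z F']; [fC] and [qC] are the
    same series at [z = x gcos], expanded in [x]. [N] collects the coefficients in [x] of the ratio
    [radial_ratio] defined below. *)
Let q (n : nat) : R := (INR (k + l + 1) + INR n) * a n.
Let fC (t : R) (n : nat) : R := a n * gcos k t ^ n.
Let qC (t : R) (n : nat) : R := q n * gcos k t ^ n.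
Let P (t : R) (n : nat) : R :=
  gcos k t ^ (2 * l + 1) * PS_incr_n (PS_mult (fC t) (fC t)) p n
  + gsin k t * gcos k t ^ l / INR k * qC t n.
Let N (t : R) : nat -> R := PS_incr_n (P t) p.

(** In polar coordinates [z = x * gcos], [w - z^(l+1) F = x^k * gsin], time is eliminated by
    [dx/dt = x * gspeed * gsin * N / (1 + gcos * N)] with [N = radial_ratio t x]. *)
Definition radial_ratio (t x : R) : R :=
  x ^ p * (gcos k t ^ (2 * l + 1) * (x ^ p * PSeries a (x * gcos k t) ^ 2)
    + gsin k t * gcos k t ^ l / INR k * PSeries q (x * gcos k t)).

(** [N / (1 + gcos N)] is expanded as [N] times a Neumann series. The explicit coefficients at
    orders [p] and [p + 1] are those that determine the displayed terms of the return value. *)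
Lemma polar_field_exists : exists (H : R -> nat -> R) (R0 M : R),
  0 < R0 /\ R0 <= RF / 2 /\
  (forall t, H t O = 0) /\
  (forall n t, continuous (fun s => H s n) t) /\
  (forall t, Rabs t <= L -> l1_le R0 M (H t)) /\
  (forall t x, Rabs x < R0 -> / 2 <= 1 + gcos k t * radial_ratio t x) /\
  (forall t x, Rabs x < R0 -> PSeries (H t) x =
     gspeed k t * gsin k t * (radial_ratio t x / (1 + gcos k t * radial_ratio t x))) /\
  (forall t n, (n < p)%nat -> H t n = 0) /\
  (forall t, H t p = q O / INR k * (gspeed k t * gsin k t ^ 2 * gcos k t ^ l)) /\
  ((2 <= p)%nat -> forall t,
     H t (S p) = q 1%nat / INR k * (gspeed k t * gsin k t ^ 2 * gcos k t ^ (l + 1))) /\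
  (p = 1%nat -> forall t,
     H t 2%nat = q 1%nat / INR k * (gspeed k t * gsin k t ^ 2 * gcos k t ^ (l + 1))
       + gspeed k t * gsin k t * (gcos k t ^ (2 * l + 1) * a O ^ 2
         - gcos k t * (gsin k t * gcos k t ^ l / INR k * q O) ^ 2)).
Proof.
  assert (Hk := INR_k_pos k hk).
  (* [RF / 2] pays for the linear weight in [q], and radius at most 1 ensures that multiplication by
     [x^p] does not increase norms. *)
  set (R1 := Rmin (RF / 2) 1).
  assert (HR1 : 0 < R1 /\ R1 <= RF / 2 /\ R1 <= 1).
  { unfold R1; split; [apply Rmin_glb_lt; lra | split; [apply Rmin_l | apply Rmin_r]]. }
  assert (HR1' : 0 <= R1) by lra.
  set (Mq := (INR (k + l + 1) + 1) * MF).
  assert (Hq : l1_le R1 Mq q).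
  { apply l1_le_smaller with (RF / 2); [lra|].
    apply l1_le_affine_weight; [lra | apply pos_INR | exact Ha]. }
  assert (Ha1 : l1_le R1 MF a) by (apply l1_le_smaller with RF; [lra | exact Ha]).
  assert (HfC : forall t, l1_le R1 MF (fC t))
    by (intros t; apply l1_le_rescale; [exact HR1' | apply gcos_gsin_bounds, hk | exact Ha1]).
  assert (HqC : forall t, l1_le R1 Mq (qC t))
    by (intros t; apply l1_le_rescale; [exact HR1' | apply gcos_gsin_bounds, hk | exact Hq]).
  assert (Hinc : forall t, l1_le R1 (MF * MF) (PS_incr_n (PS_mult (fC t) (fC t)) p))
    by (intros t; apply l1_le_incr; [lra | apply l1_le_mult; auto]).
  assert (Hsc : forall t, Rabs (gsin k t * gcos k t ^ l / INR k) <= 1).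
  { intros t; destruct (gcos_gsin_bounds k hk t) as [b1 b2].
    unfold Rdiv; rewrite !Rabs_mult.
    rewrite <- (Rmult_1_r 1); apply Rmult_le_compat; auto using Rabs_pos.
    - apply Rmult_le_pos; apply Rabs_pos.
    - rewrite <- (Rmult_1_r 1); apply Rmult_le_compat; auto using Rabs_pos, Rabs_pow_le_1.
    - rewrite Rabs_pos_eq by (left; apply Rinv_0_lt_compat; lra).
      rewrite <- Rinv_1; apply Rinv_le_contravar; lra. }
  set (MP := 1 * (MF * MF) + 1 * Mq).
  assert (HP : forall t, l1_le R1 MP (P t)).
  { intros t; apply l1_le_plus; [exact HR1' | |]; apply l1_le_scal; auto.
    apply Rabs_pow_le_1, gcos_gsin_bounds, hk. }
  assert (HN : forall t, l1_le R1 MP (N t)) by (intros t; apply l1_le_incr; [lra | apply HP]).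
  assert (HN0 : forall t, N t O = 0).
  { intros t; unfold N; destruct p as [|p']; [lia | reflexivity]. }
  assert (HMP : 0 <= MP) by (apply l1_le_nonneg with R1 (P 0); auto).
  (* As [N] has no constant term, this factor on the radius brings its norm down to 1/2, so that
     [1 + gcos N] can be inverted and stays at least 1/2. *)
  set (th := / (1 + 2 * MP)).
  assert (Hth : 0 < th <= 1).
  { unfold th; split; [apply Rinv_0_lt_compat; lra|].
    rewrite <- Rinv_1; apply Rinv_le_contravar; lra. }
  assert (HthM : th * MP <= 1 / 2).
  { unfold th; apply (Rmult_le_reg_l (1 + 2 * MP)); [lra|]; rewrite <- Rmult_assoc, Rinv_r by lra; lra. }
  set (R0 := th * R1).
  assert (HR0 : 0 < R0) by (apply Rmult_lt_0_compat; lra).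
  assert (HR01 : R0 <= R1).
  { unfold R0; rewrite <- (Rmult_1_l R1) at 2; apply Rmult_le_compat_r; lra. }
  assert (HN' : forall t, l1_le R0 (1 / 2) (N t)).
  { intros t; apply l1_le_weaken with (th * MP); [exact HthM|].
    apply l1_le_shrink; [lra | lra | apply HN0 | apply HN]. }
  assert (HCN : forall t, l1_le R0 (1 / 2) (fun n => gcos k t * N t n)).
  { intros t; apply l1_le_weaken with (1 * (1 / 2)); [lra|].
    apply l1_le_scal; [lra | apply gcos_gsin_bounds, hk | apply HN']. }
  assert (HcC : forall n t, continuous (fun s => gcos k s ^ n) t)
    by (intros n t; apply continuous_pow, continuous_gcos, hk).
  assert (HfCc : forall t n, continuous (fun s => fC s n) t).
  { intros t n; apply (continuous_mult (fun _ => a n)); [apply continuous_const | apply HcC]. }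
  assert (HPc : forall t n, continuous (fun s => P s n) t).
  { intros t n; unfold P.
    apply (continuous_plus (fun s => gcos k s ^ (2 * l + 1) * PS_incr_n (PS_mult (fC s) (fC s)) p n)).
    - apply (continuous_mult (fun s => gcos k s ^ (2 * l + 1))); [apply HcC|].
      apply (continuous_PS_incr (fun s => PS_mult (fC s) (fC s))).
      intros m; apply (continuous_PS_mult fC fC); apply HfCc.
    - apply (continuous_mult (fun s => gsin k s * gcos k s ^ l / INR k)).
      + apply (continuous_mult (fun s => gsin k s * gcos k s ^ l)); [|apply continuous_const].
        apply (continuous_mult (gsin k)); [apply continuous_gsin, hk | apply HcC].
      + apply (continuous_mult (fun _ => q n)); [apply continuous_const | apply HcC]. }
  assert (HNc : forall t n, continuous (fun s => N s n) t)
    by (intros t n; apply (continuous_PS_incr P); apply HPc).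
  destruct (PS_inverse_family (fun t n => gcos k t * N t n)) as [I [HI HIc]].
  { intros t; rewrite HN0; ring. }
  { intros t n; apply (continuous_mult (gcos k)); [apply continuous_gcos, hk | apply HNc]. }
  assert (HI2 : forall t, l1_le R0 2 (I t)).
  { intros t; apply l1_inverse with (fun n => gcos k t * N t n); [lra | apply HCN | apply HI]. }
  destruct (continuity_ab_maj (gspeed k) (- L) L) as [tm [Htm _]]; [lra | |].
  { intros c _; apply continuity_pt_filterlim, continuous_gspeed, hk. }
  set (H := fun t n => gspeed k t * gsin k t * PS_mult (N t) (I t) n).
  assert (HNI : forall t, l1_le R0 1 (PS_mult (N t) (I t))).
  { intros t; apply l1_le_weaken with (1 / 2 * 2); [lra|]; apply l1_le_mult; [lra | apply HN' | apply HI2]. }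
  assert (Hval : forall t x, Rabs x < R0 -> PSeries (N t) x = radial_ratio t x).
  { intros t x Hx; unfold N, radial_ratio; rewrite PSeries_incr_n; f_equal.
    assert (Hx1 : Rabs x < R1) by lra.
    unfold P.
    rewrite (PSeries_plus (fun n => gcos k t ^ (2 * l + 1) * PS_incr_n (PS_mult (fC t) (fC t)) p n)
       (fun n => gsin k t * gcos k t ^ l / INR k * qC t n)).
    - rewrite !PSeries_cmult, PSeries_incr_n.
      rewrite (l1_PSeries_mult R1 MF MF) by auto.
      unfold qC, fC; rewrite !PSeries_rescale; ring.
    - eexists; apply (l1_ex_pseries R1 (1 * (MF * MF))); [|lra].
      apply l1_le_scal; [exact HR1' | apply Rabs_pow_le_1, gcos_gsin_bounds, hk | apply Hinc].
    - eexists; apply (l1_ex_pseries R1 (1 * Mq)); [|lra].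
      apply l1_le_scal; [exact HR1' | apply Hsc | apply HqC]. }
  assert (Hhalf : forall t x, Rabs x < R0 -> / 2 <= 1 + gcos k t * radial_ratio t x).
  { intros t x Hx; rewrite <- Hval, <- PSeries_cmult by exact Hx.
    assert (E := l1_PSeries_le R0 (1 / 2) _ (HCN t) x ltac:(lra)).
    apply Rabs_le_between in E; lra. }
  assert (HI0 : forall t, I t O = 1).
  { intros t; rewrite HI; unfold PS_mult; cbn [sum_f_R0]; rewrite HN0; simpl; ring. }
  assert (HI1 : forall t, I t 1%nat = - gcos k t * N t 1%nat).
  { intros t; rewrite HI; unfold PS_mult; cbn [sum_f_R0]; rewrite HN0, HI0; simpl; ring. }
  assert (Hp' : exists p', p = S p') by (destruct p as [|p']; [lia | exists p'; reflexivity]).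
  destruct Hp' as [p' Ep].
  assert (HP0 : forall t, P t O = gsin k t * gcos k t ^ l / INR k * q O).
  { intros t; unfold P; rewrite Ep, PS_incr_n_0; unfold qC; simpl; ring. }
  exists H, R0, (Rabs (gspeed k tm) * 1).
  split; [exact HR0|]. split; [lra|].
  split; [intros t; unfold H, PS_mult; cbn [sum_f_R0]; rewrite HN0; ring|].
  split.
  { intros n t; unfold H; apply (continuous_mult (fun s => gspeed k s * gsin k s)).
    - apply (continuous_mult (gspeed k)); [apply continuous_gspeed, hk | apply continuous_gsin, hk].
    - apply (continuous_PS_mult N I); [apply HNc | apply HIc]. }
  split.
  { intros t Ht; apply l1_le_scal; [lra | | apply HNI].
    rewrite Rabs_mult; rewrite <- (Rmult_1_r (Rabs (gspeed k tm))).
    apply Rmult_le_compat; [apply Rabs_pos | apply Rabs_pos | | apply gcos_gsin_bounds, hk].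
    rewrite !Rabs_pos_eq by (left; apply gspeed_pos, hk).
    apply Htm; apply Rabs_le_between in Ht; lra. }
  split; [exact Hhalf|].
  split.
  { intros t x Hx; unfold H; rewrite PSeries_cmult.
    rewrite (l1_PSeries_mult R0 (1 / 2) 2) by auto.
    rewrite Hval by exact Hx; f_equal.
    assert (E := l1_PSeries_inverse R0 _ (I t) x (HCN t) (HI t) Hx).
    rewrite PSeries_cmult, Hval in E by exact Hx.
    assert (E2 := Hhalf t x Hx).
    apply (Rmult_eq_reg_l (1 + gcos k t * radial_ratio t x)); [|lra].
    transitivity (radial_ratio t x * ((1 + gcos k t * radial_ratio t x) * PSeries (I t) x)); [ring|].
    rewrite E; field; lra. }
  split; [intros t n Hn; unfold H, N; rewrite PS_mult_incr_lt by exact Hn; ring|].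
  split.
  { intros t; unfold H, N.
    replace p with (p + 0)%nat at 2 by lia; rewrite PS_mult_incr.
    unfold PS_mult; cbn [sum_f_R0]; rewrite HP0, HI0; field; lra. }
  split.
  (* The square of [F] in [N] and the quadratic part of [N / (1 + gcos N)] start at order [2p]. This
     exceeds [p + 1] when [p >= 2], whereas for [p = 1] both enter at order 2. *)
  - intros H2 t; unfold H, N.
    replace (S p) with (p + 1)%nat by lia; rewrite PS_mult_incr.
    unfold PS_mult; cbn [sum_f_R0]; rewrite HI1; simpl (1 - 1)%nat; rewrite HI0.
    assert (EN : N t 1%nat = 0).
    { unfold N; destruct p as [|[|p2]]; try lia; reflexivity. }
    rewrite EN.
    assert (EP : P t 1%nat = gsin k t * gcos k t ^ l / INR k * (q 1%nat * gcos k t)).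
    { unfold P, qC; replace (PS_incr_n (PS_mult (fC t) (fC t)) p 1%nat) with 0; [simpl; ring|].
      destruct p as [|[|p2]]; try lia; reflexivity. }
    rewrite EP, pow_add; simpl; field; lra.
  - intros H1 t; unfold H, N.
    change 2%nat with (1 + 1)%nat; rewrite H1 at 1; rewrite PS_mult_incr.
    unfold PS_mult; cbn [sum_f_R0]; rewrite HI1; simpl (1 - 1)%nat; rewrite HI0.
    assert (EN : N t 1%nat = P t O) by (unfold N; rewrite H1; reflexivity).
    rewrite EN.
    assert (EP : P t 1%nat = gcos k t ^ (2 * l + 1) * a O ^ 2
      + gsin k t * gcos k t ^ l / INR k * (q 1%nat * gcos k t)).
    { unfold P at 1; rewrite H1; change (PS_incr_n (PS_mult (fC t) (fC t)) 1 1%nat) with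
        (PS_mult (fC t) (fC t) O); unfold PS_mult, qC, fC; simpl; ring. }
    rewrite EP, HP0, (pow_add _ l 1); simpl; field; lra.
Qed.

End PolarField.

(** * Coefficients of the return map *)

Lemma same_derive_eq (f g d : R -> R) :
  (forall s, is_derive f s (d s)) -> (forall s, is_derive g s (d s)) -> f 0 = g 0 ->
  forall s, f s = g s.
Proof.
  intros Hf Hg H0 s.
  assert (H := Rabs_increment_le (fun s => f s - g s) (fun _ => 0) (Rabs s) 0).
  assert (Hd : forall t, Rabs t <= Rabs s -> is_derive (fun s => f s - g s) t 0).
  { intros t _; apply (is_derive_eq _ _ _ _ (is_derive_minus _ _ _ _ _ (Hf t) (Hg t))).
    unfold minus, plus, opp; simpl; ring. }
  specialize (H Hd (fun _ _ => Req_le _ _ Rabs_R0) s (Rle_refl _)); cbv beta in H.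
  rewrite Rmult_0_l in H; apply Rabs_le_between in H; lra.
Qed.

Lemma l1_remainder r M a m x : 0 < r -> l1_le r M a -> Rabs x <= r / 2 ->
  Rabs (PSeries a x - sum_f_R0 (fun n => a n * x ^ n) m) <= 2 * M / r ^ S m * Rabs x ^ S m.
Proof.
  intros Hr Ha Hx.
  assert (Hrm : 0 < r ^ S m) by (apply pow_lt, Hr).
  assert (HM : 0 <= M) by (apply l1_le_nonneg with r a; [lra | exact Ha]).
  rewrite (PSeries_decr_n a m x) by (eexists; apply (l1_ex_pseries r M a Ha); lra).
  rewrite Rplus_minus_l, Rabs_mult, RPow_abs, Rmult_comm.
  apply Rmult_le_compat_r; [apply Rabs_pos|].
  apply (l1_PSeries_le (r / 2)); [|exact Hx].
  intros N; apply Rle_trans with (sum_f_R0 (fun n => M / r ^ S m * (/ 2) ^ n) N).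
  - apply sum_f_R0_le; intros n _; unfold PS_decr_n.
    assert (E := l1_coef_le r (Rlt_le _ _ Hr) M a (S m + n) Ha).
    rewrite pow_add in E.
    unfold Rdiv; rewrite Rpow_mult_distr, <- Rmult_assoc.
    apply Rmult_le_compat_r; [apply pow_le; lra|].
    apply (Rmult_le_reg_l (r ^ S m)); [exact Hrm|].
    replace (r ^ S m * (M * / r ^ S m)) with M by (field; lra); lra.
  - rewrite sum_f_R0_scal, tech3 by lra.
    assert (0 <= (/ 2) ^ S N) by (apply pow_le; lra).
    replace (2 * M / r ^ S m) with (M / r ^ S m * 2) by (field; lra).
    apply Rmult_le_compat_l; [apply Rcomplements.Rdiv_le_0_compat; lra|].
    apply (Rmult_le_reg_r (1 - / 2)); [lra|]; field_simplify; lra.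
Qed.

Lemma PS_pow_coef_0 (v : nat -> R) m : v O = 1 -> PS_pow v m O = 1.
Proof.
  intros H; induction m as [|m IH]; [reflexivity|].
  simpl; unfold PS_mult; cbn [sum_f_R0]; simpl (0 - 0)%nat; rewrite H, IH; ring.
Qed.

Lemma PS_pow_coef_1 (v : nat -> R) m : v O = 1 -> PS_pow v m 1%nat = INR m * v 1%nat.
Proof.
  intros H; induction m as [|m IH]; [simpl; ring|].
  rewrite S_INR; simpl PS_pow; unfold PS_mult; cbn [sum_f_R0]; simpl (1 - 0)%nat; simpl (1 - 1)%nat.
  rewrite IH, PS_pow_coef_0, H by exact H; ring.
Qed.

Lemma sum_f_R0_last (f : nat -> R) m : (forall q, (q < m)%nat -> f q = 0) -> sum_f_R0 f m = f m.
Proof.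
  destruct m as [|m]; intros H; [reflexivity|].
  rewrite tech5, sum_eq_R0 by (intros; apply H; lia); ring.
Qed.

Section AreaPrimitives.
Variable k : nat.
Hypothesis hk : (1 <= k)%nat.

Lemma area_increment n c (f : R -> R) :
  (forall t, is_derive f t (c * (gspeed k t * gsin k t ^ 2 * gcos k t ^ n))) ->
  f (2 * PI) - f 0 = c * (2 * (1 + (-1) ^ n) * RInt (fun s => s ^ n * sqrt (1 - s ^ (2 * k))) 0 1).
Proof.
  intros Hf.
  set (A := fun t => RInt (fun t => gspeed k t * gsin k t ^ 2 * gcos k t ^ n) 0 t).
  assert (HA : forall t, is_derive A t (gspeed k t * gsin k t ^ 2 * gcos k t ^ n)).
  { intros t; apply (is_derive_RInt_0 (fun t => gspeed k t * gsin k t ^ 2 * gcos k t ^ n)).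
    intros s; apply (continuous_mult (fun s => gspeed k s * gsin k s ^ 2)).
    - apply (continuous_mult (gspeed k)); [apply continuous_gspeed, hk|].
      apply continuous_pow, continuous_gsin, hk.
    - apply continuous_pow, continuous_gcos, hk. }
  rewrite <- (area_integral k n hk A HA).
  assert (E := same_derive_eq f (fun t => f 0 + c * (A t - A 0)) _ Hf).
  rewrite (E ltac:(intros t; apply (is_derive_eq _ _ _ _ (is_derive_plus _ _ _ _ _
      (is_derive_const (V := R_NormedModule) (f 0) t)
      (is_derive_scal _ _ c _ (is_derive_minus _ _ _ _ _ (HA t)
         (is_derive_const (V := R_NormedModule) (A 0) t)))));
    unfold plus, minus, opp, zero, plus; simpl; ring) ltac:(cbv beta; ring) (2 * PI)).
  ring.
Qed.

Lemma is_derive_gcos_pow m t :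
  is_derive (fun t => gcos k t ^ S m / INR (S m)) t (- (gspeed k t * gsin k t * gcos k t ^ m)).
Proof.
  assert (Hm : INR (S m) <> 0) by (apply not_0_INR; lia).
  assert (H := is_derive_scal _ t (/ INR (S m)) _ (is_derive_pow _ (S m) t _ (is_derive_gcos k hk t))).
  apply (is_derive_ext (fun t => / INR (S m) * gcos k t ^ S m));
    [intros s; unfold Rdiv; apply Rmult_comm|].
  apply (is_derive_eq _ _ _ _ H); simpl Nat.pred; field; exact Hm.
Qed.

(** The terms without [c] are exact in [gcos], so they do not contribute to a full turn. *)
Lemma area_increment_exact n m c d e (f : R -> R) :
  (forall t, is_derive f t (c * (gspeed k t * gsin k t ^ 2 * gcos k t ^ n)
     + gspeed k t * gsin k t * (d * gcos k t ^ m - e * (gsin k t ^ 2 * gcos k t ^ m)))) ->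
  f (2 * PI) - f 0 = c * (2 * (1 + (-1) ^ n) * RInt (fun s => s ^ n * sqrt (1 - s ^ (2 * k))) 0 1).
Proof.
  intros Hf.
  (* Replacing [gsin^2] by [1 - gcos^(2k)] makes the extra terms derivatives of powers of [gcos].
     [E] is minus their primitive; it takes equal values at 0 and [2 PI], so adding it to [f] leaves
     only the area term. *)
  set (E := fun t => (d - e) * (gcos k t ^ S m / INR (S m))
    + e * (gcos k t ^ S (m + 2 * k) / INR (S (m + 2 * k)))).
  assert (HE : E (2 * PI) = E 0).
  { destruct (gcos_at k 0 1 cos_0 sin_0 ltac:(ring)) as [C0 _].
    destruct (gcos_at k (2 * PI) 1 cos_2PI sin_2PI ltac:(ring)) as [C2 _].
    unfold E; rewrite C0, C2; reflexivity. }
  assert (H := area_increment n c (fun t => f t + E t)).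
  rewrite <- H; [rewrite HE; ring|].
  intros t; apply (is_derive_eq _ _ _ _ (is_derive_plus _ _ _ _ _ (Hf t)
    (is_derive_plus _ _ _ _ _
      (is_derive_scal _ t (d - e) _ (is_derive_gcos_pow m t))
      (is_derive_scal _ t e _ (is_derive_gcos_pow (m + 2 * k) t))))).
  rewrite pow_add; assert (Hs := gcos_sq_pow k hk t).
  replace (gcos k t ^ (2 * k)) with (1 - gsin k t ^ 2) by lra.
  unfold plus; simpl; ring.
Qed.

End AreaPrimitives.

Section PolarFlow.
Variables (k l p : nat) (a : nat -> R) (RF MF : R).
Hypothesis hk : (1 <= k)%nat.
Hypothesis hp : (1 <= p)%nat.
Hypothesis hl : (p + k = l + 1)%nat.
Hypothesis HRF : 0 < RF.
Hypothesis Ha : l1_le RF MF a.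

Let B0 := 2 * INR (p + 2 * k) * a O.
Let B1 := 2 * INR (p + 2 * k + 1) * a 1%nat.
Let K := INR k.
Let theta := (-1) ^ (p + k - 1).

Lemma polar_flow_exists : exists (v : nat -> R -> R) (r : R),
  0 < r /\ r <= RF / 4 /\
  (forall t, Rabs t <= 3 * PI -> l1_le r 2 (fun n => v n t)) /\
  (forall n, v n 0 = PS_one n) /\ (forall t, v O t = 1) /\
  (forall eps t, Rabs eps < r / 2 -> Rabs t < 3 * PI ->
    let rho := fun t => eps * PSeries (fun n => v n t) eps in
    / 2 <= 1 + gcos k t * radial_ratio k l p a t (rho t) /\
    is_derive rho t (rho t * (gspeed k t * gsin k t *
      (radial_ratio k l p a t (rho t) / (1 + gcos k t * radial_ratio k l p a t (rho t)))))) /\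
  (forall n t, (1 <= n < p)%nat -> v n t = 0) /\
  v p (2 * PI) = 2 * (B0 * Phi1 p k / (2 * K)) * (1 + theta) /\
  ((2 <= p)%nat -> v (S p) (2 * PI) = 2 * (B1 * Phi1 (p + 1) k / (2 * K)) * (1 - theta)) /\
  (p = 1%nat -> v 2%nat (2 * PI) = 2 *
     (((1 - theta) * B1 * Phi1 2 k + (1 + theta) / K * B0 ^ 2 * Phi1 1 k ^ 2) / (2 * K)
      + (B0 * Phi1 1 k / (2 * K) * (1 + theta)) ^ 2)).
Proof.
  assert (HPI := PI_RGT_0); assert (Hk := INR_k_pos k hk).
  (* The turn ends at [2 PI]; the larger range leaves room for two-sided derivatives at both
     ends. *)
  destruct (polar_field_exists k l p a RF MF (3 * PI) hk hp HRF Ha ltac:(lra))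
    as (H & R0 & M & HR0 & HRR & H0 & Hc & Hl1 & Hhalf & Hval & Hlow & Hp0 & Hp1 & Hp2).
  destruct (analytic_flow H (3 * PI) M R0 ltac:(lra) HR0 H0 Hc Hl1)
    as (v & r & Hr & Hr2 & Hv0 & Hd & Hvl & HV).
  assert (Hv1 : forall t, v O t = 1).
  { intros t; apply (same_derive_eq (v O) (fun _ => 1) (fun _ => 0)).
    - intros s; apply (is_derive_eq _ _ _ _ (Hd O s)).
      unfold PS_subst; cbn [sum_f_R0]; rewrite H0; ring.
    - intros s; apply (is_derive_const (V := R_NormedModule)).
    - apply Hv0. }
  assert (Hvn : forall n t, (1 <= n < p)%nat -> v n t = 0).
  { intros n t Hn; apply (same_derive_eq (v n) (fun _ => 0) (fun _ => 0)).
    - intros s; apply (is_derive_eq _ _ _ _ (Hd n s)).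
      unfold PS_subst; apply sum_eq_R0; intros q Hq; rewrite Hlow by lia; ring.
    - intros s; apply (is_derive_const (V := R_NormedModule)).
    - rewrite Hv0; destruct n; [lia | reflexivity]. }
  assert (Hvp : forall t, is_derive (v p) t (H t p)).
  { intros t; apply (is_derive_eq _ _ _ _ (Hd p t)); unfold PS_subst.
    rewrite sum_f_R0_last by (intros q Hq; rewrite Hlow by lia; ring).
    rewrite Nat.sub_diag, PS_pow_coef_0 by apply Hv1; ring. }
  (* At order [p + 1] only [q = p] and [q = p + 1] survive; the first brings in [v_1], which
     vanishes unless [p = 1]. *)
  assert (HvS : forall t, is_derive (v (S p)) t (H t p * (INR (S p) * v 1%nat t) + H t (S p))).
  { intros t; apply (is_derive_eq _ _ _ _ (Hd (S p) t)); unfold PS_subst.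
    rewrite tech5, sum_f_R0_last by (intros q Hq; rewrite Hlow by lia; ring).
    rewrite Nat.sub_diag, PS_pow_coef_0 by apply Hv1.
    replace (S p - p)%nat with 1%nat by lia; rewrite PS_pow_coef_1 by apply Hv1; ring. }
  assert (Hvp0 : v p 0 = 0) by (rewrite Hv0; destruct p; [lia | reflexivity]).
  assert (EPhi : RInt (fun s => s ^ l * sqrt (1 - s ^ (2 * k))) 0 1 = Phi1 p k).
  { unfold Phi1; replace (p + k - 1)%nat with l by lia; reflexivity. }
  assert (EPhi1 : RInt (fun s => s ^ (l + 1) * sqrt (1 - s ^ (2 * k))) 0 1 = Phi1 (p + 1) k).
  { unfold Phi1; replace (p + 1 + k - 1)%nat with (l + 1)%nat by lia; reflexivity. }
  assert (Eth : (-1) ^ l = theta) by (unfold theta; f_equal; lia).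
  assert (Eth1 : (-1) ^ (l + 1) = - theta) by (rewrite pow_add, Eth; ring).
  assert (EB0 : INR (k + l + 1) = INR (p + 2 * k)) by (f_equal; lia).
  assert (EB1 : INR (p + 2 * k + 1) = INR (p + 2 * k) + 1) by (rewrite plus_INR; reflexivity).
  assert (Ev : v p (2 * PI) = 2 * (B0 * Phi1 p k / (2 * K)) * (1 + theta)).
  { assert (E := area_increment k hk l _ (v p)
      (fun t => is_derive_eq _ _ _ _ (Hvp t) (Hp0 t))).
    rewrite Hvp0, EPhi, Eth, EB0 in E; simpl (INR 0) in E.
    rewrite Rminus_0_r in E; rewrite E; unfold B0, K; field; lra. }
  exists v, r.
  split; [exact Hr|]. split; [lra|]. split; [exact Hvl|].
  split; [exact Hv0|]. split; [exact Hv1|].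
  split.
  { intros eps t He Ht rho.
    assert (HVb : Rabs (PSeries (fun n => v n t) eps) <= 2)
      by (apply (l1_PSeries_le r 2); [apply Hvl |]; lra).
    assert (Hrho : Rabs (rho t) < R0).
    { unfold rho; rewrite Rabs_mult.
      apply Rle_lt_trans with (Rabs eps * 2); [|lra].
      apply Rmult_le_compat_l; [apply Rabs_pos | exact HVb]. }
    split; [apply Hhalf, Hrho|].
    rewrite <- Hval by exact Hrho.
    assert (E := is_derive_scal _ t eps _ (HV eps t ltac:(lra) Ht)).
    apply (is_derive_eq _ _ _ _ E); unfold rho; ring. }
  split; [exact Hvn|].
  split; [exact Ev|].
  split.
  - intros H2.
    assert (Hder : forall t, is_derive (v (S p)) t (((INR (k + l + 1) + INR 1) * a 1%nat) / INR k *
       (gspeed k t * gsin k t ^ 2 * gcos k t ^ (l + 1)))).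
    { intros t; apply (is_derive_eq _ _ _ _ (HvS t)); rewrite Hp1 by exact H2.
      rewrite (Hvn 1%nat) by lia; ring. }
    assert (E := area_increment k hk (l + 1) _ _ Hder).
    rewrite Hv0, EPhi1, Eth1, EB0 in E; simpl (PS_one _) in E; simpl (INR 1) in E.
    rewrite Rminus_0_r in E; rewrite E; unfold B1, K; rewrite EB1; field; lra.
  - intros H1.
    (* For [p = 1] the equation reads [v_2' = 2 v_1 v_1' + H_2]. Subtracting [v_1^2] removes the
       iterated integral and leaves an area term plus exact terms. *)
    assert (Hder : forall t, is_derive (fun t => v 2%nat t - v 1%nat t ^ 2) t
      (((INR (k + l + 1) + INR 1) * a 1%nat) / INR k *
         (gspeed k t * gsin k t ^ 2 * gcos k t ^ (l + 1))
       + gspeed k t * gsin k t * (a O ^ 2 * gcos k t ^ (2 * l + 1)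
         - ((INR (k + l + 1) + INR 0) * a O / INR k) ^ 2 * (gsin k t ^ 2 * gcos k t ^ (2 * l + 1))))).
    { intros t.
      assert (D2 := HvS t); assert (D1 := Hvp t); rewrite H1 in D1, D2.
      apply (is_derive_eq _ _ _ _ (is_derive_minus _ _ _ _ _ D2 (is_derive_pow _ 2 t _ D1))).
      rewrite Hp2 by exact H1.
      unfold minus, plus, opp; simpl.
      replace (l + (l + 0) + 1)%nat with (1 + (l + l))%nat by lia; rewrite (pow_add _ 1), (pow_add _ l l).
      field; lra. }
    assert (E := area_increment_exact k hk (l + 1) (2 * l + 1) _ _ _ _ Hder).
    rewrite EPhi1, Eth1, EB0 in E; cbv beta in E.
    rewrite !Hv0 in E; simpl (PS_one _) in E; simpl (INR 1) in E.
    rewrite H1 in Ev, E; rewrite Ev in E.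
    assert (Et2 : theta ^ 2 = 1).
    { unfold theta; rewrite <- pow_mult, Nat.mul_comm, pow_mult.
      replace ((-1) ^ 2) with 1 by ring; apply pow1. }
    assert (E' : v 2%nat (2 * PI) = (2 * (B0 * Phi1 1 k / (2 * K)) * (1 + theta)) ^ 2 +
      (INR (1 + 2 * k) + 1) * a 1%nat / INR k * (2 * (1 + - theta) * Phi1 (1 + 1) k)) by lra.
    rewrite E'; unfold B1; rewrite EB1, H1.
    change (1 + 1)%nat with 2%nat.
    fold K; fold K in Hk.
    (* The computed value contains [v_1^2], which the theorem displays as two summands; they agree
       because [theta^2 = 1], that is [(1 + theta)^2 = 2 (1 + theta)]. *)
    apply Rminus_diag_uniq.
    transitivity ((theta ^ 2 - 1) * ((B0 * Phi1 1 k) ^ 2 / (2 * K ^ 2))); [field; lra|].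
    rewrite Et2; ring.
Qed.

End PolarFlow.

(** * Analytic and Lipschitz functions *)

(** Convergence at [d / 2] bounds the terms there, so at radius [d / 4] the norm is dominated by a
    geometric series. *)
Lemma analytic_l1 (f : R -> R) : analytic_at_0 f ->
  exists a r M, 0 < r /\ l1_le r M a /\ forall z, Rabs z <= r -> f z = PSeries a z.
Proof.
  intros [a [d Hd]].
  assert (Hball : forall z, Rabs z < d -> is_pseries a z (f z)).
  { intros z Hz; apply Hd; unfold ball; simpl; unfold AbsRing_ball, minus, plus, opp, abs; simpl.
    rewrite Ropp_0, Rplus_0_r; exact Hz. }
  assert (Hd0 := cond_pos d).
  assert (H2 := Hball (d / 2) ltac:(rewrite Rabs_pos_eq; lra)).
  assert (Hb : exists B, forall n, Rabs (a n * (d / 2) ^ n) <= B).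
  { assert (Hs : ex_series (fun n => a n * (d / 2) ^ n)).
    { exists (f (d / 2)); apply is_series_ext with (2 := H2).
      intros n; rewrite pow_n_pow; apply Rmult_comm. }
    apply ex_series_lim_0 in Hs.
    destruct (filterlim_bounded (fun n => a n * (d / 2) ^ n)) as [B HB].
    - exists 0; exact Hs.
    - exists B; exact HB. }
  destruct Hb as [B HB].
  exists a, (d / 4), (2 * B); split; [lra|]; split.
  - intros N; apply Rle_trans with (sum_f_R0 (fun n => B * (/ 2) ^ n) N).
    + apply sum_f_R0_le; intros n _; specialize (HB n).
      rewrite Rabs_mult, (Rabs_pos_eq ((d / 2) ^ n)) in HB by (apply pow_le; lra).
      replace (d / 4) with (d / 2 * / 2) by field.
      rewrite Rpow_mult_distr, <- Rmult_assoc; apply Rmult_le_compat_r; [apply pow_le; lra | exact HB].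
    + assert (HB0 : 0 <= B) by (apply Rle_trans with (2 := HB O), Rabs_pos).
      rewrite sum_f_R0_scal, tech3 by lra.
      assert (0 <= (/ 2) ^ S N) by (apply pow_le; lra).
      rewrite (Rmult_comm 2); apply Rmult_le_compat_l; [exact HB0|].
      apply (Rmult_le_reg_r (1 - / 2)); [lra|]; field_simplify; lra.
  - intros z Hz; symmetry; apply is_pseries_unique, Hball; lra.
Qed.

(** Normalizing [f] by [f 0] leaves 1 plus a series without constant term, of norm at most 1/2 on a
    small disc. The same bound shows that [f] keeps the sign of [f 0]. *)
Lemma analytic_ratio (f g : R -> R) : analytic_at_0 f -> analytic_at_0 g -> f 0 <> 0 ->
  exists a r M, 0 < r /\ l1_le r M a /\
    (forall z, Rabs z < r -> ratio f g z = PSeries a z /\ / 2 <= f z / f 0).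
Proof.
  intros Hf Hg Hf0.
  destruct (analytic_l1 f Hf) as (af & rf & Mf & Hrf & Hlf & Ef).
  destruct (analytic_l1 g Hg) as (ag & rg & Mg & Hrg & Hlg & Eg).
  assert (Ea : af O = f 0) by (rewrite (Ef 0) by (rewrite Rabs_R0; lra); symmetry; apply PSeries_0).
  set (r1 := Rmin rf rg).
  assert (Hr1 : 0 < r1 /\ r1 <= rf /\ r1 <= rg).
  { unfold r1; split; [apply Rmin_glb_lt; lra | split; [apply Rmin_l | apply Rmin_r]]. }
  set (b := fun n => match n with O => 0 | S _ => / f 0 * af n end).
  set (Mb := Rabs (/ f 0) * Mf).
  assert (Hb : l1_le r1 Mb b).
  { apply l1_le_dom with (fun n => / f 0 * af n); [lra | |].
    - intros [|n]; simpl; [rewrite Rabs_R0; apply Rabs_pos | lra].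
    - apply l1_le_scal; [lra | lra | apply l1_le_smaller with rf; [lra | exact Hlf]]. }
  assert (HMb : 0 <= Mb) by (apply l1_le_nonneg with r1 b; [lra | exact Hb]).
  set (th := / (1 + 2 * Mb)).
  assert (Hth : 0 < th <= 1).
  { unfold th; split; [apply Rinv_0_lt_compat; lra|].
    rewrite <- Rinv_1; apply Rinv_le_contravar; lra. }
  assert (HthM : th * Mb <= 1 / 2).
  { unfold th; apply (Rmult_le_reg_l (1 + 2 * Mb)); [lra|]; rewrite <- Rmult_assoc, Rinv_r by lra; lra. }
  set (r := th * r1).
  assert (Hr : 0 < r) by (apply Rmult_lt_0_compat; lra).
  assert (Hrr1 : r <= r1).
  { unfold r; rewrite <- (Rmult_1_l r1) at 2; apply Rmult_le_compat_r; lra. }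
  assert (Hb' : l1_le r (1 / 2) b).
  { apply l1_le_weaken with (th * Mb); [exact HthM|].
    apply l1_le_shrink; [lra | lra | reflexivity | exact Hb]. }
  destruct (PS_inverse_exists b eq_refl) as [i Hi].
  assert (Hi2 := l1_inverse r b i ltac:(lra) Hb' Hi).
  assert (Hg' : l1_le r Mg ag) by (apply l1_le_smaller with rg; [lra | exact Hlg]).
  exists (fun n => / f 0 * PS_mult ag i n), r, (Rabs (/ f 0) * (Mg * 2)).
  split; [exact Hr|]; split.
  { apply l1_le_scal; [lra | lra | apply l1_le_mult; [lra | exact Hg' | exact Hi2]]. }
  intros z Hz.
  assert (Efz : f z = f 0 * (1 + PSeries b z)).
  { rewrite (Ef z) by lra.
    rewrite <- (PSeries_one z), <- PSeries_plus.
    - rewrite <- PSeries_scal; apply PSeries_ext; intros [|n];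
        unfold PS_scal, PS_plus, plus, scal; simpl; unfold mult; simpl; [rewrite Ea; ring|].
      field; exact Hf0.
    - eexists; apply (l1_ex_pseries r 1); [apply l1_one | lra].
    - eexists; apply (l1_ex_pseries r (1/2)); [exact Hb' | lra]. }
  assert (Ebz := l1_PSeries_le r (1/2) b Hb' z ltac:(lra)); apply Rabs_le_between in Ebz.
  split.
  - unfold ratio; rewrite PSeries_cmult.
    rewrite (l1_PSeries_mult r Mg 2) by assumption.
    rewrite <- (Eg z) by lra.
    assert (EI := l1_PSeries_inverse r b i z Hb' Hi Hz).
    rewrite Efz.
    replace (PSeries i z) with (/ (1 + PSeries b z)).
    + field; split; [lra | exact Hf0].
    + apply (Rmult_eq_reg_l (1 + PSeries b z)); [|lra]; rewrite EI; field; lra.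
  - rewrite Efz; replace (f 0 * (1 + PSeries b z) / f 0) with (1 + PSeries b z) by (field; exact Hf0); lra.
Qed.

(** Boundedness is included because Lipschitz functions alone are not closed under products with a
    uniform constant. *)
Definition lip_bounded (r : R) (f : R -> R) : Prop :=
  exists K, 0 <= K /\ (forall x, Rabs x <= r -> Rabs (f x) <= K) /\
    (forall x y, Rabs x <= r -> Rabs y <= r -> Rabs (f x - f y) <= K * Rabs (x - y)).

Lemma lip_bounded_mult r f g : lip_bounded r f -> lip_bounded r g ->
  lip_bounded r (fun x => f x * g x).
Proof.
  intros [K [HK [Hf1 Hf2]]] [K' [HK' [Hg1 Hg2]]].
  exists (2 * (K * K') + K * K'); assert (0 <= K * K') by (apply Rmult_le_pos; assumption).
  split; [lra|]; split.
  - intros x Hx; rewrite Rabs_mult.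
    apply Rle_trans with (K * K'); [|lra].
    apply Rmult_le_compat; auto using Rabs_pos.
  - intros x y Hx Hy.
    replace (f x * g x - f y * g y) with (f x * (g x - g y) + (f x - f y) * g y) by ring.
    eapply Rle_trans; [apply Rabs_triang|]; rewrite !Rabs_mult.
    assert (H0 := Rabs_pos (x - y)).
    assert (H1 : Rabs (f x) * Rabs (g x - g y) <= K * (K' * Rabs (x - y)))
      by (apply Rmult_le_compat; auto using Rabs_pos).
    assert (H2 : Rabs (f x - f y) * Rabs (g y) <= (K * Rabs (x - y)) * K')
      by (apply Rmult_le_compat; auto using Rabs_pos).
    assert (0 <= K * K' * Rabs (x - y)) by (apply Rmult_le_pos; assumption).
    lra.
Qed.

Lemma lip_bounded_pow r n : 0 <= r -> lip_bounded r (fun x => x ^ n).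
Proof.
  intros Hr; induction n as [|n IH].
  - exists 1; split; [lra|]; split; intros; simpl; [rewrite Rabs_R1; lra|].
    rewrite Rminus_diag, Rabs_R0, Rmult_1_l; apply Rabs_pos.
  - apply (lip_bounded_mult r (fun x => x)); [|exact IH].
    exists (r + 1); split; [lra|]; split; intros x.
    + intros Hx; lra.
    + intros y _ _; assert (H := Rabs_pos (x - y)).
      assert (0 <= r * Rabs (x - y)) by (apply Rmult_le_pos; assumption); lra.
Qed.

Lemma lip_bounded_pseries r M a : 0 < r -> l1_le r M a -> lip_bounded (r / 2) (PSeries a).
Proof.
  intros Hr Ha.
  assert (HM := l1_le_nonneg r ltac:(lra) M a Ha).
  assert (Hin : forall x, Rabs x <= r / 2 -> Rbar_lt (Rabs x) (CV_radius a))
    by (intros x Hx; apply (l1_CV_radius r M); [lra | exact Ha | lra]).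
  destruct (continuity_ab_maj (fun x => Rabs (PSeries (PS_derive a) x)) (- (r / 2)) (r / 2))
    as [m [Hm _]]; [lra | |].
  { intros c Hc; apply continuity_pt_filterlim.
    apply continuous_Rabs_comp.
    apply continuity_pt_filterlim, PSeries_continuity; rewrite CV_radius_derive; apply Hin, Rabs_le; lra. }
  exists (M + Rabs (PSeries (PS_derive a) m)); assert (Hp := Rabs_pos (PSeries (PS_derive a) m)).
  split; [lra|]; split.
  - intros x Hx; apply Rle_trans with M; [|lra]; apply (l1_PSeries_le r M a Ha); lra.
  - intros x y Hx Hy; apply Rabs_le_between in Hx; apply Rabs_le_between in Hy.
    assert (Hb : forall t, Rmin y x <= t <= Rmax y x -> - (r / 2) <= t <= r / 2).
    { intros t Ht; unfold Rmin, Rmax in Ht; destruct (Rle_dec y x); lra. }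
    destruct (MVT_gen (PSeries a) y x (PSeries (PS_derive a))) as [c [Hc E]].
    + intros t Ht; apply is_derive_PSeries, Hin, Rabs_le, Hb; lra.
    + intros t Ht; apply PSeries_continuity, Hin, Rabs_le, Hb, Ht.
    + rewrite E, Rabs_mult; apply Rmult_le_compat_r; [apply Rabs_pos|].
      apply Rle_trans with (Rabs (PSeries (PS_derive a) m)); [|lra]; apply Hm, Hb, Hc.
Qed.

Lemma lip_bounded_ext r f g : (forall x, Rabs x <= r -> f x = g x) ->
  lip_bounded r g -> lip_bounded r f.
Proof.
  intros H [K [HK [H1 H2]]]; exists K; split; [exact HK|]; split; intros x.
  - intros Hx; rewrite H by exact Hx; auto.
  - intros y Hx Hy; rewrite !H by assumption; auto.
Qed.

Lemma lip_bounded_smaller r r' f : r' <= r -> lip_bounded r f -> lip_bounded r' f.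
Proof.
  intros H [K [HK [H1 H2]]]; exists K; split; [exact HK|]; split; intros x.
  - intros Hx; apply H1; lra.
  - intros y Hx Hy; apply H2; lra.
Qed.

Lemma lip_bounded_analytic f : analytic_at_0 f -> exists r, 0 < r /\ lip_bounded r f.
Proof.
  intros Hf; destruct (analytic_l1 f Hf) as (a & r & M & Hr & Ha & E).
  exists (r / 2); split; [lra|].
  apply lip_bounded_ext with (PSeries a); [intros x Hx; apply E; lra|].
  apply lip_bounded_pseries with M; assumption.
Qed.

(** * Uniqueness of solutions *)

Lemma is_derive_locally_lt (f : R -> R) x d c : is_derive f x d -> f x < c ->
  exists eta, 0 < eta /\ forall t, Rabs (t - x) < eta -> f t < c.
Proof.
  intros Hd Hc.
  assert (Hcont : continuous f x) by (apply (ex_derive_continuous (V := R_NormedModule)); eexists; exact Hd).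
  destruct (Hcont (fun y => y < c)) as [eta He].
  - apply (open_lt c); exact Hc.
  - exists eta; split; [apply cond_pos|]; intros t Ht; apply He; exact Ht.
Qed.

Lemma nonincreasing_of_derive (f df : R -> R) a b : a <= b ->
  (forall t, a <= t <= b -> is_derive f t (df t)) -> (forall t, a <= t <= b -> df t <= 0) ->
  f b <= f a.
Proof.
  intros Hab Hd Hn.
  destruct (MVT_gen f a b df) as [c [Hc E]]; rewrite ?Rmin_left, ?Rmax_right in * by exact Hab.
  - intros x Hx; apply Hd; lra.
  - intros x Hx; apply continuity_pt_filterlim, (ex_derive_continuous (V := R_NormedModule)).
    eexists; apply Hd, Hx.
  - assert (H := Rmult_le_compat_r (b - a) (df c) 0 ltac:(lra) (Hn c Hc)); lra.
Qed.

(** A Gronwall inequality that is only assumed while [D] is small: at the last zero of [D]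
    it is small, hence it stays zero. *)
Lemma local_gronwall_zero (D dD : R -> R) T K delta :
  0 < delta -> (forall t, 0 <= t <= T -> is_derive D t (dD t)) ->
  (forall t, 0 <= t <= T -> 0 <= D t) -> D 0 = 0 ->
  (forall t, 0 <= t <= T -> D t <= delta -> dD t <= K * D t) ->
  forall t, 0 <= t <= T -> D t = 0.
Proof.
  intros Hdel Hd Hpos H0 HK t1 Ht1.
  destruct (Hpos t1 Ht1) as [Hp|Hp]; [exfalso | symmetry; exact Hp].
  set (S := fun t => 0 <= t <= t1 /\ D t = 0).
  destruct (completeness S) as [s [Hub Hlub]].
  - exists t1; intros t [Ht _]; lra.
  - exists 0; split; [lra | exact H0].
  - assert (Hs0 : 0 <= s) by (apply Hub; split; [lra | exact H0]).
    assert (Hs1 : s <= t1) by (apply Hlub; intros t [Ht _]; lra).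
    assert (HDs : D s = 0).
    { destruct (Hpos s ltac:(lra)) as [Hs|Hs]; [exfalso | symmetry; exact Hs].
      destruct (is_derive_locally_lt (fun t => - D t) s (- dD s) 0) as [eta [He1 He2]].
      - apply (is_derive_opp D), Hd; lra.
      - lra.
      - assert (s <= s - eta / 2); [|lra].
        apply Hlub; intros t [Ht HDt].
        destruct (Rle_or_lt t (s - eta / 2)) as [Hle|Hlt]; [exact Hle|exfalso].
        assert (Hts : t <= s) by (apply Hub; split; assumption).
        assert (- D t < 0) by (apply He2, Rabs_def1; lra); lra. }
    assert (Hst : s < t1) by (destruct Hs1 as [Hs1|Hs1]; [exact Hs1 | subst s; lra]).
    destruct (is_derive_locally_lt D s (dD s) delta) as [eta [He1 He2]]; [apply Hd; lra | lra |].
    set (t2 := Rmin (s + eta / 2) t1).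
    assert (Ht2 : s < t2 /\ t2 <= s + eta / 2 /\ t2 <= t1).
    { unfold t2; split; [apply Rmin_glb_lt; lra | split; [apply Rmin_l | apply Rmin_r]]. }
    assert (E := nonincreasing_of_derive (fun t => exp (- K * t) * D t)
      (fun t => exp (- K * t) * (dD t - K * D t)) s t2 ltac:(lra)).
    assert (E' : exp (- K * t2) * D t2 <= exp (- K * s) * D s).
    { apply E.
      - intros t Ht.
        assert (Dt := Hd t ltac:(lra)).
        auto_derive; [eexists; exact Dt|].
        replace (Derive (fun x : R => D x) t) with (dD t)
          by (symmetry; exact (is_derive_unique _ _ _ Dt)).
        ring.
      - intros t Ht.
        assert (HDd : D t <= delta) by (left; apply He2, Rabs_def1; lra).
        assert (HKt := HK t ltac:(lra) HDd).
        rewrite <- (Rmult_0_r (exp (- K * t))); apply Rmult_le_compat_l; [left; apply exp_pos | lra]. }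
    rewrite HDs, Rmult_0_r in E'.
    assert (HD2 : D t2 = 0).
    { apply Rle_antisym; [|apply Hpos; lra].
      apply (Rmult_le_reg_l (exp (- K * t2))); [apply exp_pos | lra]. }
    assert (t2 <= s) by (apply Hub; split; [lra | exact HD2]); lra.
Qed.

(** The splitting is asymmetric on purpose: [w] belongs to the reference solution, while the
    competitor [w'] has no a priori bound. *)
Lemma lip_product_increment r F K W z z' w w' :
  (forall x, Rabs x <= r -> Rabs (F x) <= K) ->
  (forall x y, Rabs x <= r -> Rabs y <= r -> Rabs (F x - F y) <= K * Rabs (x - y)) ->
  Rabs z <= r -> Rabs z' <= r -> Rabs w <= W -> 0 <= K ->
  Rabs (w' * F z' - w * F z) <= K * Rabs (w' - w) + W * K * Rabs (z' - z).
Proof.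
  intros HB HL Hz Hz' Hw HK.
  replace (w' * F z' - w * F z) with ((w' - w) * F z' + w * (F z' - F z)) by ring.
  eapply Rle_trans; [apply Rabs_triang|]; rewrite !Rabs_mult.
  apply Rplus_le_compat.
  - rewrite Rmult_comm; apply Rmult_le_compat_r; [apply Rabs_pos | apply HB, Hz'].
  - rewrite Rmult_assoc; apply Rmult_le_compat; auto using Rabs_pos.
Qed.

Lemma solution_unique k l f g r T z w z' w' :
  0 < r -> 0 < T -> lip_bounded r f -> lip_bounded r g ->
  is_solution k l f g z w T -> is_solution k l f g z' w' T ->
  z' 0 = z 0 -> w' 0 = w 0 -> (forall t, 0 <= t <= T -> Rabs (z t) <= r / 2) ->
  forall t, 0 <= t <= T -> z' t = z t /\ w' t = w t.
Proof.
  intros Hr HT Hf Hg Hs Hs' Ez Ew Hz.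
  unfold is_solution in Hs, Hs'; rewrite Rmin_left, Rmax_right in Hs, Hs' by lra.
  assert (HP := lip_bounded_mult r _ _ (lip_bounded_pow r (l + 1) ltac:(lra)) Hg).
  assert (HA := lip_bounded_mult r _ _ (lip_bounded_pow r (2 * k - 1) ltac:(lra)) Hf).
  assert (HB := lip_bounded_mult r _ _ (lip_bounded_pow r l ltac:(lra)) Hg).
  destruct Hf as (Kf & Kf0 & Kf1 & Kf2); destruct HP as (KP & KP0 & KP1 & KP2).
  destruct HA as (KA & KA0 & KA1 & KA2); destruct HB as (KB & KB0 & KB1 & KB2).
  destruct (continuity_ab_maj (fun t => Rabs (w t)) 0 T ltac:(lra)) as [tm [Htm _]].
  { intros c Hc; apply continuity_pt_filterlim, continuous_Rabs_comp,
      (ex_derive_continuous (V := R_NormedModule)).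
    eexists; apply (Hs c Hc). }
  set (W := Rabs (w tm)) in *; assert (HW : 0 <= W) by apply Rabs_pos.
  assert (Hk := pos_INR k).
  set (D := fun t => (z' t - z t) ^ 2 + (w' t - w t) ^ 2).
  set (v1 := fun z w : R => - w * f z + z ^ (l + 1) * g z).
  set (v2 := fun z w : R => INR k * z ^ (2 * k - 1) * f z + INR k * w * z ^ l * g z).
  set (Q := Kf + W * Kf + KP + INR k * KA + INR k * KB + INR k * (W * KB)).
  assert (HkKA : 0 <= INR k * KA) by (apply Rmult_le_pos; assumption).
  assert (HkKB : 0 <= INR k * KB) by (apply Rmult_le_pos; assumption).
  assert (HWKf : 0 <= W * Kf) by (apply Rmult_le_pos; assumption).
  assert (HWKB : 0 <= INR k * (W * KB)) by (repeat apply Rmult_le_pos; assumption).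
  assert (HD : forall t, 0 <= t <= T -> D t = 0).
  { apply (local_gronwall_zero D (fun t =>
      2 * (z' t - z t) * (v1 (z' t) (w' t) - v1 (z t) (w t)) +
      2 * (w' t - w t) * (v2 (z' t) (w' t) - v2 (z t) (w t))) T (4 * Q) ((r / 2) ^ 2)).
    - apply pow_lt; lra.
    - intros t Ht; destruct (Hs t Ht) as [d1 d2]; destruct (Hs' t Ht) as [d3 d4].
      apply (is_derive_eq _ _ _ _ (is_derive_plus _ _ _ _ _
        (is_derive_pow _ 2 t _ (is_derive_minus _ _ _ _ _ d3 d1))
        (is_derive_pow _ 2 t _ (is_derive_minus _ _ _ _ _ d4 d2)))).
      unfold v1, v2, plus, minus, opp, plus; simpl; ring.
    - intros t _; unfold D; apply Rplus_le_le_0_compat; apply pow2_ge_0.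
    - unfold D; rewrite Ez, Ew; ring.
    - intros t Ht HDt.
      (* The threshold [(r/2)^2] on [D], together with [Rabs (z t) <= r / 2], keeps [z'] inside the
         disc where the Lipschitz bounds hold. *)
      assert (Hdz : Rabs (z' t - z t) <= r / 2).
      { rewrite <- (Rabs_pos_eq (r / 2)) by lra; apply Rsqr_le_abs_0; unfold Rsqr.
        unfold D in HDt; assert (H0 := pow2_ge_0 (w' t - w t)); simpl in *; lra. }
      assert (Hzt := Hz t Ht).
      assert (Hz' : Rabs (z' t) <= r).
      { replace (z' t) with ((z' t - z t) + z t) by ring.
        eapply Rle_trans; [apply Rabs_triang | lra]. }
      assert (Hw : Rabs (w t) <= W) by apply Htm, Ht.
      assert (Hzr : Rabs (z t) <= r) by lra.
      set (dz := Rabs (z' t - z t)) in *; set (dw := Rabs (w' t - w t)).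
      assert (Hdz0 : 0 <= dz) by apply Rabs_pos; assert (Hdw0 : 0 <= dw) by apply Rabs_pos.
      assert (B1 : Rabs (v1 (z' t) (w' t) - v1 (z t) (w t)) <= Q * (dz + dw)).
      { unfold v1.
        replace (_ - _) with (- (w' t * f (z' t) - w t * f (z t)) +
          (z' t ^ (l + 1) * g (z' t) - z t ^ (l + 1) * g (z t))) by ring.
        eapply Rle_trans; [apply Rabs_triang|]; rewrite Rabs_Ropp.
        assert (A1 := lip_product_increment r f Kf W _ _ _ (w' t) Kf1 Kf2 Hzr Hz' Hw Kf0).
        assert (A2 := KP2 _ _ Hz' Hzr); cbv beta in A2; fold dz in A1, A2; fold dw in A1.
        assert (0 <= (KP + INR k * KA + INR k * KB + INR k * (W * KB) + W * Kf) * dw)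
          by (apply Rmult_le_pos; lra).
        assert (0 <= (Kf + INR k * KA + INR k * KB + INR k * (W * KB)) * dz)
          by (apply Rmult_le_pos; lra).
        unfold Q; lra. }
      assert (B2 : Rabs (v2 (z' t) (w' t) - v2 (z t) (w t)) <= Q * (dz + dw)).
      { unfold v2.
        replace (_ - _) with (INR k * ((z' t ^ (2 * k - 1) * f (z' t) - z t ^ (2 * k - 1) * f (z t))
          + (w' t * (z' t ^ l * g (z' t)) - w t * (z t ^ l * g (z t))))) by ring.
        rewrite Rabs_mult, (Rabs_pos_eq (INR k)) by exact Hk.
        assert (A1 := lip_product_increment r _ KB W _ _ _ (w' t) KB1 KB2 Hzr Hz' Hw KB0).
        assert (A2 := KA2 _ _ Hz' Hzr); cbv beta in A1, A2; fold dz in A1, A2; fold dw in A1.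
        apply Rle_trans with (INR k * (KA * dz + (KB * dw + W * KB * dz))).
        - apply Rmult_le_compat_l; [exact Hk|].
          eapply Rle_trans; [apply Rabs_triang|]; lra.
        - assert (0 <= (KP + INR k * KA + INR k * (W * KB) + Kf + W * Kf) * dw)
            by (apply Rmult_le_pos; lra).
          assert (0 <= (Kf + W * Kf + KP + INR k * KB) * dz)
            by (apply Rmult_le_pos; lra).
          unfold Q; lra. }
      assert (HQ : 0 <= Q) by (unfold Q; lra).
      assert (C1 : (z' t - z t) * (v1 (z' t) (w' t) - v1 (z t) (w t)) <= dz * (Q * (dz + dw))).
      { eapply Rle_trans; [apply Rle_abs|]; rewrite Rabs_mult; apply Rmult_le_compat_l; assumption. }
      assert (C2 : (w' t - w t) * (v2 (z' t) (w' t) - v2 (z t) (w t)) <= dw * (Q * (dz + dw))).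
      { eapply Rle_trans; [apply Rle_abs|]; rewrite Rabs_mult; apply Rmult_le_compat_l; assumption. }
      assert (ED : D t = dz ^ 2 + dw ^ 2) by (unfold D, dz, dw; rewrite !pow2_abs; reflexivity).
      rewrite ED.
      (* The two products sum to at most [2 Q (dz + dw)^2], and [(dz + dw)^2 <= 2 (dz^2 + dw^2)]
         gives the constant [4 Q]. *)
      assert (0 <= Q * (dz - dw) ^ 2) by (apply Rmult_le_pos; [exact HQ | apply pow2_ge_0]).
      lra. }
  intros t Ht; specialize (HD t Ht); unfold D in HD.
  assert (H1 := pow2_ge_0 (z' t - z t)); assert (H2 := pow2_ge_0 (w' t - w t)).
  assert (E1 : (z' t - z t) ^ 2 = 0) by lra; assert (E2 : (w' t - w t) ^ 2 = 0) by lra.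
  split; apply Rminus_diag_uniq; eapply Rsqr_0_uniq; unfold Rsqr; simpl in *; lra.
Qed.

(** * Construction of the orbit *)

(** Extends a function continuous on [[-L, L]] to the line, so that its primitive is defined
    everywhere. Minimum and maximum are rewritten through absolute values to get continuity. *)
Lemma continuous_clamp (f : R -> R) L : 0 < L ->
  (forall s, Rabs s <= L -> continuous f s) ->
  forall s, continuous (fun s => f (Rmax (- L) (Rmin s L))) s.
Proof.
  intros HL Hf s.
  assert (Hb : forall s, Rabs (Rmax (- L) (Rmin s L)) <= L).
  { intros u; apply Rabs_le; unfold Rmax, Rmin; destruct (Rle_dec u L); destruct Rle_dec; lra. }
  apply (continuous_comp (fun s => Rmax (- L) (Rmin s L)) f); [|apply Hf, Hb].
  apply (continuous_ext (fun s => (- L + (s + L - Rabs (s - L)) / 2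
    + Rabs (- L - (s + L - Rabs (s - L)) / 2)) / 2)).
  { intros u; unfold Rmax, Rmin, Rabs; destruct (Rle_dec u L); destruct Rle_dec;
      repeat destruct Rcase_abs; lra. }
  assert (Hr : forall t, continuous (fun s => (s + L - Rabs (s - L)) / 2) t).
  { intros t; unfold Rdiv; apply (continuous_mult (fun s => s + L - Rabs (s - L)));
      [|apply continuous_const].
    apply (continuous_minus (fun s => s + L)).
    - apply (ex_derive_continuous (V := R_NormedModule)); auto_derive; exact Logic.I.
    - apply continuous_Rabs_comp, (ex_derive_continuous (V := R_NormedModule)); auto_derive;
        exact Logic.I. }
  unfold Rdiv at 1; apply (continuous_mult (fun s => - L + (s + L - Rabs (s - L)) / 2
    + Rabs (- L - (s + L - Rabs (s - L)) / 2))); [|apply continuous_const].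
  apply (continuous_plus (fun s => - L + (s + L - Rabs (s - L)) / 2)).
  - apply (continuous_plus (fun _ => - L)); [apply continuous_const | apply Hr].
  - apply continuous_Rabs_comp.
    apply (continuous_minus (fun _ => - L)); [apply continuous_const | apply Hr].
Qed.

(** The lower bound [m] makes [th] expanding: it is injective, reaches every [t] between
    [- Rabs t / m] and [Rabs t / m], and has an inverse with Lipschitz constant [/ m]. *)
Lemma inverse_of_increasing (th tau : R -> R) m : 0 < m -> th 0 = 0 ->
  (forall s, is_derive th s (tau s)) -> (forall s, m <= tau s) ->
  (forall a b, a < b -> th a < th b) /\
  exists ph : R -> R, (forall s, ph (th s) = s) /\ (forall t, th (ph t) = t) /\
    forall t, is_derive ph t (/ tau (ph t)).
Proof.
  intros Hm H0 Hd Htau.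
  assert (Hexp : forall a b, a <= b -> m * (b - a) <= th b - th a).
  { intros a b Hab.
    assert (E := nonincreasing_of_derive (fun s => m * s - th s) (fun s => m - tau s) a b Hab).
    assert (m * b - th b <= m * a - th a); [apply E|lra].
    - intros t _; apply (is_derive_eq _ _ _ _ (is_derive_minus _ _ _ _ _
        (is_derive_scal _ t m _ (is_derive_id t)) (Hd t))).
      unfold minus, plus, opp, one; simpl; ring.
    - intros t _; specialize (Htau t); lra. }
  assert (Hinc : forall a b, a < b -> th a < th b).
  { intros a b Hab; assert (E := Hexp a b ltac:(lra)).
    assert (0 < m * (b - a)) by (apply Rmult_lt_0_compat; lra); lra. }
  split; [exact Hinc|].
  assert (Hinj : forall a b, th a = th b -> a = b).
  { intros a b E; destruct (Rtotal_order a b) as [H|[H|H]]; [|exact H|];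
      apply Hinc in H; lra. }
  assert (Hc : continuity th).
  { intros s; apply continuity_pt_filterlim, (ex_derive_continuous (V := R_NormedModule)).
    eexists; apply Hd. }
  assert (Hsur : forall t, { s | th s = t }).
  { intros t.
    assert (Ht := Rabs_pos t).
    assert (Hq : 0 <= Rabs t / m) by (apply Rcomplements.Rdiv_le_0_compat; lra).
    assert (E1 := Hexp 0 (Rabs t / m) Hq).
    assert (E2 := Hexp (- (Rabs t / m)) 0 ltac:(lra)).
    replace (m * (Rabs t / m - 0)) with (Rabs t) in E1 by (field; lra).
    replace (m * (0 - - (Rabs t / m))) with (Rabs t) in E2 by (field; lra).
    assert (Hab := Rle_abs t); assert (Hab' := Rle_abs (- t)); rewrite Rabs_Ropp in Hab'.
    destruct (IVT_gen th (- (Rabs t / m)) (Rabs t / m) t Hc) as [s [_ Hs]].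
    - rewrite Rmin_left, Rmax_right by lra; lra.
    - exists s; exact Hs. }
  exists (fun t => proj1_sig (Hsur t)).
  set (ph := fun t => proj1_sig (Hsur t)).
  assert (Hth : forall t, th (ph t) = t) by (intros t; exact (proj2_sig (Hsur t))).
  split; [intros s; apply Hinj, (Hth (th s))|].
  split; [exact Hth|].
  assert (Hlip : forall t h, m * Rabs (ph (t + h) - ph t) <= Rabs h).
  { intros t h.
    replace h with (th (ph (t + h)) - th (ph t)) at 2 by (rewrite !Hth; ring).
    destruct (Rle_or_lt (ph t) (ph (t + h))) as [Hle|Hlt].
    - assert (E := Hexp _ _ Hle); rewrite !Rabs_pos_eq; [exact E | | lra].
      assert (0 <= m * (ph (t + h) - ph t)) by (apply Rmult_le_pos; lra); lra.
    - assert (E := Hexp _ _ (Rlt_le _ _ Hlt)).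
      assert (Hlt' := Hinc _ _ Hlt); rewrite !Rabs_left by lra; lra. }
  intros t; apply is_derive_Reals; intros eps Heps.
  assert (Ht0 := Htau (ph t)).
  assert (D := Hd (ph t)); apply is_derive_Reals in D.
  (* The error for the inverse is that of [h / d] times two factors bounded by [/ m], which leaves
     [eps / 2]. *)
  destruct (D (eps * m * m / 2)) as [del Hdel].
  { repeat apply Rmult_lt_0_compat; lra. }
  assert (Hdelp := cond_pos del).
  exists (mkposreal (m * del) (Rmult_lt_0_compat _ _ Hm Hdelp)); intros h Hh0 Hh; simpl in Hh.
  change (proj1_sig (Hsur (t + h))) with (ph (t + h)).
  change (proj1_sig (Hsur t)) with (ph t).
  set (d := ph (t + h) - ph t).
  assert (Hd0 : d <> 0).
  { intros E; apply Hh0.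
    assert (ph (t + h) = ph t) by (unfold d in E; lra).
    assert (th (ph (t + h)) = th (ph t)) by (f_equal; assumption).
    rewrite !Hth in *; lra. }
  assert (Hdl := Hlip t h); fold d in Hdl.
  assert (Hdd : Rabs d < del) by (apply (Rmult_lt_reg_l m); lra).
  specialize (Hdel d Hd0 Hdd).
  replace (ph t + d) with (ph (t + h)) in Hdel by (unfold d; ring).
  rewrite !Hth in Hdel; replace (t + h - t) with h in Hdel by ring.
  replace (d / h - / tau (ph t)) with (- ((h / d - tau (ph t)) * (d / h * / tau (ph t))))
    by (field; repeat split; lra).
  rewrite Rabs_Ropp, Rabs_mult, Rabs_mult.
  assert (A1 : Rabs (d / h) <= / m).
  { unfold Rdiv; rewrite Rabs_mult, Rabs_inv.
    assert (Hhp : 0 < Rabs h) by (apply Rabs_pos_lt; exact Hh0).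
    apply (Rmult_le_reg_l m); [exact Hm|]; rewrite Rinv_r by lra.
    apply (Rmult_le_reg_r (Rabs h)); [exact Hhp|].
    rewrite <- Rmult_assoc, Rmult_assoc, Rinv_l by lra; lra. }
  assert (A2 : Rabs (/ tau (ph t)) <= / m).
  { rewrite Rabs_pos_eq by (left; apply Rinv_0_lt_compat; lra); apply Rinv_le_contravar; lra. }
  apply Rle_lt_trans with (eps * m * m / 2 * (/ m * / m)).
  - apply Rmult_le_compat; try apply Rabs_pos; [|lra|].
    + apply Rmult_le_pos; apply Rabs_pos.
    + apply Rmult_le_compat; auto using Rabs_pos.
  - field_simplify; lra.
Qed.

(** [tau] is the derivative of time with respect to the angle, known to be positive only for angles
    in [[-L, L]]; [th] is time as a function of the angle and [ph] its inverse. *)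
Lemma time_change (tau : R -> R) L : 0 < L ->
  (forall s, Rabs s <= L -> continuous tau s /\ 0 < tau s) ->
  exists th ph : R -> R, th 0 = 0 /\ (forall a b, a < b -> th a < th b) /\
    (forall s, ph (th s) = s) /\ (forall t, th (ph t) = t) /\
    (forall t, Rabs (ph t) <= L -> is_derive ph t (/ tau (ph t))).
Proof.
  intros HL Ht.
  set (tc := fun s => tau (Rmax (- L) (Rmin s L))).
  assert (Hc : forall s, continuous tc s)
    by (apply continuous_clamp; [exact HL | intros s Hs; apply Ht, Hs]).
  destruct (continuity_ab_min tau (- L) L) as [sm [Hsm Hsm']]; [lra | |].
  { intros c Hc'; apply continuity_pt_filterlim, Ht, Rabs_le; lra. }
  assert (Hm : 0 < tau sm) by (apply Ht, Rabs_le; lra).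
  assert (Hid : forall s, Rabs s <= L -> tc s = tau s).
  { intros s Hs; apply Rabs_le_between in Hs; unfold tc.
    rewrite Rmin_left, Rmax_right by lra; reflexivity. }
  destruct (inverse_of_increasing (fun s => RInt tc 0 s) tc (tau sm) Hm) as [Hinc (ph & P1 & P2 & P3)].
  - apply (RInt_point (V := R_CompleteNormedModule)).
  - intros s; apply is_derive_RInt_0, Hc.
  - intros s; apply Hsm; unfold Rmax, Rmin; destruct (Rle_dec s L); destruct Rle_dec; lra.
  - exists (fun s => RInt tc 0 s), ph.
    split; [apply (RInt_point (V := R_CompleteNormedModule))|].
    split; [exact Hinc|]; split; [exact P1|]; split; [exact P2|].
    intros t Hp; rewrite <- Hid by exact Hp; apply P3.
Qed.

Lemma lip_bounded_continuous r f x : lip_bounded r f -> Rabs x < r -> continuous f x.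
Proof.
  intros (K & HK & _ & HL) Hx.
  apply continuity_pt_filterlim; intros eps Heps.
  exists (Rmin (r - Rabs x) (eps / (K + 1))); split.
  - apply Rmin_glb_lt; [lra | apply Rdiv_lt_0_compat; lra].
  - intros y [_ Hy]; simpl in *; unfold Rdist in *.
    assert (H1 := Rmin_l (r - Rabs x) (eps / (K + 1))).
    assert (H2 := Rmin_r (r - Rabs x) (eps / (K + 1))).
    assert (Hyr : Rabs y <= r).
    { replace y with ((y - x) + x) by ring; eapply Rle_trans; [apply Rabs_triang | lra]. }
    eapply Rle_lt_trans; [apply HL; lra|].
    assert (H3 : (K + 1) * Rabs (y - x) < eps).
    { apply Rlt_le_trans with ((K + 1) * (eps / (K + 1))); [|right; field; lra].
      apply Rmult_lt_compat_l; lra. }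
    assert (H4 := Rabs_pos (y - x)); lra.
Qed.

Lemma is_derive_Rmult (f g : R -> R) x df dg : is_derive f x df -> is_derive g x dg ->
  is_derive (fun t => f t * g t) x (df * g x + f x * dg).
Proof. intros Hf Hg; exact (is_derive_mult f g x df dg Hf Hg Rmult_comm). Qed.

Lemma is_derive_Rplus (f g : R -> R) x df dg : is_derive f x df -> is_derive g x dg ->
  is_derive (fun t => f t + g t) x (df + dg).
Proof. exact (is_derive_plus f g x df dg). Qed.

Lemma is_derive_Rcomp (f g : R -> R) x df dg : is_derive f (g x) df -> is_derive g x dg ->
  is_derive (fun t => f (g t)) x (dg * df).
Proof. exact (is_derive_comp f g x df dg). Qed.

(** * The orbit of one turn, back in the original time *)

Section Orbit.
Variables (k l p : nat) (f g : R -> R) (a : nat -> R) (RF MF : R).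
Hypothesis hk : (1 <= k)%nat.
Hypothesis hp : (1 <= p)%nat.
Hypothesis hl : (p + k = l + 1)%nat.
Hypothesis HRF : 0 < RF.
Hypothesis Ha : l1_le RF MF a.
Hypothesis Hrat : forall z, Rabs z < RF -> ratio f g z = PSeries a z.
Hypothesis Hfpos : forall z, Rabs z < RF -> 0 < f z.
Hypothesis Hfc : forall z, Rabs z < RF -> continuous f z.

Lemma polar_velocity (rho ph : R -> R) (t : R) :
  0 < rho (ph t) -> Rabs (rho (ph t) * gcos k (ph t)) < RF ->
  let s := ph t in
  let RR := radial_ratio k l p a s (rho s) in
  let z := fun t => rho (ph t) * gcos k (ph t) in
  let w := fun t => rho (ph t) ^ k * gsin k (ph t) + z t ^ (l + 1) * PSeries a (z t) in
  0 < 1 + gcos k s * RR ->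
  is_derive rho s (rho s * (gspeed k s * gsin k s * (RR / (1 + gcos k s * RR)))) ->
  is_derive ph t (/ (gspeed k s / (f (z t) * rho s ^ (k - 1) * (1 + gcos k s * RR)))) ->
  is_derive z t (- w t * f (z t) + z t ^ (l + 1) * g (z t)) /\
  is_derive w t (INR k * z t ^ (2 * k - 1) * f (z t) + INR k * w t * z t ^ l * g (z t)).
Proof.
  intros Hr0 Hz s RR z w HD Hrho Hph.
  assert (Hk := INR_k_pos k hk).
  assert (Hfz : 0 < f (z t)) by (apply Hfpos, Hz).
  assert (Hom := gspeed_pos k hk s).
  assert (HF : PSeries a (z t) = g (z t) / f (z t)) by (rewrite <- Hrat by exact Hz; reflexivity).
  assert (HdF := is_derive_PSeries a (z t) (l1_CV_radius RF MF a ltac:(lra) Ha (z t) Hz)).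
  assert (HQ := PSeries_affine_weight RF MF a (INR (k + l + 1)) (z t) Ha Hz).
  rewrite (is_derive_unique _ _ _ HdF) in HQ.
  set (F' := PSeries (PS_derive a) (z t)) in *.
  assert (ERR : RR = rho s ^ p * (gcos k s ^ (2 * l + 1) * (rho s ^ p * PSeries a (z t) ^ 2)
    + gsin k s * gcos k s ^ l / INR k *
      (INR (k + l + 1) * PSeries a (z t) + z t * F'))).
  { rewrite <- HQ; reflexivity. }
  assert (Hu : 0 < rho s ^ (k - 1)) by (apply pow_lt, Hr0).
  assert (ER := is_derive_Rcomp _ _ _ _ _ Hrho Hph).
  assert (EC := is_derive_Rcomp _ _ _ _ _ (is_derive_gcos k hk s) Hph).
  assert (ES := is_derive_Rcomp _ _ _ _ _ (is_derive_gsin k hk s) Hph).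
  set (u := rho s ^ (k - 1)) in *; set (D1 := 1 + gcos k s * RR) in *.
  assert (ER' : is_derive (fun t => rho (ph t)) t (f (z t) * u * rho s * gsin k s * RR)).
  { apply (is_derive_eq _ _ _ _ ER); field; repeat split; lra. }
  assert (EC' : is_derive (fun t => gcos k (ph t)) t (- (f (z t) * u * D1 * gsin k s))).
  { apply (is_derive_eq _ _ _ _ EC); field; repeat split; lra. }
  assert (ES' : is_derive (fun t => gsin k (ph t)) t
     (f (z t) * u * D1 * INR k * gcos k s ^ (2 * k - 1))).
  { apply (is_derive_eq _ _ _ _ ES); field; repeat split; lra. }
  (* The [RR] from [rho'] cancels the one in the angular speed: the factor [D1 = 1 + gcos RR] is
     exactly what makes [z' = - f h]. *)
  assert (Ez : is_derive z t (- (f (z t) * u * rho s * gsin k s))).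
  { apply (is_derive_eq _ _ _ _ (is_derive_Rmult _ _ _ _ _ ER' EC')).
    fold s; unfold D1; ring. }
  assert (Hrk : rho s ^ k = rho s * u)
    by (unfold u; replace k with (S (k - 1)) at 1 by lia; reflexivity).
  assert (Hsq := gcos_sq_pow k hk s).
  replace (2 * k)%nat with (S (2 * k - 1)) in Hsq by lia; rewrite <- tech_pow_Rmult in Hsq.
  assert (Ezl : z t ^ l = rho s ^ p * u * gcos k s ^ l).
  { unfold z; fold s; rewrite Rpow_mult_distr; unfold u; rewrite <- pow_add.
    do 2 f_equal; lia. }
  assert (Ezk : z t ^ (2 * k - 1) = rho s * u ^ 2 * gcos k s ^ (2 * k - 1)).
  { unfold z; fold s; rewrite Rpow_mult_distr; unfold u; rewrite <- pow_mult, tech_pow_Rmult.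
    do 2 f_equal; lia. }
  assert (Ec2l : gcos k s ^ (2 * l + 1) = gcos k s * (gcos k s ^ l) ^ 2).
  { rewrite pow_add, <- pow_mult, (Nat.mul_comm l 2); ring. }
  assert (Ew : w t = rho s * u * gsin k s + z t ^ (l + 1) * PSeries a (z t))
    by (unfold w; fold s; rewrite Hrk; reflexivity).
  assert (Eg : g (z t) = PSeries a (z t) * f (z t)) by (rewrite HF; field; lra).
  assert (Ezt : z t = rho s * gcos k s) by reflexivity.
  split.
  - apply (is_derive_eq _ _ _ _ Ez); rewrite Ew, Eg; ring.
  - assert (Eh : is_derive (fun t => rho (ph t) ^ k * gsin k (ph t)) t
       (INR k * f (z t) * u ^ 2 * rho s * (RR + gcos k s ^ (2 * k - 1)))).
    { apply (is_derive_eq _ _ _ _ (is_derive_Rmult _ _ _ _ _ (is_derive_pow _ k t _ ER') ES')).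
      fold s; replace (Nat.pred k) with (k - 1)%nat by lia; fold u; rewrite Hrk; unfold D1.
      set (c := gcos k s ^ (2 * k - 1)) in *.
      (* Here the equation of the curve enters: the two contributions of [RR] combine with weights
         [gsin^2] and [gcos^(2k)]. *)
      apply Rminus_diag_uniq.
      transitivity (INR k * f (z t) * u ^ 2 * rho s * RR * ((gcos k s * c + gsin k s ^ 2) - 1));
        [ring | rewrite Hsq; ring]. }
    assert (Ezf : is_derive (fun t => z t ^ (l + 1) * PSeries a (z t)) t
      ((INR (l + 1) * z t ^ l * PSeries a (z t) + z t * z t ^ l * F') *
       - (f (z t) * u * rho s * gsin k s))).
    { apply (is_derive_eq _ _ _ _ (is_derive_Rmult _ _ _ _ _
        (is_derive_pow _ (l + 1) t _ Ez) (is_derive_Rcomp _ _ _ _ _ HdF Ez))).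
      replace (Nat.pred (l + 1)) with l by lia; rewrite pow_add; fold F'; simpl; ring. }
    apply (is_derive_eq _ _ _ _ (is_derive_Rplus _ _ _ _ _ Eh Ezf)).
    rewrite Ew, Eg, ERR, Ezk, Ec2l, pow_add, Ezl, Ezt.
    replace (INR (k + l + 1)) with (INR k + INR (l + 1)) by (rewrite <- plus_INR; f_equal; lia).
    field; lra.
Qed.

Variables (v : nat -> R -> R) (r : R).
Hypothesis Hr : 0 < r.
Hypothesis HrRF : r <= RF / 4.
Hypothesis Hvl : forall t, Rabs t <= 3 * PI -> l1_le r 2 (fun n => v n t).
Hypothesis Hv0 : forall n, v n 0 = PS_one n.
Hypothesis Hv1 : forall t, v O t = 1.
Hypothesis Hflow : forall eps t, Rabs eps < r / 2 -> Rabs t < 3 * PI ->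
    let rho := fun t => eps * PSeries (fun n => v n t) eps in
    / 2 <= 1 + gcos k t * radial_ratio k l p a t (rho t) /\
    is_derive rho t (rho t * (gspeed k t * gsin k t *
      (radial_ratio k l p a t (rho t) / (1 + gcos k t * radial_ratio k l p a t (rho t))))).

(** The nonconstant part has norm at most 2 at radius [r], hence at most 1/2 at radius [r / 4]. This
    keeps [rho] positive and of the size of [eps]. *)
Lemma flow_near_1 eps t : Rabs eps <= r / 4 -> Rabs t <= 3 * PI ->
  / 2 <= PSeries (fun n => v n t) eps <= 3 / 2.
Proof.
  intros He Ht.
  set (w := fun n => match n with O => 0 | S _ => v n t end).
  assert (Hw : l1_le (/ 4 * r) (/ 4 * 2) w).
  { apply l1_le_shrink; [lra | lra | reflexivity|].
    apply l1_le_dom with (fun n => v n t); [lra | | apply Hvl, Ht].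
    intros [|n]; unfold w; [rewrite Rabs_R0; apply Rabs_pos | lra]. }
  assert (E : PSeries (fun n => v n t) eps = 1 + PSeries w eps).
  { rewrite <- (PSeries_one eps), <- PSeries_plus.
    - apply PSeries_ext; intros [|n]; unfold PS_plus, plus, w; simpl; [rewrite Hv1|]; ring.
    - eexists; apply (l1_ex_pseries r 1); [apply l1_one | lra].
    - eexists; apply (l1_ex_pseries (/ 4 * r) (/ 4 * 2)); [exact Hw | lra]. }
  assert (H := l1_PSeries_le _ _ w Hw eps ltac:(lra)); apply Rabs_le_between in H; lra.
Qed.

Lemma continuous_radial_ratio (rho : R -> R) s : continuous rho s ->
  Rabs (rho s * gcos k s) < RF / 2 ->
  continuous (fun s => radial_ratio k l p a s (rho s)) s.
Proof.
  intros Hc Hz.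
  assert (HC := fun n => continuous_pow (gcos k) n s (continuous_gcos k hk s)).
  assert (Hrp := continuous_pow rho p s Hc).
  assert (Hzc : continuous (fun s => rho s * gcos k s) s)
    by (apply (continuous_mult rho); [exact Hc | apply continuous_gcos, hk]).
  assert (HPS : forall r M b, 0 <= r -> l1_le r M b -> Rabs (rho s * gcos k s) < r ->
     continuous (fun s => PSeries b (rho s * gcos k s)) s).
  { intros r0 M b Hr0 Hb Hlt.
    apply (continuous_comp (fun s => rho s * gcos k s) (PSeries b)); [exact Hzc|].
    apply continuity_pt_filterlim, PSeries_continuity, (l1_CV_radius r0 M); assumption. }
  unfold radial_ratio.
  apply (continuous_mult (fun s => rho s ^ p)); [exact Hrp|].
  apply (continuous_plus (fun s => gcos k s ^ (2 * l + 1) * (rho s ^ p * PSeries a (rho s * gcos k s) ^ 2))).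
  - apply (continuous_mult (fun s => gcos k s ^ (2 * l + 1))); [apply HC|].
    apply (continuous_mult (fun s => rho s ^ p)); [exact Hrp|].
    apply (continuous_pow (fun s => PSeries a (rho s * gcos k s))).
    apply (HPS RF MF); [lra | exact Ha | lra].
  - apply (continuous_mult (fun s => gsin k s * gcos k s ^ l / INR k)).
    + unfold Rdiv; apply (continuous_mult (fun s => gsin k s * gcos k s ^ l)); [|apply continuous_const].
      apply (continuous_mult (gsin k)); [apply continuous_gsin, hk | apply HC].
    + apply (HPS (RF / 2) ((INR (k + l + 1) + 1) * MF)); [lra | | exact Hz].
      apply l1_le_affine_weight; [lra | apply pos_INR | exact Ha].
Qed.

Lemma orbit_exists eps : 0 < eps < r / 4 ->
  exists z w T, 0 < T /\ first_return k l f g eps z w T /\ counterclockwise l f g z w T /\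
    z T = eps * PSeries (fun n => v n (2 * PI)) eps /\
    (forall t, 0 <= t <= T -> Rabs (z t) <= 2 * eps).
Proof.
  intros He; assert (HPI := PI_RGT_0); assert (Hk := INR_k_pos k hk).
  assert (HeA : Rabs eps = eps) by (apply Rabs_pos_eq; lra).
  set (rho := fun t => eps * PSeries (fun n => v n t) eps).
  assert (Hrho : forall s, Rabs s <= 3 * PI -> 0 < rho s <= 2 * eps).
  { intros s Hs; assert (E := flow_near_1 eps s ltac:(lra) Hs); unfold rho; split.
    - apply Rmult_lt_0_compat; lra.
    - rewrite (Rmult_comm 2); apply Rmult_le_compat_l; lra. }
  assert (Hzb : forall s, Rabs s <= 3 * PI -> Rabs (rho s * gcos k s) <= 2 * eps).
  { intros s Hs; assert (E := Hrho s Hs); rewrite Rabs_mult, (Rabs_pos_eq (rho s)) by lra.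
    destruct (gcos_gsin_bounds k hk s) as [b _].
    rewrite <- (Rmult_1_r (2 * eps)); apply Rmult_le_compat; auto using Rabs_pos; lra. }
  set (RR := fun s => radial_ratio k l p a s (rho s)).
  assert (Hfl : forall s, Rabs s < 3 * PI -> / 2 <= 1 + gcos k s * RR s /\
     is_derive rho s (rho s * (gspeed k s * gsin k s * (RR s / (1 + gcos k s * RR s)))))
    by (intros s Hs; apply (Hflow eps s); [lra | exact Hs]).
  set (tau := fun s => gspeed k s / (f (rho s * gcos k s) * rho s ^ (k - 1) * (1 + gcos k s * RR s))).
  (* [time_change] wants a closed range of angles; [5/2 PI] lies beyond the end [2 PI] of the turn
     and inside the open range [3 PI] of the flow equation. *)
  assert (Htau : forall s, Rabs s <= 5 / 2 * PI -> continuous tau s /\ 0 < tau s).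
  { intros s Hs.
    assert (E := Hrho s ltac:(lra)); assert (Ez := Hzb s ltac:(lra)).
    destruct (Hfl s ltac:(lra)) as [E1 E2].
    assert (Hf := Hfpos (rho s * gcos k s) ltac:(lra)).
    assert (Hu : 0 < rho s ^ (k - 1)) by (apply pow_lt; lra).
    assert (Hc : continuous rho s)
      by (apply (ex_derive_continuous (V := R_NormedModule)); eexists; exact E2).
    assert (Hden : 0 < f (rho s * gcos k s) * rho s ^ (k - 1) * (1 + gcos k s * RR s)).
    { apply Rmult_lt_0_compat; [apply Rmult_lt_0_compat; assumption | lra]. }
    split; [|apply Rdiv_lt_0_compat; [apply gspeed_pos, hk | exact Hden]].
    unfold tau, Rdiv.
    apply (continuous_mult (gspeed k)); [apply continuous_gspeed, hk|].
    apply continuous_Rinv_comp; [|lra].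
    apply (continuous_mult (fun s => f (rho s * gcos k s) * rho s ^ (k - 1))).
    - apply (continuous_mult (fun s => f (rho s * gcos k s))); [|apply continuous_pow, Hc].
      apply (continuous_comp (fun s => rho s * gcos k s) f); [|apply Hfc; lra].
      apply (continuous_mult rho); [exact Hc | apply continuous_gcos, hk].
    - apply (continuous_plus (fun _ => 1)); [apply continuous_const|].
      apply (continuous_mult (gcos k)); [apply continuous_gcos, hk|].
      apply continuous_radial_ratio; [exact Hc | lra]. }
  destruct (time_change tau (5 / 2 * PI) ltac:(lra) Htau) as (th & ph & T0 & Tinc & T1 & T2 & T3).
  assert (Hgt : forall t b, th b < t -> b < ph t).
  { intros t b H; destruct (Rtotal_order b (ph t)) as [H'|[H'|H']]; [exact H'| |];
      [subst b; rewrite T2 in H | apply Tinc in H'; rewrite T2 in H']; lra. }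
  assert (Hlt : forall t b, t < th b -> ph t < b).
  { intros t b H; destruct (Rtotal_order b (ph t)) as [H'|[H'|H']]; [ | |exact H'];
      [apply Tinc in H'; rewrite T2 in H' | subst b; rewrite T2 in H]; lra. }
  set (T := th (2 * PI)).
  assert (HT : 0 < T) by (rewrite <- T0; apply Tinc; lra).
  assert (Hph : forall t, 0 <= t <= T -> 0 <= ph t <= 2 * PI).
  { intros t Ht; split; apply Rnot_lt_le; intros H.
    - apply Tinc in H; rewrite T2, T0 in H; lra.
    - apply Tinc in H; rewrite T2 in H; unfold T in Ht; lra. }
  assert (Hph0 := T1 0); rewrite T0 in Hph0.
  assert (HphT : ph T = 2 * PI) by apply T1.
  destruct (gcos_at k 0 1 cos_0 sin_0 ltac:(ring)) as [C0 S0].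
  destruct (gcos_at k PI (-1) cos_PI sin_PI ltac:(ring)) as [C1 _].
  destruct (gcos_at k (2 * PI) 1 cos_2PI sin_2PI ltac:(ring)) as [C2 S2].
  assert (Hrho0 : rho 0 = eps).
  { unfold rho; rewrite <- (Rmult_1_r eps) at 3; f_equal.
    rewrite <- (PSeries_one eps); apply PSeries_ext; intros n; apply Hv0. }
  set (z := fun t => rho (ph t) * gcos k (ph t)).
  set (w := fun t => rho (ph t) ^ k * gsin k (ph t) + z t ^ (l + 1) * PSeries a (z t)).
  assert (Hzt : forall t, 0 <= t <= T -> Rabs (z t) <= 2 * eps).
  { intros t Ht; apply Hzb; specialize (Hph t Ht); apply Rabs_le; lra. }
  assert (Hrt : forall t, 0 <= t <= T -> 0 < rho (ph t)).
  { intros t Ht; apply Hrho; specialize (Hph t Ht); apply Rabs_le; lra. }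
  assert (Hh : forall t, 0 <= t <= T -> height l f g (z t) (w t) = rho (ph t) ^ k * gsin k (ph t)).
  { intros t Ht; assert (E := Hzt t Ht); unfold height; rewrite Hrat by lra; unfold w; ring. }
  assert (Hsin_zero : forall t, 0 <= t <= T -> w t = z t ^ (l + 1) * ratio f g (z t) ->
     gsin k (ph t) = 0).
  { intros t Ht E; assert (E1 := Hh t Ht); unfold height in E1; rewrite E, Rminus_diag in E1.
    symmetry in E1; apply Rmult_integral in E1; destruct E1 as [E1|E1]; [|exact E1].
    assert (0 < rho (ph t) ^ k) by (apply pow_lt, Hrt, Ht); lra. }
  assert (HsT : forall s, 0 < s < 1 -> 0 <= s * T <= T).
  { intros s Hs; split; [apply Rmult_le_pos; lra|].
    rewrite <- (Rmult_1_l T) at 2; apply Rmult_le_compat_r; lra. }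
  assert (HzT : z T = eps * PSeries (fun n => v n (2 * PI)) eps).
  { unfold z; rewrite HphT, C2; unfold rho; ring. }
  exists z, w, T.
  split; [exact HT|]; split; [|split; [|split; [exact HzT | exact Hzt]]].
  - split; [lra|]; split; [|split; [|split; [|split]]].
    + intros t Ht; rewrite Rmin_left, Rmax_right in Ht by lra.
      assert (Hpt := Hph t Ht).
      assert (Hp3 : Rabs (ph t) < 3 * PI) by (apply Rabs_def1; lra).
      destruct (Hfl (ph t) Hp3) as [E1 E2].
      apply (polar_velocity rho ph t (Hrt t Ht)).
      * assert (E := Hzt t Ht); unfold z in E; lra.
      * fold (RR (ph t)); lra.
      * exact E2.
      * apply T3, Rabs_le; lra.
    + unfold z; rewrite Hph0, C0, Hrho0; ring.
    + assert (Ez0 : z 0 = eps) by (unfold z; rewrite Hph0, C0, Hrho0; ring).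
      unfold w; rewrite Ez0, Hph0, S0, Hrat by (rewrite HeA; lra); ring.
    + split.
      * unfold z; rewrite HphT, C2, Rmult_1_r, <- HphT; apply Hrt; lra.
      * unfold w; rewrite HphT, S2, Hrat by (assert (E := Hzt T ltac:(lra)); lra); ring.
    + intros s Hs [Hz0 Hw0].
      assert (Hs' := HsT s Hs).
      assert (E := Hsin_zero (s * T) Hs' Hw0).
      assert (H1 : 0 < ph (s * T)).
      { apply Hgt; rewrite T0; apply Rmult_lt_0_compat; lra. }
      assert (H2 : ph (s * T) < 2 * PI).
      { apply Hlt; fold T; rewrite <- (Rmult_1_l T) at 2; apply Rmult_lt_compat_r; lra. }
      (* Strictly inside the turn [gsin] vanishes only at the angle [PI], where [gcos = -1] puts [z]
         on the negative side. *)
      destruct (Rtotal_order (ph (s * T)) PI) as [H|[H|H]].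
      * assert (Hg := gsin_pos k (ph (s * T)) (sin_gt_0 _ H1 H)); lra.
      * assert (Hr' := Hrt (s * T) Hs'); unfold z in Hz0; rewrite H, C1 in *; lra.
      * assert (Hg := gsin_neg k (ph (s * T)) (sin_lt_0 _ H H2)); lra.
  - assert (Hsl : forall b s, th b / T < s -> b < ph (s * T)).
    { intros b s H; apply Hgt; apply (Rmult_lt_reg_r (/ T)); [apply Rinv_0_lt_compat, HT|].
      rewrite Rmult_assoc, Rinv_r by lra; unfold Rdiv in H; lra. }
    assert (Hsu : forall b s, s < th b / T -> ph (s * T) < b).
    { intros b s H; apply Hlt; apply (Rmult_lt_reg_r (/ T)); [apply Rinv_0_lt_compat, HT|].
      rewrite Rmult_assoc, Rinv_r by lra; unfold Rdiv in H; lra. }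
    assert (Hord : forall b c, b < c -> th b / T < th c / T).
    { intros b c H; apply Rmult_lt_compat_r; [apply Rinv_0_lt_compat, HT | apply Tinc, H]. }
    assert (HTT : th (2 * PI) / T = 1) by (unfold T; field; unfold T in HT; lra).
    assert (H00 : th 0 / T = 0) by (rewrite T0; field; lra).
    assert (Hsign : forall s, 0 < s < 1 -> 0 < rho (ph (s * T)) /\ 0 < rho (ph (s * T)) ^ k /\
       height l f g (z (s * T)) (w (s * T)) = rho (ph (s * T)) ^ k * gsin k (ph (s * T))).
    { intros s Hs; assert (E := Hrt _ (HsT s Hs)); split; [exact E|]; split;
        [apply pow_lt, E | apply Hh, HsT, Hs]. }
    assert (O1 := Hord 0 (PI / 2) ltac:(lra)); assert (O2 := Hord (PI / 2) PI ltac:(lra)).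
    assert (O3 := Hord PI (3 * (PI / 2)) ltac:(lra)).
    assert (O4 := Hord (3 * (PI / 2)) (2 * PI) ltac:(lra)).
    rewrite H00 in O1; rewrite HTT in O4.
    assert (Hneg : forall x y, 0 < x -> y < 0 -> x * y < 0).
    { intros x y Hx Hy; rewrite <- (Rmult_0_r x); apply Rmult_lt_compat_l; assumption. }
    (* The axes are crossed at the multiples of [PI / 2], here converted to fractions of the return
       time. *)
    exists (th (PI / 2) / T), (th PI / T), (th (3 * (PI / 2)) / T).
    do 4 (split; [assumption|]).
    split; [|split; [|split]]; intros s Hs; destruct (Hsign s ltac:(lra)) as (P1 & P2 & ->);
      unfold z.
    + assert (L1 := Hsl 0 s ltac:(rewrite H00; lra)); assert (L2 := Hsu _ s (proj2 Hs)).
      split; apply Rmult_lt_0_compat; try assumption.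
      * apply gcos_pos, cos_gt_0; lra.
      * apply gsin_pos, sin_gt_0; lra.
    + assert (L1 := Hsl _ s (proj1 Hs)); assert (L2 := Hsu _ s (proj2 Hs)).
      split; [apply Hneg | apply Rmult_lt_0_compat]; try assumption.
      * apply gcos_neg, cos_lt_0; lra.
      * apply gsin_pos, sin_gt_0; lra.
    + assert (L1 := Hsl _ s (proj1 Hs)); assert (L2 := Hsu _ s (proj2 Hs)).
      split; apply Hneg; try assumption.
      * apply gcos_neg, cos_lt_0; lra.
      * apply gsin_neg, sin_lt_0; lra.
    + assert (L1 := Hsl _ s (proj1 Hs)); assert (L2 := Hsu (2 * PI) s ltac:(rewrite HTT; lra)).
      split; [apply Rmult_lt_0_compat | apply Hneg]; try assumption.
      * apply gcos_pos.
        replace (cos (ph (s * T))) with (cos (ph (s * T) - 2 * PI))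
          by (rewrite cos_minus, cos_2PI, sin_2PI; ring).
        apply cos_gt_0; lra.
      * apply gsin_neg, sin_lt_0; lra.
Qed.

End Orbit.

(** * The return map *)

Lemma is_solution_restrict k l f g z w T T' : 0 <= T' <= T ->
  is_solution k l f g z w T -> is_solution k l f g z w T'.
Proof.
  intros H Hs t Ht; apply Hs.
  rewrite Rmin_left, Rmax_right in * by lra; lra.
Qed.

(** The height over the transversal vanishes at time [0] with positive derivative, so it is
    negative just before: only forward time enters the quadrant [x > 0, y > 0] first. *)
Lemma return_time_pos k l f g a RF MF eps z w T :
  (1 <= k)%nat -> l1_le RF MF a ->
  (forall z, Rabs z < RF -> ratio f g z = PSeries a z) -> 0 < f eps -> 0 < eps < RF ->
  first_return k l f g eps z w T -> counterclockwise l f g z w T -> 0 < T.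
Proof.
  intros hk Ha Hrat Hf He (HT & Hs & Hz0 & Hw0 & _ & _) (s1 & s2 & s3 & Hs1 & Hs2 & Hs3 & Hs4 & Hq & _).
  destruct (Rtotal_order T 0) as [Hneg|[H|H]]; [exfalso | lra | exact H].
  assert (Hk := INR_k_pos k hk).
  assert (H0 : Rmin 0 T <= 0 <= Rmax 0 T) by (split; [apply Rmin_l | apply Rmax_l]).
  destruct (Hs 0 H0) as [Dz Dw].
  assert (HeA : Rabs eps < RF) by (rewrite Rabs_pos_eq; lra).
  assert (HF : PSeries a eps = g eps / f eps) by (rewrite <- Hrat by exact HeA; reflexivity).
  assert (HdF := is_derive_PSeries a eps (l1_CV_radius RF MF a ltac:(lra) Ha eps HeA)).
  rewrite Hz0, Hw0, Hrat in Dz, Dw by exact HeA.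
  (* On the transversal [w f = z^(l+1) g], so [z' = 0] and the derivative of the height reduces to
     that of [w], a positive multiple of [f eps]. *)
  assert (Dz' : is_derive z 0 0).
  { apply (is_derive_eq _ _ _ _ Dz); rewrite HF; field; lra. }
  set (d := INR k * f eps * (eps ^ (2 * k - 1) + eps ^ (l + 1) * eps ^ l * PSeries a eps ^ 2)).
  assert (Hd : 0 < d).
  { apply Rmult_lt_0_compat; [apply Rmult_lt_0_compat; lra|].
    assert (0 < eps ^ (2 * k - 1)) by (apply pow_lt; lra).
    assert (0 <= eps ^ (l + 1) * eps ^ l * PSeries a eps ^ 2).
    { apply Rmult_le_pos; [|apply pow2_ge_0].
      apply Rmult_le_pos; apply pow_le; lra. }
    lra. }
  assert (Dh : is_derive (fun t => w t - z t ^ (l + 1) * PSeries a (z t)) 0 d).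
  { rewrite <- Hz0 in HdF.
    apply (is_derive_eq _ _ _ _ (is_derive_minus _ _ _ _ _ Dw
      (is_derive_Rmult _ _ _ _ _ (is_derive_pow _ (l + 1) 0 _ Dz') (is_derive_Rcomp _ _ _ _ _ HdF Dz')))).
    unfold minus, plus, opp; cbn [AbelianGroup.opp]; unfold d.
    replace (g eps) with (PSeries a eps * f eps) by (rewrite HF; field; lra).
    simpl; ring. }
  apply is_derive_Reals in Dh; destruct (Dh d Hd) as [del Hdel].
  assert (Hdp := cond_pos del).
  destruct (is_derive_locally_lt z 0 _ RF Dz') as (eta & Heta1 & Heta2); [rewrite Hz0; lra|].
  set (mm := Rmin del eta).
  assert (Hmm : 0 < mm /\ mm <= del /\ mm <= eta).
  { unfold mm; split; [apply Rmin_glb_lt; lra | split; [apply Rmin_l | apply Rmin_r]]. }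
  (* Small enough to lie in the first quadrant phase and to keep [s T] in the range where the
     difference quotient of the height is positive. *)
  set (s := Rmin s1 (mm / - T) / 2).
  assert (Hms : 0 < mm / - T) by (apply Rdiv_lt_0_compat; lra).
  assert (Hs0 : 0 < s /\ s < s1 /\ s < mm / - T).
  { unfold s; assert (E1 := Rmin_l s1 (mm / - T)); assert (E2 := Rmin_r s1 (mm / - T)).
    assert (E3 : 0 < Rmin s1 (mm / - T)) by (apply Rmin_glb_lt; lra); lra. }
  assert (HsT : - mm < s * T < 0).
  { assert (E : s * - T < mm).
    { apply Rlt_le_trans with (mm / - T * - T); [apply Rmult_lt_compat_r; lra|].
      right; field; lra. }
    assert (E2 : 0 < s * - T) by (apply Rmult_lt_0_compat; lra); lra. }
  destruct (Hq s ltac:(lra)) as [Q1 Q2].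
  assert (Hzs : z (s * T) < RF).
  { apply Heta2; rewrite Rminus_0_r; apply Rabs_def1; lra. }
  unfold height in Q2; rewrite Hrat in Q2 by (rewrite Rabs_pos_eq; lra).
  assert (Hst0 : s * T <> 0) by lra.
  assert (E := Hdel (s * T) Hst0 ltac:(apply Rabs_def1; lra)).
  rewrite Rplus_0_l, Hz0, Hw0, Hrat, Rminus_diag, Rminus_0_r in E by exact HeA.
  apply Rabs_def2 in E.
  assert (E3 : 0 < (w (s * T) - z (s * T) ^ (l + 1) * PSeries a (z (s * T))) / (s * T)) by lra.
  assert (E4 : (w (s * T) - z (s * T) ^ (l + 1) * PSeries a (z (s * T))) / (s * T) * - (s * T) =
    - (w (s * T) - z (s * T) ^ (l + 1) * PSeries a (z (s * T)))) by (field; split; lra).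
  assert (E5 := Rmult_lt_0_compat _ (- (s * T)) E3 ltac:(lra)); lra.
Qed.

(** On the common time interval the solutions coincide, so the earlier return would be an interior
    return of the other one unless the times agree. Only the reference solution has to be known
    small. *)
Lemma first_return_unique k l f g eps r z w T z' w' T' :
  0 < r -> lip_bounded r f -> lip_bounded r g -> 0 < T -> 0 < T' ->
  (forall t, 0 <= t <= T -> Rabs (z t) <= r / 2) ->
  first_return k l f g eps z w T -> first_return k l f g eps z' w' T' -> z' T' = z T.
Proof.
  intros Hr Hf Hg HT HT' Hz (_ & Hs & Hz0 & Hw0 & Ht & Hn) (_ & Hs' & Hz0' & Hw0' & Ht' & Hn').
  set (T1 := Rmin T T').
  assert (HT1 : 0 < T1 /\ T1 <= T /\ T1 <= T').
  { unfold T1; split; [apply Rmin_glb_lt; lra | split; [apply Rmin_l | apply Rmin_r]]. }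
  assert (Hu := solution_unique k l f g r T1 z w z' w' Hr ltac:(lra) Hf Hg
    (is_solution_restrict _ _ _ _ _ _ T T1 ltac:(lra) Hs)
    (is_solution_restrict _ _ _ _ _ _ T' T1 ltac:(lra) Hs')
    ltac:(lra) ltac:(lra) ltac:(intros t Hb; apply Hz; lra)).
  destruct (Rtotal_order T T') as [H|[H|H]].
  - exfalso; assert (ET1 : T1 = T) by (apply Rmin_left; lra); rewrite ET1 in Hu.
    apply (Hn' (T / T')).
    + split; [apply Rdiv_lt_0_compat; lra|].
      apply (Rmult_lt_reg_r T'); [lra|]; field_simplify; lra.
    + replace (T / T' * T') with T by (field; lra).
      destruct (Hu T ltac:(lra)) as [-> ->]; exact Ht.
  - rewrite <- H; apply Hu; split; [lra|]; apply Rmin_glb; lra.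
  - exfalso; assert (ET1 : T1 = T') by (apply Rmin_right; lra); rewrite ET1 in Hu.
    apply (Hn (T' / T)).
    + split; [apply Rdiv_lt_0_compat; lra|].
      apply (Rmult_lt_reg_r T); [lra|]; field_simplify; lra.
    + replace (T' / T * T) with T' by (field; lra).
      destruct (Hu T' ltac:(lra)) as [<- <-]; exact Ht'.
Qed.

Lemma ratio_opp f g : ratio (fun x => - f x) (fun x => - g x) = ratio f g.
Proof.
  apply functional_extensionality; intros x; unfold ratio, Rdiv; rewrite Rinv_opp; ring.
Qed.

Lemma analytic_opp f : analytic_at_0 f -> analytic_at_0 (fun x => - f x).
Proof.
  intros [a [d Hd]]; exists (PS_opp a), d; intros y Hy.
  apply (is_pseries_opp a y (f y)), Hd, Hy.
Qed.

Lemma opp_opp_fun (f : R -> R) : (fun x => - - f x) = f.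
Proof. apply functional_extensionality; intros x; apply Ropp_involutive. Qed.

Lemma first_return_reverse k l f g eps z w T : first_return k l f g eps z w T ->
  first_return k l (fun x => - f x) (fun x => - g x) eps (fun t => z (- t)) (fun t => w (- t)) (- T).
Proof.
  intros (HT & Hs & Hz0 & Hw0 & Ht & Hn).
  unfold first_return, on_transversal; rewrite ratio_opp, Ropp_involutive, Ropp_0.
  repeat (split; [solve [lra | assumption | apply Ht]|]).
  split; [|split; [exact Hz0|split; [exact Hw0|split; [exact Ht|]]]].
  - intros t Hb.
    assert (Hb' : Rmin 0 T <= - t <= Rmax 0 T).
    { unfold Rmin, Rmax in *; destruct (Rle_dec 0 T); destruct (Rle_dec 0 (- T)); lra. }
    destruct (Hs (- t) Hb') as [Dz Dw].
    assert (Do : is_derive (fun t : R => - t) t (-1))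
      by (apply (is_derive_eq _ _ _ _ (is_derive_opp _ _ _ (is_derive_id t))); reflexivity).
    split.
    + apply (is_derive_eq _ _ _ _ (is_derive_Rcomp _ _ _ _ _ Dz Do)); ring.
    + apply (is_derive_eq _ _ _ _ (is_derive_Rcomp _ _ _ _ _ Dw Do)); ring.
  - intros s Hb; replace (- (s * - T)) with (s * T) by ring; apply Hn, Hb.
Qed.

Lemma counterclockwise_reverse l f g z w T : counterclockwise l f g z w T ->
  counterclockwise l (fun x => - f x) (fun x => - g x) (fun t => z (- t)) (fun t => w (- t)) (- T).
Proof.
  unfold counterclockwise, height; rewrite ratio_opp.
  intros (s1 & s2 & s3 & H); exists s1, s2, s3.
  assert (E : forall s, - (s * - T) = s * T) by (intros; ring).
  repeat (split; [apply H|]).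
  split; [|split; [|split]]; intros s Hs; rewrite E; apply H, Hs.
Qed.

Section Main.
Variables (k l p : nat).
Hypothesis hk : (1 <= k)%nat.
Hypothesis hp : (1 <= p)%nat.
Hypothesis hl : (p + k = l + 1)%nat.

(** Stated as a property of the pair so that it can be transported along the change of sign of [f]
    and [g]. *)
Definition return_expansion (f g : R -> R) : Prop :=
  let F := ratio f g in
  let K := INR k in
  let B0 := 2 * INR (p + 2 * k) * F 0 in
  let B1 := 2 * INR (p + 2 * k + 1) * Derive F 0 in
  let theta := (-1) ^ (p + k - 1) in
  exists (c : nat -> R) (eps0 C : R),
    0 < eps0 /\
    forall eps : R, 0 < eps < eps0 ->
      (exists (z w : R -> R) (T : R),
         first_return k l f g eps z w T /\ counterclockwise l f g z w T) /\
      (forall (z w : R -> R) (T : R),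
         first_return k l f g eps z w T -> counterclockwise l f g z w T ->
         is_pseries c eps (z T) /\
         ((2 <= p)%nat ->
            Rabs (z T -
              (eps
               + 2 * eps ^ (p + 1) * (B0 * Phi1 p k / (2 * K)) * (1 + theta)
               + 2 * eps ^ (p + 2) * (B1 * Phi1 (p + 1) k / (2 * K))
                   * (1 - theta)))
            <= C * eps ^ (p + 3)) /\
         (p = 1%nat ->
            Rabs (z T -
              (eps
               + 2 * eps ^ 2 * (B0 * Phi1 1 k / (2 * K)) * (1 + theta)
               + 2 * eps ^ 3 *
                   (((1 - theta) * B1 * Phi1 2 k
                     + (1 + theta) / K * B0 ^ 2 * Phi1 1 k ^ 2) / (2 * K)
                    + (B0 * Phi1 1 k / (2 * K) * (1 + theta)) ^ 2)))
            <= C * eps ^ 4)).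

(** Time reversal exchanges [(f, g)] and [(-f, -g)], which have the same ratio. *)
Lemma return_expansion_reverse f g :
  return_expansion (fun x => - f x) (fun x => - g x) -> return_expansion f g.
Proof.
  unfold return_expansion; rewrite ratio_opp; intros (c & eps0 & C & He0 & H).
  exists c, eps0, C; split; [exact He0|]; intros eps He.
  destruct (H eps He) as [(z & w & T & H1 & H2) H3]; split.
  - apply first_return_reverse in H1; apply counterclockwise_reverse in H2.
    rewrite !opp_opp_fun in H1, H2; eauto.
  - intros z' w' T' H4 H5.
    specialize (H3 _ _ _ (first_return_reverse _ _ _ _ _ _ _ _ H4)
      (counterclockwise_reverse _ _ _ _ _ _ H5)).
    cbv beta in H3; rewrite Ropp_involutive in H3; exact H3.
Qed.

Lemma return_expansion_pos f g :
  analytic_at_0 f -> analytic_at_0 g -> 0 < f 0 -> return_expansion f g.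
Proof.
  intros Hf Hg Hf0.
  destruct (analytic_ratio f g Hf Hg ltac:(lra)) as (a & r1 & MF & Hr1 & Ha1 & Hrat1).
  destruct (lip_bounded_analytic f Hf) as (rf & Hrf & Lf).
  destruct (lip_bounded_analytic g Hg) as (rg & Hrg & Lg).
  set (RF := Rmin r1 (Rmin rf rg)).
  assert (HRF : 0 < RF /\ RF <= r1 /\ RF <= rf /\ RF <= rg).
  { assert (E1 := Rmin_l r1 (Rmin rf rg)); assert (E2 := Rmin_r r1 (Rmin rf rg)).
    assert (E3 := Rmin_l rf rg); assert (E4 := Rmin_r rf rg); fold RF in E1, E2.
    split; [unfold RF; repeat apply Rmin_glb_lt; lra | lra]. }
  assert (Ha : l1_le RF MF a) by (apply l1_le_smaller with r1; [lra | exact Ha1]).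
  assert (Hrat : forall z, Rabs z < RF -> ratio f g z = PSeries a z)
    by (intros z Hz; apply Hrat1; lra).
  assert (Hfpos : forall z, Rabs z < RF -> 0 < f z).
  { intros z Hz; destruct (Hrat1 z ltac:(lra)) as [_ E].
    replace (f z) with (f z / f 0 * f 0) by (field; lra).
    apply Rmult_lt_0_compat; lra. }
  apply (lip_bounded_smaller _ RF) in Lf, Lg; try lra.
  assert (Hfc : forall z, Rabs z < RF -> continuous f z)
    by (intros z Hz; apply lip_bounded_continuous with RF; assumption).
  destruct (polar_flow_exists k l p a RF MF hk hp hl ltac:(lra) Ha)
    as (v & r & Hr & HrRF & Hvl & Hv0 & Hv1 & Hflow & Hvn & Evp & Ev2 & Ev1).
  assert (HPI := PI_RGT_0).
  assert (H2PI : Rabs (2 * PI) <= 3 * PI) by (rewrite Rabs_pos_eq; lra).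
  assert (Hz0 : Rabs 0 < RF) by (rewrite Rabs_R0; lra).
  assert (EF0 : ratio f g 0 = a O) by (rewrite Hrat by exact Hz0; apply PSeries_0).
  assert (EF1 : Derive (ratio f g) 0 = a 1%nat).
  { rewrite (Derive_ext_loc _ (PSeries a)).
    - rewrite Derive_PSeries, PSeries_0 by (apply (l1_CV_radius RF MF); [lra | exact Ha | exact Hz0]).
      unfold PS_derive; simpl; ring.
    - exists (mkposreal RF (proj1 HRF)); intros y Hy; apply Hrat.
      unfold ball in Hy; simpl in Hy; unfold AbsRing_ball, minus, plus, opp, abs in Hy; simpl in Hy.
      rewrite Ropp_0, Rplus_0_r in Hy; exact Hy. }
  unfold return_expansion; rewrite EF0, EF1.
  (* The shift of coefficients is the factor [eps] of the ansatz, [r / 4] is the range of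
     [orbit_exists], and the constant is the one of [l1_remainder] for the norm bound 2 at order
     [p + 1]. *)
  exists (PS_incr_1 (fun n => v n (2 * PI))), (r / 4), (2 * 2 / r ^ S (S p)).
  split; [lra|]; intros eps He.
  assert (HeA : Rabs eps = eps) by (apply Rabs_pos_eq; lra).
  destruct (orbit_exists k l p f g a RF MF hk hp hl ltac:(lra) Ha Hrat Hfpos Hfc v r Hr HrRF
    Hvl Hv0 Hv1 Hflow eps He) as (z & w & T & HT & Hfr & Hcc & HzT & Hzb).
  split; [exists z, w, T; split; assumption|].
  intros z' w' T' Hfr' Hcc'.
  assert (HT' : 0 < T').
  { apply (return_time_pos k l f g a RF MF eps z' w' T'); try assumption; [|lra].
    apply Hfpos; lra. }
  assert (EzT : z' T' = z T).
  { apply (first_return_unique k l f g eps RF z w T z' w' T'); try assumption.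
    - lra.
    - intros t Ht; specialize (Hzb t Ht); lra. }
  rewrite EzT.
  assert (Hl1 := Hvl (2 * PI) H2PI).
  assert (Hrem := l1_remainder r 2 _ (S p) eps Hr Hl1 ltac:(lra)).
  assert (Esum : sum_f_R0 (fun n => v n (2 * PI) * eps ^ n) (S p) =
    1 + v p (2 * PI) * eps ^ p + v (S p) (2 * PI) * eps ^ S p).
  { destruct p as [|p']; [lia|].
    rewrite !tech5; do 2 f_equal.
    clear - Hv1 Hvn; induction p' as [|p' IH]; [simpl; rewrite Hv1; ring|].
    rewrite tech5, IH by (intros; apply Hvn; lia); rewrite Hvn by lia; ring. }
  cbv beta in Hrem; rewrite Esum, HeA in Hrem.
  assert (Hexp : Rabs (z T - (eps + v p (2 * PI) * eps ^ S p + v (S p) (2 * PI) * eps ^ S (S p)))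
    <= 2 * 2 / r ^ S (S p) * eps ^ S (S (S p))).
  { rewrite HzT.
    replace (_ - _) with (eps * (PSeries (fun n => v n (2 * PI)) eps -
      (1 + v p (2 * PI) * eps ^ p + v (S p) (2 * PI) * eps ^ S p))) by (simpl; ring).
    rewrite Rabs_mult, HeA.
    replace (2 * 2 / r ^ S (S p) * eps ^ S (S (S p))) with
      (eps * (2 * 2 / r ^ S (S p) * eps ^ S (S p))) by (rewrite <- (tech_pow_Rmult _ (S (S p))); ring).
    apply Rmult_le_compat_l; [lra | exact Hrem]. }
  split; [|split].
  - rewrite HzT; apply (is_pseries_incr_1 (fun n => v n (2 * PI)) eps).
    apply (l1_ex_pseries r 2); [exact Hl1 | lra].
  - intros H2; rewrite Evp, (Ev2 H2) in Hexp.
    replace (p + 1)%nat with (S p) in * by lia; replace (p + 2)%nat with (S (S p)) by lia.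
    replace (p + 3)%nat with (S (S (S p))) by lia.
    match goal with |- Rabs (_ - ?X) <= _ => match type of Hexp with Rabs (_ - ?Y) <= _ =>
      replace X with Y by ring end end.
    exact Hexp.
  - intros H1; rewrite H1 in Hexp, Evp; rewrite Evp, (Ev1 H1) in Hexp.
    rewrite H1.
    match goal with |- Rabs (_ - ?X) <= _ => match type of Hexp with Rabs (_ - ?Y) <= _ =>
      replace X with Y by (rewrite H1; ring) end end.
    exact Hexp.
Qed.

End Main.

Theorem mainTheorem2 (k l p : nat) (f g : R -> R)
  (hk1 : (1 <= k)%nat) (hkl : (k <= l + 1)%nat) (hkne : k <> (l + 1)%nat)
  (hp : p = (l - k + 1)%nat)
  (hf : analytic_at_0 f) (hg : analytic_at_0 g) (hf0 : f 0 <> 0) :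
  let F := ratio f g in
  let K := INR k in
  let B0 := 2 * INR (p + 2 * k) * F 0 in
  let B1 := 2 * INR (p + 2 * k + 1) * Derive F 0 in
  let theta := (-1) ^ (p + k - 1) in
  exists (c : nat -> R) (eps0 C : R),
    0 < eps0 /\
    forall eps : R, 0 < eps < eps0 ->
      (exists (z w : R -> R) (T : R),
         first_return k l f g eps z w T /\ counterclockwise l f g z w T) /\
      (forall (z w : R -> R) (T : R),
         first_return k l f g eps z w T -> counterclockwise l f g z w T ->
         is_pseries c eps (z T) /\
         ((2 <= p)%nat ->
            Rabs (z T -
              (eps
               + 2 * eps ^ (p + 1) * (B0 * Phi1 p k / (2 * K)) * (1 + theta)
               + 2 * eps ^ (p + 2) * (B1 * Phi1 (p + 1) k / (2 * K))
                   * (1 - theta)))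
            <= C * eps ^ (p + 3)) /\
         (p = 1%nat ->
            Rabs (z T -
              (eps
               + 2 * eps ^ 2 * (B0 * Phi1 1 k / (2 * K)) * (1 + theta)
               + 2 * eps ^ 3 *
                   (((1 - theta) * B1 * Phi1 2 k
                     + (1 + theta) / K * B0 ^ 2 * Phi1 1 k ^ 2) / (2 * K)
                    + (B0 * Phi1 1 k / (2 * K) * (1 + theta)) ^ 2)))
            <= C * eps ^ 4)).
Proof.
  cbv zeta.
  assert (Hp : (1 <= p)%nat) by lia; assert (Hl : (p + k = l + 1)%nat) by lia.
  destruct (Rtotal_order (f 0) 0) as [Hn|[H0|Hpos]]; [|contradiction|].
  - apply (return_expansion_reverse k l p), return_expansion_pos; auto using analytic_opp; lra.
  - apply (return_expansion_pos k l p); auto.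
Qed.
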